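(* Let $X$ be a separable infinite dimensional Fréchet space over $\mathbb{K}$ and let $\mathcal{E}(X)$ be the set of dense linear subspaces of $X$ of infinite countable algebraic dimension, each endowed with the topology inherited from $X$. Then: (1) $X\in\mathcal{F}_0\iff\mathcal{E}(X)\cap\mathcal{M}_0\neq\varnothing\iff\mathcal{E}(X)\subseteq\mathcal{M}_0$. Furthermore, if $X\in\mathcal{F}_0$, then every $F,G\in\mathcal{E}(X)$ are isomorphic as topological vector spaces. (2) $X\notin\mathcal{F}_0\iff\mathcal{E}(X)\cap\mathcal{M}_1\neq\varnothing$, and every $E,F\in\mathcal{E}(X)\cap\mathcal{M}_1$ are isomorphic. Furthermore, $X\in\mathcal{F}_1\iff\mathcal{E}(X)\subseteq\mathcal{M}_1$. (3) $X\in\mathcal{F}_2\cup\mathcal{F}_3\iff\mathcal{E}(X)\cap\mathcal{M}_2\neq\varnothing$. If $X\in\mathcal{F}_3$, then every $E,F\in\mathcal{E}(X)\cap\mathcal{M}_2$ are isomorphic. If $X\in\mathcal{F}_2$, then $\mathcal{E}(X)\cap\mathcal{M}_2$ splits into exactly two isomorphism classes. (4) $X\in\mathcal{F}_3\iff\mathcal{E}(X)\cap\mathcal{M}_3\neq\varnothing$. If $X\in\mathcal{F}_3$, then the number of isomorphism classes in $\mathcal{E}(X)\cap\mathcal{M}_3$ is uncountable.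
   Context: $\mathbb{K}$ is either $\mathbb{R}$ or $\mathbb{C}$; all topological spaces are Hausdorff; $\mathbb{N}=\{1,2,\dots\}$. A Fréchet space is a complete metrizable locally convex space. ''Isomorphic'' means isomorphic as topological vector spaces. For a seminorm $p$, $\ker p=\{x:p(x)=0\}$. Let $\mathcal{M}$ be the class of infinite dimensional metrizable locally convex spaces. For $j\in\{0,1,2,3\}$, $X\in\mathcal{M}$ belongs to $\mathcal{M}_j$ if for some increasing sequence $\{p_n\}_{n\in\mathbb{N}}$ of seminorms on $X$ defining the topology of $X$ the following condition $(A_j)$ holds: $(A_0)$ $X/\ker p_1$ is finite dimensional and $\ker p_n/\ker p_{n+1}$ is finite dimensional for each $n\in\mathbb{N}$; $(A_1)$ there is $n\in\mathbb{N}$ such that $\ker p_n=\{0\}$; $(A_2)$ $X/\ker p_1$ is infinite dimensional, and $\ker p_n/\ker p_{n+1}$ is finite dimensional for each $n\in\mathbb{N}$ and is non-zero for infinitely many $n\in\mathbb{N}$; $(A_3)$ $\ker p_n/\ker p_{n+1}$ is infinite dimensional for infinitely many $n\in\mathbb{N}$. The classes $\mathcal{M}_0,\dots,\mathcal{M}_3$ partition $\mathcal{M}$. Let $\mathcal{F}$ be the class of separable infinite dimensional Fréchet spaces and $\mathcal{F}_j=\mathcal{F}\cap\mathcal{M}_j$ for $0\le j\le 3$. *)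

(* Defs.v *)
From HB Require Import structures.
From mathcomp Require Import all_boot all_order all_algebra.
From mathcomp Require Import all_classical all_reals all_analysis.
From mathcomp Require Import complex.

Set Implicit Arguments.
Unset Strict Implicit.
Unset Printing Implicit Defensive.

Import Order.TTheory GRing.Theory Num.Theory.
Import numFieldNormedType.Exports.

Local Open Scope classical_set_scope.
Local Open Scope ring_scope.

Variant real_or_complex : numFieldType -> Prop :=
| RealScalars (R : realType) : real_or_complex R
| ComplexScalars (R : realType) : real_or_complex R[i].

(* submodClosed X is not used because its universe is too large for the type
   [set (submodClosed X)] needed for sets of subspaces. *)
Record linear_subspace (K : numFieldType) (X : tvsType K) := LinearSubspace {
  carrier :> set X ;
  carrier_submod_closed : GRing.submod_closed [in carrier] }.

Section SubspaceTvs.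
Context (K : numFieldType) (X : tvsType K) (S : linear_subspace X).

Definition subspace_pred : {pred X} := [in carrier S].

HB.instance Definition _ :=
  GRing.isSubmodClosed.Build K X subspace_pred (carrier_submod_closed S).

Definition sub_tvs : Type := {x : X | x \in subspace_pred}.

Local Notation incl := (sval : sub_tvs -> X).

HB.instance Definition _ :=
  SubChoice.copy sub_tvs {x : X | x \in subspace_pred}.
HB.instance Definition _ := [SubChoice_isSubLmodule of sub_tvs by <:].
HB.instance Definition _ := Uniform.copy sub_tvs (initial_topology incl).

Let incl_continuous : continuous incl.
Proof. exact: initial_continuous. Qed.

Let continuous_incl (T : topologicalType) (f : T -> sub_tvs) :
  continuous (incl \o f) -> continuous f.
Proof.
move=> cf; apply/continuousP => _ [B oB <-].
by rewrite -comp_preimage; move/continuousP: cf; apply.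
Qed.

Let sub_add_continuous : continuous (fun x : sub_tvs * sub_tvs => x.1 + x.2).
Proof.
apply: continuous_incl => x.
apply: (@continuous_comp _ _ _ (fun y : sub_tvs * sub_tvs =>
  (incl y.1, incl y.2)) (fun y : X * X => y.1 + y.2)); last exact: add_continuous.
apply: cvg_pair => /=.
- by apply: continuous_comp; [exact: cvg_fst|exact: incl_continuous].
- by apply: continuous_comp; [exact: cvg_snd|exact: incl_continuous].
Qed.

Let sub_scale_continuous : continuous (fun z : K^o * sub_tvs => z.1 *: z.2).
Proof.
apply: continuous_incl => x.
apply: (@continuous_comp _ (K^o * X)%type _ (fun y : K^o * sub_tvs =>
  (y.1, incl y.2)) (fun y : K^o * X => y.1 *: y.2)); last exact: scale_continuous.
apply: (@cvg_pair _ _ _ _ (nbhs (x.1 : K^o))) => /=; first exact: cvg_fst.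
by apply: continuous_comp; [exact: cvg_snd|exact: incl_continuous].
Qed.

Let sub_locally_convex : exists2 B : set_system sub_tvs,
  (forall b, b \in B -> convex_set b) & basis B.
Proof.
have [B Bconvex [Bopen Bnbhs]] := @locally_convex K X.
exists [set incl @^-1` b | b in B].
  move=> _ /[!inE] -[b Bb <-] x y l; rewrite !inE /= => bx by_.
  have /set_mem := Bconvex b (mem_set Bb) _ _ l (mem_set bx) (mem_set by_).
  by [].
split=> [_ [b Bb <-]|x U]; first by exists b => //; exact: Bopen.
rewrite nbhsE => -[V [[W oW <-] Wx] WU].
have [b [Bb bx] bW] := Bnbhs (incl x) W (open_nbhs_nbhs (conj oW Wx)).
exists (incl @^-1` b); first by split=> //; exists b.
by move=> y /= /bW Wy; exact: WU.
Qed.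

HB.instance Definition _ :=
  PreTopologicalNmodule_isTopologicalNmodule.Build sub_tvs sub_add_continuous.
HB.instance Definition _ :=
  TopologicalNmodule_isTopologicalLmodule.Build K sub_tvs sub_scale_continuous.
HB.instance Definition _ := Uniform_isTvs.Build K sub_tvs sub_locally_convex.

End SubspaceTvs.

Section LocallyConvexSpaces.
Context (K : numFieldType).
Implicit Types E F : tvsType K.

(* A metric takes its values in the nonnegative elements of K, as the distance
   of metricType does; for K = R[i] these are the nonnegative reals. *)
Definition metrizable E := exists d : E -> E -> K,
  [/\ forall x y, 0 <= d x y,
      forall x y, d x y = 0 <-> x = y,
      forall x y, d x y = d y x,
      forall x y z, d x z <= d x y + d y z &
      forall x (U : set E),
        nbhs x U <-> exists2 e, 0 < e & [set y | d x y < e] `<=` U].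

(* tvsType only asks that its uniform structure induce the topology, so the
   library's [cauchy] need not be the linear notion: Cauchy filters are defined
   here from the neighbourhoods of 0. *)
Definition linear_cauchy E (A : set_system E) := forall U : set E, nbhs 0 U ->
  exists2 B, A B & forall x y, B x -> B y -> U (x - y).

Definition linear_complete E := forall A : set_system E,
  ProperFilter A -> linear_cauchy A -> exists x : E, A --> x.

Definition separable E := exists2 D : set E, countable D & dense D.

Definition tvs_isomorphic E F := exists (f : {linear E -> F}) (g : F -> E),
  [/\ cancel f g, cancel g f, continuous f & continuous g].

(* For subspaces V `<=` U: the quotient U / V is spanned by the cosets of
   finitely many vectors of U. *)
Definition fin_dim_quotient E (U V : set E) := exists n (s : 'I_n -> E),
  (forall i, U (s i)) /\
  forall x, U x -> exists c : 'I_n -> K, V (x - \sum_(i < n) c i *: s i).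

Definition finite_dimensional E := fin_dim_quotient [set: E] [set 0].

Definition countable_hamel_basis E (b : nat -> E) :=
  (forall n (c : 'I_n -> K), \sum_(i < n) c i *: b i = 0 -> forall i, c i = 0) /\
  forall x, exists n (c : 'I_n -> K), x = \sum_(i < n) c i *: b i.

Definition infinite_countable_dimension E :=
  exists b : nat -> E, countable_hamel_basis b.

(* The nonnegative elements of K = R[i] are the nonnegative reals. *)
Definition seminorm E (p : E -> K) :=
  [/\ forall x, 0 <= p x,
      forall x y, p (x + y) <= p x + p y &
      forall a x, p (a *: x) = `|a| * p x].

Definition ker E (p : E -> K) : set E := [set x | p x = 0].

Definition defines_topology E (p : nat -> E -> K) := forall x (U : set E),
  nbhs x U <-> exists n e, 0 < e /\
    [set y | forall i, (i <= n)%N -> p i (y - x) < e] `<=` U.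

(* The sequence starts at p 0, so that p 0 plays the role of p_1. *)
Definition defining_seminorms E (p : nat -> E -> K) :=
  [/\ forall n, seminorm (p n),
      forall n x, p n x <= p n.+1 x &
      defines_topology p].

Definition condA0 E (p : nat -> E -> K) :=
  fin_dim_quotient [set: E] (ker (p 0%N)) /\
  forall n, fin_dim_quotient (ker (p n)) (ker (p n.+1)).

Definition condA1 E (p : nat -> E -> K) := exists n, ker (p n) = [set 0].

Definition condA2 E (p : nat -> E -> K) :=
  [/\ ~ fin_dim_quotient [set: E] (ker (p 0%N)),
      forall n, fin_dim_quotient (ker (p n)) (ker (p n.+1)) &
      forall m, exists2 n, (m <= n)%N & ~ ker (p n) `<=` ker (p n.+1)].

Definition condA3 E (p : nat -> E -> K) :=
  forall m, exists2 n, (m <= n)%N &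
    ~ fin_dim_quotient (ker (p n)) (ker (p n.+1)).

Definition classM E :=
  [/\ hausdorff_space E, metrizable E & ~ finite_dimensional E].

Definition classM0 E :=
  classM E /\ exists2 p : nat -> E -> K, defining_seminorms p & condA0 p.
Definition classM1 E :=
  classM E /\ exists2 p : nat -> E -> K, defining_seminorms p & condA1 p.
Definition classM2 E :=
  classM E /\ exists2 p : nat -> E -> K, defining_seminorms p & condA2 p.
Definition classM3 E :=
  classM E /\ exists2 p : nat -> E -> K, defining_seminorms p & condA3 p.

Definition frechet E :=
  [/\ hausdorff_space E, metrizable E & linear_complete E].

Definition classF E :=
  [/\ frechet E, separable E & ~ finite_dimensional E].

Definition classF0 E := classF E /\ classM0 E.
Definition classF1 E := classF E /\ classM1 E.
Definition classF2 E := classF E /\ classM2 E.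
Definition classF3 E := classF E /\ classM3 E.

Section SubspacesOf.
Context (X : tvsType K).

Definition calE : set (linear_subspace X) := [set S : linear_subspace X |
  dense (carrier S) /\ infinite_countable_dimension (sub_tvs S)].

Definition subspaces_in (C : tvsType K -> Prop) : set (linear_subspace X) :=
  [set S : linear_subspace X | C (sub_tvs S)].

Definition pairwise_isomorphic (A : set (linear_subspace X)) :=
  forall S T, A S -> A T -> tvs_isomorphic (sub_tvs S) (sub_tvs T).

Definition isomorphism_classes (A : set (linear_subspace X)) :
    set (set (linear_subspace X)) :=
  [set A `&` [set T : linear_subspace X |
    tvs_isomorphic (sub_tvs S) (sub_tvs T)] | S in A].

End SubspacesOf.

End LocallyConvexSpaces.

Arguments calE {K} X.
Arguments subspaces_in {K} X C.

(* Main.v *)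
Require Import Defs.
From HB Require Import structures.
From mathcomp Require Import all_boot all_order all_algebra.
From mathcomp Require Import all_classical all_reals all_analysis.
From mathcomp Require Import complex.
From mathcomp Require Import ring lra zify.

(** Fix an increasing sequence of seminorms p_n defining the topology of X; the
    class M_j of X or of a dense subspace E is read off the kernels E `&` ker p_n.

    Two dense subspaces of countable dimension with E `&` ker p_n = F `&` ker p_n
    are isomorphic: a back-and-forth construction yields E -> F as a limit of maps
    T_i = (1 + psi_i (x) y_i) T_(i-1), with psi_i a p_n-bounded functional and y_i
    small; conversely every countably spanned Z in ker p_n (of infinite
    codimension) is E `&` ker p_n for some such E. So everything is about the
    subspaces Z, up to automorphisms of X.

    If all Z / (Z `&` ker p_m) are finite dimensional, then the closure of Z is a
    complemented copy of K^N with a biorthogonal basis extracted from Z, and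
    automorphisms of X exchanging two such bases give (1) and (3). In F_2 the
    two classes are told apart by whether the closure of E `&` ker p_n
    is ker p_n for large n.

    For the last claim of (4), the decay of the Gelfand widths of p_k with respect
    to p_m on E `&` ker p_n is an invariant: no E in M_3 has arbitrarily fast
    decay, but every decay rate is attained by some E in M_3, and a diagonal
    argument shows that no countable list of classes is complete. *)

(** What makes the back-and-forth work is that every psi_i is bounded by the one seminorm p_n: each
    T_i is then the identity on ker p_n, so the common trace stays fixed, and every vector of E is
    congruent modulo ker p_n to a combination of finitely many vectors whose images no longer
    change. The limit is attained at each point; the smallness of y_i keeps the maps invertible and
    makes the limit continuous. The price is that the traces must be equal, not merely isomorphic,
    hence the automorphisms of X. An automorphism exchanging two bases is built from projections
    that fix both of them, so both must generate the same complemented subspace. Traces with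
    different closures are therefore completed to bases of a common host, which requires each
    closure to have infinite codimension in it. In F_2 the host is ker p_n, and a trace whose
    closure has finite codimension there has full closure at a deeper kernel: hence two classes. In
    F_3 a host can always be enlarged by a null sequence of new vectors: hence one class. *)

Set Implicit Arguments.
Unset Strict Implicit.
Unset Printing Implicit Defensive.

Import Order.TTheory GRing.Theory Num.Theory.
Import numFieldNormedType.Exports.

Local Open Scope classical_set_scope.
Local Open Scope ring_scope.

(* Presents K = R or K = R[i] over the real field R, so that seminorms can be
   taken real valued in both cases. *)
Record scalars (K : numFieldType) (R : realType) := Scalars {
  emb :> {rmorphism R -> K} ;
  nrm : K -> R ;
  embK : forall a, emb (nrm a) = `|a| ;
  emb_le : forall s t, (emb s <= emb t) = (s <= t) ;
  scalars_cases : (forall a : K, exists s, a = emb s) \/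
    exists2 i : K, i * i = -1 & forall a : K, exists s t, a = emb s + i * emb t
}.

Lemma scalars_exist (K : numFieldType) :
  real_or_complex K -> exists R : realType, inhabited (scalars K R).
Proof.
case=> R; exists R; constructor.
- apply: (@Scalars R R idfun (fun a => `|a|)) => //.
  by left => a; exists a.
- apply: (@Scalars R[i] R (real_complex R)
    (fun a => Num.sqrt ((complex.Re a) ^+ 2 + (complex.Im a) ^+ 2))).
  + by move=> a; rewrite normc_def.
  + by move=> s t; rewrite lecR.
  + right; exists 'i%C; first by rewrite -expr2 sqr_i.
    by move=> a; exists (complex.Re a), (complex.Im a); rewrite -complexE.
Qed.

Section Scalars.
Context (K : numFieldType) (R : realType) (S : scalars K R).
Local Notation emb := (emb S).
Local Notation nrm := (nrm S).

Lemma emb_inj : injective emb.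
Proof. by move=> s t st; apply/eqP; rewrite eq_le -!(emb_le S) st lexx. Qed.

Lemma emb_lt s t : (emb s < emb t) = (s < t).
Proof. by rewrite !lt_neqAle (emb_le S) (inj_eq emb_inj). Qed.

Lemma nrm_ge0 a : 0 <= nrm a.
Proof. by rewrite -(emb_le S) rmorph0 embK. Qed.

Lemma nrmM a b : nrm (a * b) = nrm a * nrm b.
Proof. by apply: emb_inj; rewrite rmorphM !(embK S) normrM. Qed.

Lemma nrmD a b : nrm (a + b) <= nrm a + nrm b.
Proof. by rewrite -(emb_le S) rmorphD !(embK S) ler_normD. Qed.

Lemma nrm_emb_ge0 s : 0 <= s -> nrm (emb s) = s.
Proof.
by move=> s0; apply: emb_inj; rewrite (embK S) ger0_norm// -(rmorph0 emb) emb_le.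
Qed.

Lemma nrm0 : nrm 0 = 0.
Proof. by rewrite -(rmorph0 emb) nrm_emb_ge0. Qed.

Lemma nrm1 : nrm 1 = 1.
Proof. by rewrite -(rmorph1 emb) nrm_emb_ge0// ler01. Qed.

Lemma nrmN a : nrm (- a) = nrm a.
Proof. by apply: emb_inj; rewrite !(embK S) normrN. Qed.

Lemma nrm_eq0 a : nrm a = 0 -> a = 0.
Proof. by move=> a0; apply/normr0_eq0; rewrite -(embK S) a0 rmorph0. Qed.

Lemma nrm_gt0 a : a != 0 -> 0 < nrm a.
Proof.
move=> a0; rewrite lt_neqAle nrm_ge0 andbT eq_sym.
by apply: contra_neq a0; exact: nrm_eq0.
Qed.

Lemma nrmV a : nrm a^-1 = (nrm a)^-1.
Proof.
by apply: emb_inj; rewrite fmorphV !(embK S) normfV.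
Qed.

Lemma emb_ge0P a : 0 <= a -> exists2 s, 0 <= s & a = emb s.
Proof.
by move=> a0; exists (nrm a); [exact: nrm_ge0|rewrite (embK S) ger0_norm].
Qed.

Section Seminorms.
Context (X : lmodType K).
Implicit Types (p : X -> R) (f : X -> K).

Definition rseminorm p :=
  (forall x y, p (x + y) <= p x + p y) /\ forall a x, p (a *: x) = nrm a * p x.

Section OneSeminorm.
Variables (p : X -> R) (pS : rseminorm p).

Lemma snD x y : p (x + y) <= p x + p y. Proof. exact: pS.1. Qed.
Lemma snZ a x : p (a *: x) = nrm a * p x. Proof. exact: pS.2. Qed.
Lemma sn0 : p 0 = 0. Proof. by rewrite -(scale0r 0) snZ nrm0 mul0r. Qed.
Lemma snN x : p (- x) = p x.
Proof. by rewrite -scaleN1r snZ nrmN nrm1 mul1r. Qed.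
Lemma snB x y : p (x - y) <= p x + p y.
Proof. by rewrite -(snN y) snD. Qed.
Lemma snC x y : p (x - y) = p (y - x).
Proof. by rewrite -opprB snN. Qed.
Lemma sn_ge0 x : 0 <= p x.
Proof. by have := snB x x; rewrite subrr sn0; lra. Qed.
Lemma sn_tri y x z : p (x - z) <= p (x - y) + p (y - z).
Proof. by apply: le_trans (snD _ _); rewrite addrA subrK. Qed.
Lemma snDl0 x y : p x = 0 -> p (x + y) = p y.
Proof.
move=> x0; have := snD x y; have := snB (x + y) x.
rewrite (addrC x y) addrK (addrC y x) x0 addr0 add0r => le1 le2.
by apply/eqP; rewrite eq_le le1 le2.
Qed.
Lemma snDr0 x y : p y = 0 -> p (x + y) = p x.
Proof. by move=> y0; rewrite addrC snDl0. Qed.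
Lemma snBr0 x y : p y = 0 -> p (x - y) = p x.
Proof. by move=> y0; rewrite snDr0 ?snN. Qed.
Lemma sn_kerD x y : p x = 0 -> p y = 0 -> p (x + y) = 0.
Proof. by move=> x0 y0; rewrite snDl0. Qed.
Lemma sn_kerB x y : p x = 0 -> p y = 0 -> p (x - y) = 0.
Proof. by move=> x0 y0; rewrite snBr0. Qed.
Lemma sn_kerZ a x : p x = 0 -> p (a *: x) = 0.
Proof. by move=> x0; rewrite snZ x0 mulr0. Qed.
Lemma sn_sum I (r : seq I) (P : pred I) (F : I -> X) :
  p (\sum_(i <- r | P i) F i) <= \sum_(i <- r | P i) p (F i).
Proof.
elim/big_rec2: _ => [|i y x _ IH]; first by rewrite sn0.
by rewrite (le_trans (snD _ _))// lerD2l.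
Qed.
Lemma sn_ker_sum I (r : seq I) (P : pred I) (F : I -> X) :
  (forall i, P i -> p (F i) = 0) -> p (\sum_(i <- r | P i) F i) = 0.
Proof.
move=> F0; elim/big_rec: _ => [|i x Pi IH]; first by rewrite sn0.
by rewrite sn_kerD// F0.
Qed.
End OneSeminorm.

End Seminorms.
End Scalars.

(** * Hahn-Banach for real and complex scalars *)

Section HahnBanach.
Context (K : numFieldType) (R : realType) (S : scalars K R).
Local Notation emb := (emb S).
Local Notation nrm := (nrm S).
Context (X : lmodType K) (p : X -> R) (pS : rseminorm S p) (x0 : X).

(* Partial real-linear functionals dominated by p are handled through their
   graphs; such a graph is automatically functional. *)
Let adm (G : set (X * R)) :=
  [/\ forall u v, G u -> G v -> G (u.1 + v.1, u.2 + v.2),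
      forall t u, G u -> G (emb t *: u.1, t * u.2),
      forall u, G u -> u.2 <= p u.1 &
      G !=set0 -> G (x0, p x0)].

Let dominated_real_functional : exists u : X -> R,
  [/\ forall x y, u (x + y) = u x + u y,
      forall t x, u (emb t *: x) = t * u x,
      forall x, u x <= p x & u x0 = p x0].
Proof.
have [|G [[GD GZ Gp Gx0] Gmax]] := @Zorn_bigcup (X * R)%type adm.
  move=> F Fadm Ftot; split.
  - move=> u v [A FA Au] [B FB Bv]; have [AB|BA] := Ftot _ _ FA FB.
      by exists B => //; have [+ _ _ _] := Fadm _ FB; apply => //; exact: AB.
    by exists A => //; have [+ _ _ _] := Fadm _ FA; apply => //; exact: BA.
  - by move=> t u [A FA Au]; exists A => //; have [_ + _ _] := Fadm _ FA; apply.
  - by move=> u [A FA Au]; have [_ _ + _] := Fadm _ FA; apply.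
  - move=> [u [A FA Au]]; exists A => //.
    by have [_ _ _] := Fadm _ FA; apply; exists u.
(* The last clause of [adm] is conditional because the union of the empty chain must be admissible.
   A maximal graph is not empty: the real line through [x0] would extend it. *)
have G0 : G (x0, p x0).
  apply: Gx0; apply: contrapT => /set0P/negP/negPn/eqP GE.
  apply: (Gmax [set u | exists t, u = (emb t *: x0, t * p x0)]).
    rewrite GE; split=> // /(_ (x0, p x0)); apply.
    by exists 1; rewrite rmorph1 scale1r mul1r.
  split.
  - move=> _ _ [s ->] [t ->]; exists (s + t).
    by rewrite rmorphD scalerDl mulrDl.
  - by move=> t _ [s ->]; exists (t * s); rewrite rmorphM scalerA mulrA.
  - move=> _ [t ->] /=; rewrite (snZ pS) ler_wpM2r ?(sn_ge0 pS)//.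
    have [t0|t0] := leP 0 t; first by rewrite nrm_emb_ge0.
    by rewrite (le_trans (ltW t0))// nrm_ge0.
  - by move=> _; exists 1; rewrite rmorph1 scale1r mul1r.
have GN u : G u -> G (- u.1, - u.2).
  by move=> /(GZ (-1)); rewrite rmorphN rmorph1 scaleN1r mulN1r.
have Gdom x : exists a, G (x, a).
  apply: contrapT => nx.
  (* If [x] is outside the domain, any value [c] at [x] between all [u.2 - p (u.1 - x)] and all
     [p (v.1 + x) - v.2] extends the graph; the supremum of the lower bounds is one. *)
  pose A := [set u.2 - p (u.1 - x) | u in G].
  have Aub c : (forall u, G u -> u.2 - p (u.1 - x) <= c) -> ubound A c.
    by move=> cP _ [u Gu <-]; exact: cP.
  have key u v : G u -> G v -> u.2 - p (u.1 - x) <= p (v.1 + x) - v.2.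
    move=> Gu Gv; have /= := Gp _ (GD _ _ Gu Gv).
    have := snD pS (u.1 - x) (v.1 + x).
    by rewrite addrACA addNr addr0; lra.
  have A0 : A !=set0 by exists (p x0 - p (x0 - x)); exists (x0, p x0).
  have supA : has_sup A.
    by split => //; eexists; apply: Aub => u Gu; exact: (key _ _ Gu G0).
  pose c := sup A.
  have c1 u : G u -> u.2 - p (u.1 - x) <= c.
    by move=> Gu; apply: ub_le_sup; [case: supA|exists u].
  have c2 v : G v -> c <= p (v.1 + x) - v.2.
    by move=> Gv; apply: ge_sup => //; apply: Aub => u Gu; exact: key.
  apply: (Gmax [set w | exists u t, G u /\ w = (u.1 + emb t *: x, u.2 + t * c)]).
    split=> [w Gw|].
      exists w, 0; split=> //; rewrite rmorph0 scale0r mul0r !addr0.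
      by case: (w).
    move=> /(_ (x, c)) H; apply: nx; exists c; apply: H.
    exists (0, 0), 1; split; last by rewrite rmorph1 scale1r mul1r !add0r.
    by have := GZ 0 _ G0; rewrite /= rmorph0 scale0r mul0r.
  split.
  - move=> _ _ [u [s [Gu ->]]] [v [t [Gv ->]]].
    exists (u.1 + v.1, u.2 + v.2), (s + t); split; first exact: GD.
    by rewrite /= rmorphD scalerDl mulrDl addrACA (addrACA u.2).
  - move=> t _ [u [s [Gu ->]]]; exists (emb t *: u.1, t * u.2), (t * s).
    split; first exact: GZ.
    by rewrite /= scalerDr scalerA -rmorphM mulrDr mulrA.
  - move=> _ [u [t [Gu ->]]] /=.
    have [t0|t0|->] := ltrgtP t 0; last first.
    + by rewrite rmorph0 scale0r mul0r !addr0; exact: Gp.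
    + have := c2 _ (GZ t^-1 _ Gu) => /=.
      have -> : u.1 + emb t *: x = emb t *: (emb t^-1 *: u.1 + x).
        rewrite scalerDr scalerA -rmorphM divff ?gt_eqF// rmorph1 scale1r.
        by [].
      rewrite (snZ pS) (nrm_emb_ge0 _ (ltW _))//.
      set q := p _ => cq.
      have : t * c <= t * (q - t^-1 * u.2) by rewrite ler_pM2l.
      by rewrite mulrBr mulrA divff ?gt_eqF// mul1r; lra.
    + have t1 : 0 < - t by rewrite oppr_gt0.
      have := c1 _ (GZ (- t)^-1 _ Gu) => /=.
      have -> : u.1 + emb t *: x = emb (- t) *: (emb (- t)^-1 *: u.1 - x).
        rewrite scalerBr scalerA -rmorphM divff ?gt_eqF// rmorph1 scale1r.
        by rewrite rmorphN scaleNr opprK.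
      rewrite (snZ pS) (nrm_emb_ge0 _ (ltW _))//.
      set q := p _ => cq.
      have : (- t) * ((- t)^-1 * u.2 - q) <= (- t) * c by rewrite ler_pM2l.
      by rewrite mulrBr mulrA divff ?gt_eqF// mul1r; lra.
  - move=> _; exists (x0, p x0), 0; split => //.
    by rewrite rmorph0 scale0r mul0r !addr0.
have [u uP] := choice Gdom.
have Gfun x a b : G (x, a) -> G (x, b) -> a = b.
  have Gfun1 c d : G (x, c) -> G (x, d) -> c <= d.
    by move=> Gc Gd; have /= := Gp _ (GD _ _ Gc (GN _ Gd)); rewrite subrr (sn0 pS); lra.
  by move=> Ga Gb; apply/eqP; rewrite eq_le !Gfun1.
exists u; split.
- by move=> x y; apply: Gfun (uP _) _; exact: (GD _ _ (uP x) (uP y)).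
- by move=> t x; apply: Gfun (uP _) _; exact: (GZ t _ (uP x)).
- by move=> x; exact: (Gp _ (uP x)).
- exact: Gfun (uP _) G0.
Qed.

(** A complex functional is recovered from its real part [u] as [u x - i u (i x)], and rotating
    [f x] onto the positive axis turns the bound on the real part into one on the modulus. Dividing
    by [f x0] normalises it, at the cost of the constant [C]. *)
Lemma hahn_banach1 : p x0 != 0 -> exists f : X -> K,
  [/\ scalar f, exists C, forall x, nrm (f x) <= C * p x & f x0 = 1].
Proof.
move=> px0.
have [u [uD uZ up ux0]] := dominated_real_functional.
have nrm_fun (f : X -> K) : scalar f -> (forall x s, f x = emb s -> s <= p x) ->
    forall x, nrm (f x) <= p x.
  move=> fl fp x; have [->|fx0] := eqVneq (f x) 0.
    by rewrite nrm0 (sn_ge0 pS).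
  have fZ a y : f (a *: y) = a * f y.
    have f0 : f 0 = 0.
      have := fl 1 0 0; rewrite scaler0 addr0 mul1r => /eqP.
      by rewrite -subr_eq0 opprD addrA subrr sub0r oppr_eq0 => /eqP.
    by have := fl a y 0; rewrite addr0 f0 addr0.
  have := fp ((emb (nrm (f x)) / f x) *: x) (nrm (f x)).
  rewrite fZ divfK// => /(_ erefl) /le_trans; apply.
  rewrite (snZ pS) nrmM nrmV nrm_emb_ge0 ?nrm_ge0// divff ?mul1r//.
  by rewrite gt_eqF// nrm_gt0.
have normalize (f : X -> K) : scalar f -> (forall x, nrm (f x) <= p x) ->
    f x0 != 0 -> exists f : X -> K,
    [/\ scalar f, exists C, forall x, nrm (f x) <= C * p x & f x0 = 1].
  move=> fl fp fx0; exists (fun x => (f x0)^-1 * f x); split.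
  - by move=> a x y; rewrite fl mulrDr mulrCA.
  - by exists (nrm (f x0))^-1 => x; rewrite nrmM nrmV ler_wpM2l// invr_ge0 nrm_ge0.
  - by rewrite mulVf.
have uN x : u (- x) = - u x.
  by have := uZ (-1) x; rewrite rmorphN rmorph1 scaleN1r mulN1r.
case: (scalars_cases S) => [allreal|[i ii dec]].
  have fl : scalar (emb \o u).
    move=> a x y /=; rewrite uD rmorphD; have [s ->] := allreal a.
    by rewrite uZ rmorphM.
  apply: (@normalize (emb \o u)) => //=.
    by apply: nrm_fun => // x s /emb_inj <-.
  by rewrite ux0 -(rmorph0 emb) (inj_eq (@emb_inj _ _ S)).
have i_real s t : emb s + i * emb t = 0 -> s = 0 /\ t = 0.
  move=> st; have : emb (s * s + t * t) = 0.
    rewrite rmorphD !rmorphM.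
    have -> : emb s = - (i * emb t) by apply/eqP; rewrite -addr_eq0 st.
    by rewrite mulrNN mulrACA ii mulN1r addNr.
  rewrite -(rmorph0 emb) => /emb_inj/eqP.
  by rewrite paddr_eq0 ?mulf_eq0 ?orbb -?expr2 ?sqr_ge0// =>
    /andP[/eqP -> /eqP ->].
pose f x := emb (u x) - i * emb (u (i *: x)).
have fl : scalar f.
  move=> a x y; rewrite /f; have [s [t ->]] := dec a.
  have Ei z : i *: (i *: z) = - z by rewrite scalerA ii scaleN1r.
  have E1 : u ((emb s + i * emb t) *: x + y) = s * u x + t * u (i *: x) + u y.
    by rewrite uD scalerDl uD uZ [i * _]mulrC -scalerA uZ.
  have E2 : u (i *: ((emb s + i * emb t) *: x + y)) =
      s * u (i *: x) - t * u x + u (i *: y).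
    rewrite scalerDr uD scalerA mulrDr mulrA ii mulN1r scalerDl uD scaleNr uN.
    by rewrite [i * _]mulrC -scalerA !uZ.
  rewrite E1 E2 !rmorphD rmorphN !rmorphM.
  have -> : emb t * emb (u (i *: x)) = - (i * i * emb t * emb (u (i *: x))).
    by rewrite ii mulN1r mulNr opprK.
  by ring.
have fp : forall x, nrm (f x) <= p x.
  apply: nrm_fun => // x s fxs.
  have : emb (u x - s) + i * emb (- u (i *: x)) = 0.
    by rewrite rmorphB rmorphN -fxs /f mulrN; ring.
  by move=> /i_real[/eqP]; rewrite subr_eq0 => /eqP <-.
have fx0 : f x0 != 0.
  apply/eqP => f0.
  have : emb (u x0) + i * emb (- u (i *: x0)) = 0 by rewrite rmorphN mulrN.
  by move=> /i_real[+ _]; rewrite ux0 => /eqP; rewrite (negbTE px0).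
exact: normalize fx0.
Qed.

End HahnBanach.

(** * Spans and finite dimensional quotients *)

Section LinearAlgebra.
Context (K : fieldType) (X : lmodType K).
Implicit Types (U V W : set X) (L : seq X) (x y z : X) (v : nat -> X).

Definition subsp V := V 0 /\ forall a x y, V x -> V y -> V (a *: x + y).

Section Subsp.
Variables (V : set X) (sV : subsp V).
Lemma subsp0 : V 0. Proof. by case: sV. Qed.
Lemma subspD x y : V x -> V y -> V (x + y).
Proof. by case: sV => _ + Vx Vy => /(_ 1 _ _ Vx Vy); rewrite scale1r. Qed.
Lemma subspZ a x : V x -> V (a *: x).
Proof. by case: sV => V0 + Vx => /(_ a _ _ Vx V0); rewrite addr0. Qed.
Lemma subspN x : V x -> V (- x).
Proof. by move=> /(subspZ (-1)); rewrite scaleN1r. Qed.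
Lemma subspB x y : V x -> V y -> V (x - y).
Proof. by move=> Vx /subspN; exact: subspD. Qed.
Lemma subsp_sum I (r : seq I) (P : pred I) (F : I -> X) :
  (forall i, P i -> V (F i)) -> V (\sum_(i <- r | P i) F i).
Proof.
by move=> VF; apply: big_ind => //; [exact: subsp0|exact: subspD].
Qed.
End Subsp.

Lemma subspT : subsp setT. Proof. by []. Qed.
Lemma subsp_set0 : subsp [set 0].
Proof. by split=> // a x y -> ->; rewrite scaler0 addr0. Qed.
Lemma subspI V W : subsp V -> subsp W -> subsp (V `&` W).
Proof.
move=> [V0 sV] [W0 sW]; split=> // a x y [Vx Wx] [Vy Wy].
by split; [exact: sV|exact: sW].
Qed.

Fixpoint lspan L : set X :=
  if L is x :: L' then [set y | exists a, lspan L' (y - a *: x)] else [set 0].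

Lemma subsp_lspan L : subsp (lspan L).
Proof.
elim: L => [|z L sL] /=; first exact: subsp_set0.
split; first by exists 0; rewrite scale0r subr0; exact: subsp0.
move=> a x y [b xb] [c yc]; exists (a * b + c).
rewrite scalerDl -scalerA opprD addrACA -scalerBr.
by apply: (subspD sL) => //; exact: subspZ.
Qed.

Lemma lspan_cons x L y : lspan L y -> lspan (x :: L) y.
Proof. by move=> Ly; exists 0; rewrite scale0r subr0. Qed.

Lemma mem_lspan L x : x \in L -> lspan L x.
Proof.
elim: L => //= y L IH; rewrite inE => /predU1P[->|xL].
  by exists 1; rewrite scale1r subrr; exact: (subsp0 (subsp_lspan L)).
by apply/lspan_cons/IH.
Qed.

Lemma lspan_sub L V : subsp V -> (forall x, x \in L -> V x) -> lspan L `<=` V.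
Proof.
move=> sV; elim: L => [|z L IH] LV y /=; first by move=> ->; exact: subsp0.
move=> [a ya]; rewrite -(subrK (a *: z) y); apply: subspD => //.
  by apply: IH => // x xL; apply: LV; rewrite inE xL orbT.
by apply: subspZ => //; apply: LV; rewrite inE eqxx.
Qed.

Lemma lspan_subset L L' : {subset L <= L'} -> lspan L `<=` lspan L'.
Proof.
by move=> LL'; apply: lspan_sub (subsp_lspan _) _ => x /LL'; exact: mem_lspan.
Qed.

Lemma lspan_cat L L' y :
  lspan (L ++ L') y <-> exists2 z, lspan L z & lspan L' (y - z).
Proof.
elim: L y => [|x L IH] y /=.
  by split=> [Ly|[z ->]]; [exists 0; rewrite ?subr0|rewrite subr0].
split=> [[a /IH[z Lz L'z]]|[z [a Lz] L'z]].
  exists (z + a *: x); first by exists a; rewrite addrK.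
  by rewrite opprD addrA addrAC.
exists a; apply/IH; exists (z - a *: x) => //.
by rewrite opprB addrA subrK.
Qed.

Lemma lspan_rcons L x y :
  lspan (rcons L x) y <-> exists a, lspan L (y - a *: x).
Proof.
rewrite -cats1; split => [/lspan_cat[z Lz /= [a E]]|[a La]].
  exists a; suff -> : y - a *: x = (y - z - a *: x) + z by rewrite E add0r.
  by rewrite addrAC subrK.
apply/lspan_cat; exists (y - a *: x) => //=.
by exists a; rewrite subKr subrr.
Qed.

Definition comb (c : nat -> K) v n := \sum_(i < n) c i *: v i.

Lemma combS c v n : comb c v n.+1 = comb c v n + c n *: v n.
Proof. by rewrite /comb big_ord_recr. Qed.

Lemma eq_comb c c' v v' n : (forall i, (i < n)%N -> c i = c' i) ->
  (forall i, (i < n)%N -> v i = v' i) -> comb c v n = comb c' v' n.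
Proof. by move=> cc' vv'; apply: eq_bigr => i _; rewrite cc' ?vv'. Qed.

Lemma lspan_comb v n y : lspan (mkseq v n) y <-> exists c, y = comb c v n.
Proof.
elim: n y => [|n IH] y.
  rewrite /comb /=; split => [->|[c ->]]; last by rewrite big_ord0.
  by exists (fun=> 0); rewrite big_ord0.
rewrite mkseqS lspan_rcons; split => [[a /IH[c yc]]|[c ->]].
  exists (fun i => if i == n then a else c i); rewrite combS eqxx.
  rewrite -(subrK (a *: v n) y) yc; congr (_ + _); apply: eq_comb => // i.
  by move=> /ltn_eqF ->.
by exists (c n); rewrite combS addrK; apply/IH; exists c.
Qed.

Definition cspan v : set X := [set x | exists n, lspan (mkseq v n) x].

Lemma lspan_mkseq_le v m n : (m <= n)%N ->
  lspan (mkseq v m) `<=` lspan (mkseq v n).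
Proof.
move=> mn; apply: lspan_subset => _ /mapP[i + ->].
rewrite mem_iota => /andP[_ im]; apply: map_f.
by rewrite mem_iota (leq_trans im).
Qed.

Lemma lspan_mkseq_mem v n i : (i < n)%N -> lspan (mkseq v n) (v i).
Proof. by move=> in_; apply: mem_lspan; apply: map_f; rewrite mem_iota. Qed.

Lemma subsp_cspan v : subsp (cspan v).
Proof.
split; first by exists 0%N.
move=> a x y [m mx] [n ny]; exists (maxn m n).
apply: (subspD (subsp_lspan _)).
  apply: (subspZ (subsp_lspan _)).
  by apply: lspan_mkseq_le mx; exact: leq_maxl.
by apply: lspan_mkseq_le ny; exact: leq_maxr.
Qed.

Lemma mem_cspan v i : cspan v (v i).
Proof. by exists i.+1; apply: lspan_mkseq_mem. Qed.

Lemma cspan_sub v V : subsp V -> (forall i, V (v i)) -> cspan v `<=` V.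
Proof. by move=> sV vV y [n]; apply: lspan_sub => // _ /mapP[i _ ->]. Qed.

Definition indep V n v :=
  forall c, V (comb c v n) -> forall i, (i < n)%N -> c i = 0.

Lemma indep_le V m n v : (m <= n)%N -> indep V n v -> indep V m v.
Proof.
move=> mn iv c cV i im.
have := iv (fun i => if (i < m)%N then c i else 0).
rewrite /comb -(subnKC mn) big_split_ord /= [X in _ + X]big1 ?addr0; last first.
  by move=> j _; rewrite ltnNge leq_addr scale0r.
under eq_bigr => j _ do rewrite ltn_ord.
move=> /(_ cV i); rewrite im; apply.
by rewrite subnKC// (leq_trans im).
Qed.

Lemma row_dependence m n (A : 'M[K]_(m, n)) : (n < m)%N ->
  exists2 c : 'rV_m, c != 0 & c *m A = 0.
Proof.
move=> nm; have /rowV0Pn[c /sub_kermxP cA c0] : kermx A != 0.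
  by rewrite -mxrank_eq0 mxrank_ker subn_eq0 -ltnNge (leq_ltn_trans (rank_leq_col A)).
by exists c.
Qed.

(** For subspaces, U / (U [&] V) has finite dimension: [V] need not lie in [U], which allows
    [fdq E (kerp p m)]. *)
Definition fdq U V := exists2 L, forall x, x \in L -> U x &
  forall x, U x -> exists2 y, lspan L y & V (x - y).

(** The coefficients of the [v i] modulo [V] form a matrix with one row more than columns, and a
    vanishing combination of its rows is a dependence modulo [V]. *)
Lemma spanned_not_indep U V L : subsp V ->
    (forall x, U x -> exists2 y, lspan L y & V (x - y)) ->
  forall v, (forall i, (i < (size L).+1)%N -> U (v i)) ->
    ~ indep V (size L).+1 v.
Proof.
move=> sV Lgen v vU iv.
have gen i : exists c : nat -> K, (i < (size L).+1)%N ->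
    V (v i - comb c (nth 0 L) (size L)).
  have [ilt|_] := boolP (i < (size L).+1)%N; last by exists (fun=> 0).
  have [y + Vy] := Lgen _ (vU _ ilt).
  by rewrite -{1}(mkseq_nth 0 L) => /lspan_comb[c yc]; exists c; rewrite -yc.
have [c cP] := choice gen.
pose A := (\matrix_(i < (size L).+1, j < size L) c i j).
have [r r0 rA] := @row_dependence _ _ A (ltnSn _).
pose d i := if insub i is Some j then r 0 (j : 'I_(size L).+1) else 0.
have dE (j : 'I_(size L).+1) : d j = r 0 j by rewrite /d valK.
move: r0 => /negP; apply; apply/eqP/rowP => j; rewrite mxE -dE.
apply: (iv d) => //; rewrite /comb.
suff -> : \sum_(i < (size L).+1) d i *: v i =
   \sum_(i < (size L).+1) d i *: (v i - comb (c i) (nth 0 L) (size L)).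
  apply: subsp_sum => // i _; apply: subspZ => //; exact: cP.
under [RHS]eq_bigr => i _ do rewrite scalerBr.
rewrite sumrB [X in _ - X](_ : _ = 0) ?subr0//.
under eq_bigr => i _ do rewrite scaler_sumr.
rewrite exchange_big big1//= => k _.
under eq_bigr => i _ do rewrite scalerA.
rewrite -scaler_suml [X in X *: _](_ : _ = 0) ?scale0r//.
have := congr1 (fun M : 'rV_ _ => M 0 k) rA; rewrite !mxE => E; rewrite -[RHS]E.
by apply: eq_bigr => i _; rewrite dE mxE.
Qed.

(** A longest family in [U] independent modulo [V] spans [U] modulo [V]. This form mentions no
    generators that must lie in [U], so finiteness passes to smaller [U]. *)
Lemma fdq_indep U V : subsp V ->
  fdq U V <-> exists N, forall v, (forall i, (i < N)%N -> U (v i)) -> ~ indep V N v.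
Proof.
move=> sV; split=> [[L LU Lgen]|].
  by exists (size L).+1; exact: spanned_not_indep.
move=> exN; have [N NP] : exists N, forall v,
   (forall i, (i < N)%N -> U (v i)) -> ~ indep V N v by exact: exN.
elim: N NP => [|N IH] NP.
  by exfalso; apply: (NP (fun=> 0)).
have [NP'|] := pselect (forall v, (forall i, (i < N)%N -> U (v i)) -> ~ indep V N v).
  exact: IH.
move=> /existsNP[v /not_implyP[vU /contrapT iv]].
exists (mkseq v N).
  by move=> _ /mapP[i + ->]; rewrite mem_iota => /andP[_]; exact: vU.
move=> x Ux.
pose w i := if i == N then x else v i.
have wU i : (i < N.+1)%N -> U (w i).
  by rewrite /w ltnS leq_eqVlt; case: eqP => //= _; exact: vU.
have /existsNP[c /not_implyP[cV /existsNP[i /not_implyP[iN ci0]]]] := NP _ wU.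
have cE : comb c w N.+1 = comb c v N + c N *: x.
  rewrite combS /w eqxx; congr (_ + _); apply: eq_comb => // j.
  by move=> /ltn_eqF ->.
have cN0 : c N != 0.
  apply/eqP => cN0; move: cV; rewrite cE cN0 scale0r addr0 => cV.
  move: iN; rewrite ltnS leq_eqVlt => /predU1P[iN|iN]; first by apply: ci0; rewrite iN.
  by apply: ci0; exact: iv cV _ iN.
exists (- (c N)^-1 *: comb c v N).
  apply: (subspZ (subsp_lspan _)); apply/lspan_comb; by exists c.
rewrite scaleNr opprK.
have := subspZ sV (c N)^-1 cV.
by rewrite cE scalerDr scalerA mulVf// scale1r addrC.
Qed.

Lemma not_fdq U V : subsp V -> ~ fdq U V ->
  forall N, exists2 v, forall i, (i < N)%N -> U (v i) & indep V N v.
Proof.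
move=> sV nf N; apply: contrapT => H; apply: nf; apply/fdq_indep => //.
by exists N => v vU iv; apply: H; exists v.
Qed.

Lemma fdq_subl U U' V : subsp V -> U' `<=` U -> fdq U V -> fdq U' V.
Proof.
move=> sV UU' /fdq_indep -/(_ sV)[N NP]; apply/fdq_indep => //.
by exists N => v vU'; apply: NP => i /vU'; exact: UU'.
Qed.

Lemma fdq_subr U V V' : V `<=` V' -> fdq U V -> fdq U V'.
Proof. by move=> VV' [L LU Lg]; exists L => // x /Lg[y Ly /VV']; exists y. Qed.

Lemma fdq_trans U V W : subsp U -> fdq U V -> fdq (U `&` V) W -> fdq U W.
Proof.
move=> sU [L LU Lg] [L' L'UV L'g]; exists (L ++ L').
  by move=> x; rewrite mem_cat => /orP[/LU//|/L'UV[]].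
move=> x Ux; have [y Ly Vxy] := Lg _ Ux.
have Uxy : U (x - y) by apply: (subspB sU) => //; exact: (lspan_sub sU LU).
have [z L'z Wz] := L'g _ (conj Uxy Vxy).
exists (y + z); last by rewrite opprD addrA.
by apply/lspan_cat; exists y => //; rewrite addrAC subrr add0r.
Qed.

Lemma fdq_notsub U V L : subsp U -> subsp V -> ~ fdq U V ->
  exists2 x, U x & forall y, lspan L y -> ~ V (x - y).
Proof.
move=> sU sV nf; apply: contrapT => H; apply: nf.
apply: (@fdq_subr _ (V)) => //.
suff : exists N, forall v, (forall i, (i < N)%N -> U (v i)) -> ~ indep V N v.
  by move=> /fdq_indep; apply.
have gen x : U x -> exists2 y, lspan L y & V (x - y).
  move=> Ux; apply: contrapT => H'; apply: H; exists x => // y Ly Vy.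
  by apply: H'; exists y.
pose T : set X := [set x | exists2 y, lspan L y & V (x - y)].
have : fdq T V.
  exists L.
    move=> x xL; exists x; first exact: mem_lspan.
    by rewrite subrr; exact: subsp0.
  by [].
move=> /(fdq_subl sV gen) /fdq_indep; exact.
Qed.

End LinearAlgebra.

Section LinearMaps.
Context (K : fieldType) (X : lmodType K).

Section Scalar.
Variables (f : X -> K) (fl : scalar f).
Lemma scal0 : f 0 = 0.
Proof.
have := fl 1 0 0; rewrite scaler0 addr0 mul1r => /eqP.
by rewrite -subr_eq0 opprD addrA subrr sub0r oppr_eq0 => /eqP.
Qed.
Lemma scalD x y : f (x + y) = f x + f y.
Proof. by rewrite -{1}(scale1r x) fl mul1r. Qed.
Lemma scalZ a x : f (a *: x) = a * f x.
Proof. by rewrite -{1}(addr0 (a *: x)) fl scal0 addr0. Qed.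
Lemma scalN x : f (- x) = - f x.
Proof. by rewrite -scaleN1r scalZ mulN1r. Qed.
Lemma scalB x y : f (x - y) = f x - f y.
Proof. by rewrite scalD scalN. Qed.
Lemma scal_sum I (r : seq I) (P : pred I) (F : I -> X) :
  f (\sum_(i <- r | P i) F i) = \sum_(i <- r | P i) f (F i).
Proof. by apply: big_morph; [exact: scalD|exact: scal0]. Qed.
Lemma scal_ker_lspan L y : (forall x, x \in L -> f x = 0) -> lspan L y -> f y = 0.
Proof.
move=> fL; apply: (@lspan_sub _ _ _ [set x | f x = 0]) => //.
by split=> [|a u w /= fu fw]; rewrite /= ?scal0// fl fu fw mulr0 addr0.
Qed.
End Scalar.

Section Linear.
Variables (Y : lmodType K) (f : X -> Y) (fl : linear f).
Lemma lin0 : f 0 = 0.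
Proof.
have := fl 1 0 0; rewrite scaler0 addr0 scale1r => /eqP.
by rewrite -subr_eq0 opprD addrA subrr sub0r oppr_eq0 => /eqP.
Qed.
Lemma linD x y : f (x + y) = f x + f y.
Proof. by rewrite -{1}(scale1r x) fl scale1r. Qed.
Lemma linZ a x : f (a *: x) = a *: f x.
Proof. by rewrite -{1}(addr0 (a *: x)) fl lin0 addr0. Qed.
Lemma linN x : f (- x) = - f x.
Proof. by rewrite -scaleN1r linZ scaleN1r. Qed.
Lemma linB x y : f (x - y) = f x - f y.
Proof. by rewrite linD linN. Qed.
Lemma lin_sum I (r : seq I) (P : pred I) (F : I -> X) :
  f (\sum_(i <- r | P i) F i) = \sum_(i <- r | P i) f (F i).
Proof. by apply: big_morph; [exact: linD|exact: lin0]. Qed.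
Lemma lin_lspan L y : lspan L y -> lspan (map f L) (f y).
Proof.
elim: L y => [|x L IH] y /=; first by move=> ->; exact: lin0.
by move=> [a /IH]; rewrite linB linZ; exists a.
Qed.
End Linear.
End LinearMaps.

(** * Bounded functionals and separation from finite dimensional spans *)

Section Separation.
Context (K : numFieldType) (R : realType) (S : scalars K R).
Local Notation nrm := (nrm S).
Context (X : lmodType K) (p : X -> R) (pS : rseminorm S p).

Definition bounded (f : X -> K) := exists C, forall x, nrm (f x) <= C * p x.

Lemma boundedP f : bounded f ->
  exists2 C, 0 < C & forall x, nrm (f x) <= C * p x.
Proof.
move=> [C CP]; exists (`|C| + 1); first by rewrite ltr_wpDl.
move=> x; rewrite (le_trans (CP x))// ler_wpM2r ?(sn_ge0 pS)//.
by rewrite (le_trans (ler_norm _))// lerDl.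
Qed.

Lemma bounded_ker f x : bounded f -> p x = 0 -> f x = 0.
Proof.
move=> [C CP] px; apply: (@nrm_eq0 _ _ S); apply/eqP.
by rewrite eq_le nrm_ge0 andbT (le_trans (CP x))// px mulr0.
Qed.

Lemma boundedZB f g a : bounded f -> bounded g -> bounded (fun x => f x - a * g x).
Proof.
move=> [C CP] [D DP]; exists (C + nrm a * D) => x.
rewrite (le_trans (nrmD _ _ _))// nrmN nrmM mulrDl -mulrA lerD//.
by rewrite ler_wpM2l ?nrm_ge0.
Qed.

(** Induction on [L]. If [l] is new, take [f] killing [L] with value 1 at [l], and [g] killing [L]
    with value 1 at [x - f x *: l]; then [g - g l * f] also kills [l] and is 1 at [x]. *)
Lemma separation L x : (forall y, lspan L y -> p (x - y) != 0) ->
  exists f, [/\ scalar f, bounded f, forall y, y \in L -> f y = 0 & f x = 1].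
Proof.
elim: L x => [|l L IH] x H.
  have [//|f [fl fb fx]] := @hahn_banach1 _ _ S _ _ pS x.
    by have := H 0 erefl; rewrite subr0.
  by exists f.
have [[y Ly yp]|Hl] := pselect (exists2 y, lspan L y & p (l - y) = 0).
  have [|f [fl fb fL fx]] := IH x.
    by move=> z Lz; apply: H; exact: lspan_cons.
  exists f; split => // z; rewrite inE => /predU1P[->|]; last exact: fL.
  rewrite -(subrK y l) (scalD fl) (bounded_ker fb yp) add0r.
  exact: (scal_ker_lspan fl fL Ly).
have [|f [fl fb fL fL1]] := IH l.
  by move=> y Ly; apply/eqP => py; apply: Hl; exists y.
have [|g [gl gb gL gx]] := IH (x - f x *: l).
  move=> y Ly; rewrite -addrA -opprD; apply: H.
  by exists (f x); rewrite addrAC subrr add0r.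
exists (fun z => g z - g l * f z); split.
- by move=> a u w; rewrite gl fl; ring.
- exact: boundedZB.
- move=> z; rewrite inE => /predU1P[->|zL]; first by rewrite fL1 mulr1 subrr.
  by rewrite gL// fL// mulr0 subrr.
- by move: gx; rewrite (scalB gl) (scalZ gl) => <-; rewrite mulrC.
Qed.

Lemma subsp_ker : subsp [set x | p x = 0].
Proof.
split=> [|a x y px py] /=; first exact: (sn0 pS).
by rewrite (sn_kerD pS)// (sn_kerZ pS).
Qed.

(** Duality in place of compactness: a functional killing [L], equal to 1 at [x] and bounded by
    [C p], keeps [x] at distance at least [1 / C] from the span. *)
Lemma lspan_ker_closed L x :
  (forall e, 0 < e -> exists2 y, lspan L y & p (x - y) < e) ->
  exists2 y, lspan L y & p (x - y) = 0.
Proof.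
move=> H; apply: contrapT => nH.
have [|f [fl /boundedP[C C0 CP] fL fx]] := @separation L x.
  by move=> y Ly; apply/eqP => py; apply: nH; exists y.
have [|y Ly] := H C^-1; first by rewrite invr_gt0.
rewrite -(ltr_pM2l C0) divff ?gt_eqF// ltNge => /negP; apply.
by rewrite (le_trans _ (CP _))// (scalB fl) fx (scal_ker_lspan fl fL Ly) subr0 nrm1.
Qed.

End Separation.

Lemma history_choice (T : Type) (P : seq T -> T -> Prop) :
  (forall s, exists x, P s x) -> exists b, forall n, P (mkseq b n) (b n).
Proof.
move=> /choice[g gP].
pose h := fix h n := if n is n'.+1 then rcons (h n') (g (h n')) else [::].
exists (g \o h) => n.
by suff -> : mkseq (g \o h) n = h n; [exact: gP|elim: n => // n IH; rewrite mkseqS IH].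
Qed.

(** For constructions in which a next term exists only after a correct history: other lists are
    answered by the dummy [x0], and strong induction shows that they never arise. *)
Lemma history_choice_cond (T : Type) (P : seq T -> T -> Prop) :
  (forall b n, (forall m, (m < n)%N -> P (mkseq b m) (b m)) ->
    exists x, P (mkseq b n) x) ->
  (exists x, P [::] x) ->
  exists b, forall n, P (mkseq b n) (b n).
Proof.
move=> step [x0 _].
pose good s := exists2 b, s = mkseq b (size s) &
  forall m, (m < size s)%N -> P (mkseq b m) (b m).
have [s|b bP] := @history_choice T (fun s x => good s -> P s x).
  have [[b sE bP]|ng] := pselect (good s); last by exists x0.
  by have [x] := step b _ bP; rewrite -sE => Px; exists x.
exists b; elim/ltn_ind => n IH; apply: bP; exists b; first by rewrite size_mkseq.
by rewrite size_mkseq.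
Qed.

(** Numbers that are not codes of pairs are read as (0, 0), so constructions indexed by pairs can
    run over all of [nat]. *)
Definition decode (n : nat) : nat * nat := odflt (0%N, 0%N) (choice.unpickle n).
Definition encode (u : nat * nat) : nat := choice.pickle u.
Lemma encodeK u : decode (encode u) = u.
Proof. by rewrite /decode /encode choice.pickleK. Qed.

(** * Spaces with an increasing sequence of seminorms *)

Section Calibrated.
Context (K : numFieldType) (R : realType) (S : scalars K R).
Local Notation nrm := (nrm S).
Local Notation emb := (emb S).
Context (X : lmodType K).
Implicit Types (E F U V W : set X) (x y z : X).

Definition sumset U V : set X := [set x | exists2 y, U y & V (x - y)].

Lemma subsp_sumset U V : subsp U -> subsp V -> subsp (sumset U V).
Proof.
move=> sU sV; split; first by exists 0; [exact: subsp0|rewrite subr0; exact: subsp0].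
move=> a x y [u Uu Vu] [w Uw Vw]; exists (a *: u + w); first exact: sU.2.
by rewrite opprD addrACA -scalerBr; exact: sV.2.
Qed.

Lemma sumsetl U V : subsp V -> U `<=` sumset U V.
Proof. by move=> sV x Ux; exists x; rewrite // subrr; exact: subsp0. Qed.

Lemma sumsetr U V : subsp U -> V `<=` sumset U V.
Proof. by move=> sU x Vx; exists 0; [exact: subsp0|rewrite subr0]. Qed.

Definition interleave (T : Type) (u v : nat -> T) n :=
  if odd n then v n./2 else u n./2.

Lemma cspan_interleave (u v : nat -> X) :
  cspan (interleave u v) = sumset (cspan u) (cspan v).
Proof.
apply/seteqP; split; last first.
  move=> x [y uy vy]; rewrite -(subrK y x); apply: (subspD (subsp_cspan _)).
    apply: cspan_sub vy; first exact: subsp_cspan.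
    by move=> i; have := mem_cspan (interleave u v) i.*2.+1;
      rewrite /interleave /= odd_double uphalf_double.
  apply: cspan_sub uy; first exact: subsp_cspan.
  by move=> i; have := mem_cspan (interleave u v) i.*2;
    rewrite /interleave /= odd_double doubleK.
apply: cspan_sub; first exact: subsp_sumset (subsp_cspan _) (subsp_cspan _).
move=> i; rewrite /interleave; case: ifP => _.
  exact/(sumsetr (subsp_cspan _))/mem_cspan.
exact/(sumsetl (subsp_cspan _))/mem_cspan.
Qed.

(** Echelon form: [v n] is an element of [E] with leading term [b n], with coefficient 1, if there
    is one, and 0 otherwise. Subtracting a multiple of [v n] lowers the last index of an element of
    [E]. *)
Lemma subsp_cspanned E (b : nat -> X) : subsp E -> E `<=` cspan b ->
  exists v, E = cspan v.
Proof.
move=> sE Eb.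
have ex n : exists z, E z /\ ((exists y, lspan (mkseq b n) y /\ E (b n + y)) ->
    lspan (mkseq b n) (z - b n)).
  have [[y [by_ Ey]]|ny] := pselect (exists y, lspan (mkseq b n) y /\ E (b n + y)).
    by exists (b n + y); split => // _; rewrite addrAC subrr add0r.
  by exists 0; split => //; exact: subsp0.
have [v vP] := choice ex; exists v; apply/seteqP; split; last first.
  by apply: cspan_sub => // i; case: (vP i).
move=> x Ex; have [n bx] := Eb _ Ex.
elim: n x Ex bx => [|n IH] x Ex; first by move=> ->; exact: (subsp0 (subsp_cspan v)).
rewrite mkseqS lspan_rcons => -[a ax].
have [a0|a0] := eqVneq a 0; first by apply: IH => //; move: ax; rewrite a0 scale0r subr0.
have xE : x = a *: (b n + a^-1 *: (x - a *: b n)).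
  by rewrite scalerDr scalerA divff// scale1r addrC subrK.
have [Ev bv] := vP n; have {}bv : lspan (mkseq b n) (v n - b n).
  apply: bv.
  exists (a^-1 *: (x - a *: b n)); split; first exact: (subspZ (subsp_lspan _)).
  suff -> : b n + a^-1 *: (x - a *: b n) = a^-1 *: x by exact: subspZ.
  by rewrite {2}xE scalerA mulVf// scale1r.
rewrite -(subrK (a *: v n) x); apply: (subspD (subsp_cspan _)); last first.
  by apply: (subspZ (subsp_cspan _)); exact: mem_cspan.
apply: IH; first by apply: (subspB sE) => //; exact: subspZ.
suff -> : x - a *: v n = (x - a *: b n) - a *: (v n - b n).
  by apply: (subspB (subsp_lspan _)) => //; exact: (subspZ (subsp_lspan _)).
by rewrite scalerBr opprB addrA subrK.
Qed.

(** Induction on the list. Either some [U k] contains no [l + w] with [w] in the span of [L], or one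
    [w0] serves all [k], since two choices of [w] differ by an element of [U k0], which the
    induction hypothesis puts in every [U j]. *)
Lemma decreasing_stab (U : nat -> set X) : (forall k, subsp (U k)) ->
  (forall k, U k.+1 `<=` U k) -> forall L,
  exists k, forall y, lspan L y -> U k y -> forall j, U j y.
Proof.
move=> sU Udec.
have U_le i j : (i <= j)%N -> U j `<=` U i.
  by move=> /subnK <-; elim: (j - i)%N => // n IH x /Udec/IH.
elim=> [|l L [k0 k0P]]; first by exists 0%N => y -> _ j; exact: subsp0.
apply: contrapT => H.
have ex k : (k0 <= k)%N -> exists2 w, lspan L w & U k (l + w).
  move=> k0k; apply: contrapT => H'; apply: H; exists k => y [a ya] Uy.
  have [a0|a0] := eqVneq a 0.
    by apply: k0P; [rewrite a0 scale0r subr0 in ya|exact: U_le Uy].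
  case: H'; exists (a^-1 *: (y - a *: l)); first exact: (subspZ (subsp_lspan _)).
  by rewrite scalerBr scalerA mulVf// scale1r addrC subrK; exact: subspZ.
have [w0 Lw0 Uw0] := ex k0 (leqnn k0).
have lw j : U j (l + w0).
  apply: (U_le j (maxn k0 j)); first exact: leq_maxr.
  have [w Lw Uw] := ex (maxn k0 j) (leq_maxl _ _).
  have -> : l + w0 = (l + w) + (w0 - w) by rewrite [w0 - w]addrC addrA addrK.
  apply: (subspD (sU _)) => //; apply: k0P; first exact: (subspB (subsp_lspan _)).
  have -> : w0 - w = (l + w0) - (l + w) by rewrite opprD addrACA subrr add0r.
  by apply: (subspB (sU _)) => //; apply: (U_le k0 (maxn k0 j)) => //; exact: leq_maxl.
apply: H; exists k0 => y [a ya] Uy j.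
have -> : y = a *: (l + w0) + (y - a *: (l + w0)) by rewrite addrC subrK.
have aU i : U i (a *: (l + w0)) by exact: subspZ.
apply: (subspD (sU j)) => //; apply: k0P; last exact: (subspB (sU k0)).
rewrite scalerDr opprD addrA; apply: (subspB (subsp_lspan _)) => //.
exact: (subspZ (subsp_lspan _)).
Qed.

Lemma small_scalar (C e : R) : 0 <= C -> 0 < e ->
  exists2 t : K, t != 0 & nrm t * C < e.
Proof.
move=> C0 e0; have C1 : 0 < C + 1 by rewrite ltr_wpDl.
have h0 : 0 < e / (C + 1) by rewrite divr_gt0.
exists (emb (e / (C + 1))).
  by rewrite fmorph_eq0 gt_eqF.
rewrite nrm_emb_ge0 ?ltW// -mulrA gtr_pMr//.
by rewrite mulrC ltr_pdivrMr// mul1r ltrDl.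
Qed.

(** The analytic argument is run on a bare module with such a sequence; topologies return only when
    the classes are translated. The third clause is the Hausdorff property. *)
Definition calibrated (p : nat -> X -> R) :=
  [/\ forall n, rseminorm S (p n), forall n x, p n x <= p n.+1 x &
      forall x, (forall n, p n x = 0) -> x = 0].

Definition kerp (p : nat -> X -> R) n : set X := [set x | p n x = 0].

Variables (p : nat -> X -> R) (pC : calibrated p).

Lemma calibrated_seminorm n : rseminorm S (p n). Proof. by case: pC. Qed.
Let pS := calibrated_seminorm.
Hint Resolve pS : core.

Lemma calibrated_ge0 n x : 0 <= p n x. Proof. exact: (sn_ge0 (pS n)). Qed.
Let p_ge0 := calibrated_ge0.
Hint Resolve p_ge0 : core.

Lemma calibrated_le m n x : (m <= n)%N -> p m x <= p n x.
Proof.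
move=> /subnK <-; elim: (n - m)%N => // k IH.
by rewrite (le_trans IH)//; case: pC.
Qed.

Lemma calibrated_sep x : (forall n, p n x = 0) -> x = 0. Proof. by case: pC => _ _; apply. Qed.

Lemma calibrated_ker m n x : (m <= n)%N -> p n x = 0 -> p m x = 0.
Proof.
by move=> mn x0; apply/eqP; rewrite eq_le p_ge0 andbT -x0 calibrated_le.
Qed.

Lemma kerp_le m n : (m <= n)%N -> kerp p n `<=` kerp p m.
Proof. by move=> mn x; exact: calibrated_ker. Qed.

Lemma subsp_kerp n : subsp (kerp p n). Proof. exact: (subsp_ker (pS n)). Qed.
Hint Resolve subsp_kerp : core.

Lemma lspan_kerp_trivial L : exists k, forall y, lspan L y -> p k y = 0 -> y = 0.
Proof.
have [k kP] := decreasing_stab subsp_kerp (fun k => @kerp_le k k.+1 (leqnSn k)) L.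
by exists k => y Ly yk; apply: calibrated_sep => j; exact: kP.
Qed.

Lemma indep_stab n v : indep [set 0] n v -> exists k, indep (kerp p k) n v.
Proof.
move=> iv; have [k kP] := lspan_kerp_trivial (mkseq v n).
by exists k => c /kP cv; apply/iv/cv/lspan_comb; exists c.
Qed.

Definition pdense E := forall x k (e : R), 0 < e -> exists2 y, E y & p k (x - y) < e.

(** Finite spans are closed modulo [kerp p k], so what generates a dense [E] modulo this kernel
    generates everything. *)
Lemma dense_span_kerp E L k : pdense E ->
  (forall x, E x -> exists2 y, lspan L y & kerp p k (x - y)) ->
  forall x, exists2 y, lspan L y & kerp p k (x - y).
Proof.
move=> dE LE x; apply: (lspan_ker_closed (pS k)) => e e0.
have [y Ey ye] := dE x k _ e0; have [z Lz yz] := LE _ Ey.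
by exists z => //; rewrite -(subrK y x) -addrA (snDr0 (pS k)).
Qed.

Lemma dense_fdq E k : pdense E -> fdq E (kerp p k) -> fdq setT (kerp p k).
Proof.
move=> dE [L _ LE]; exists L => // x _; exact: dense_span_kerp dE LE x.
Qed.

(** Generators [L] of [E] would generate [X] modulo every kernel, whereas [X] contains [size L + 1]
    vectors independent modulo some kernel. *)
Lemma dense_infinite E : pdense E -> ~ fdq setT [set (0 : X)] ->
  ~ fdq E [set (0 : X)].
Proof.
move=> dE nf [L LE Lgen].
have [v _ /indep_stab[k]] := not_fdq (@subsp_set0 _ _) nf (size L).+1.
apply: (@spanned_not_indep _ _ setT) => // x _.
apply: (dense_span_kerp dE) => z Ez; have [y Ly zy] := Lgen z Ez.
by exists y => //; rewrite zy; exact: (subsp0 (subsp_kerp k)).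
Qed.

(** Infinite codimension gives [w] outside the span of [L] plus [ker p_n]; if [x] is inside,
    [x - t w] is outside for every nonzero [t]. *)
Lemma perturb_outside n L : ~ fdq setT (kerp p n) -> forall x k (e : R), 0 < e ->
  exists2 x', p k (x - x') < e & forall y, lspan L y -> p n (x' - y) <> 0.
Proof.
move=> nf x k e e0.
have [xout|] := pselect (forall y, lspan L y -> p n (x - y) <> 0).
  by exists x => //; rewrite subrr (sn0 (pS k)).
move=> /existsNP[y0 /not_implyP[Ly0 /contrapT xy0]].
have [w _ wout] := fdq_notsub L (@subspT _ _) (subsp_kerp n) nf.
have [t t0 tw] := small_scalar (p_ge0 k w) e0.
exists (x - t *: w).
  by rewrite opprB addrCA subrr addr0 (snZ (pS k)).
move=> y Ly xy; apply: (wout (t^-1 *: (y0 - y))).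
  apply: (subspZ (subsp_lspan _)); exact: (subspB (subsp_lspan _)).
suff -> : w - t^-1 *: (y0 - y) = t^-1 *: ((x - y0) - (x - t *: w - y)).
  by apply: (subspZ (subsp_kerp n)); exact: (subspB (subsp_kerp n)).
have -> : (x - y0) - (x - t *: w - y) = t *: w - (y0 - y).
  have -> : x - t *: w - y = (x - y0) + (y0 - y - t *: w).
    by rewrite addrA addrA subrK addrAC.
  by rewrite opprD addrA subrr add0r opprB.
by rewrite [RHS]scalerBr scalerA mulVf// scale1r.
Qed.

Definition pseparable := exists d : nat -> X, forall x k (e : R), 0 < e ->
  exists n, p k (x - d n) < e.

Lemma inv_small (k : nat) (e : R) : 0 < e ->
  exists2 b, (k <= b)%N & b.+1%:R^-1 < e.
Proof.
move=> e0; exists (maxn k (Num.truncn e^-1)); first exact: leq_maxl.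
rewrite -[ltRHS]invrK ltf_pV2 ?posrE ?invr_gt0// (lt_le_trans (truncnS_gt _))//.
by rewrite ler_nat ltnS leq_maxr.
Qed.

End Calibrated.

(** * Dense subspaces with the same kernel trace *)

Section BackAndForth.
Context (K : numFieldType) (R : realType) (S : scalars K R).
Local Notation nrm := (nrm S).
Local Notation emb := (emb S).
Context (X : lmodType K) (p : nat -> X -> R) (pC : calibrated S p).
Implicit Types (E F U V W : set X) (x y z : X).
Let pS n : rseminorm S (p n) := calibrated_seminorm pC n.
Hint Resolve pS : core.
Let p_ge0 n x : 0 <= p n x := calibrated_ge0 pC n x.
Hint Resolve p_ge0 : core.

Lemma pdense_cspan d : (forall x k (e : R), 0 < e -> exists n, p k (x - d n) < e) ->
  pdense p (cspan d).
Proof.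
by move=> dP x k e /dP -/(_ x k)[n xn]; exists (d n) => //; exact: mem_cspan.
Qed.

(** Step coding (a, b) picks a vector within [1 / (b + 1)] of [d a] for [p b], outside the span of
    the earlier ones plus [ker p_n]. Hence the span of [u] is dense and meets [ker p_n] only in 0,
    and adding the [z i] creates the prescribed trace. *)
Lemma dense_with_kernel n (z : nat -> X) : pseparable p -> ~ fdq setT (kerp p n) ->
  (forall i, kerp p n (z i)) ->
  exists2 v, pdense p (cspan v) & cspan v `&` kerp p n = cspan z.
Proof.
move=> [d dP] nf zk.
have [s|u uP] := @history_choice X (fun s x =>
    (forall y, lspan s y -> p n (x - y) <> 0) /\
    p (decode (size s)).2 (d (decode (size s)).1 - x) < (decode (size s)).2.+1%:R^-1).
  have [|x ? ?] := perturb_outside pC s nf (d (decode (size s)).1)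
    (decode (size s)).2 (e := (decode (size s)).2.+1%:R^-1).
    by rewrite invr_gt0.
  by exists x.
exists (interleave u z).
  move=> x k e e0.
  have e2 : 0 < e / 2 by rewrite divr_gt0.
  have [b kb be] := inv_small k e2.
  have [a ax] := dP x k _ e2.
  exists (u (encode (a, b))).
    by rewrite cspan_interleave; apply: sumsetl (subsp_cspan _) _ _; exact: mem_cspan.
  have [_] := uP (encode (a, b)); rewrite size_mkseq encodeK /= => ub.
  have := sn_tri (pS k) (d a) x (u (encode (a, b))).
  have := calibrated_le pC (d a - u (encode (a, b))) kb.
  by move: (lt_trans ub be) ax; lra.
rewrite cspan_interleave; apply/seteqP; split; last first.
  move=> x zx; split; first exact: sumsetr (subsp_cspan _) _ _.
  exact: (cspan_sub (subsp_kerp pC n) zk).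
move=> x [[y [m uy] zxy] xk].
suff y0 : y = 0 by rewrite y0 subr0 in zxy.
have yk : p n y = 0.
  rewrite -(subKr x y); apply: (subspB (subsp_kerp pC n)) => //.
  exact: (cspan_sub (subsp_kerp pC n) zk).
elim: m y uy yk {zxy} => [y -> //|m IH y].
rewrite mkseqS lspan_rcons => -[c cy] yk.
have [c0|c0] := eqVneq c 0.
  by apply: IH => //; move: cy; rewrite c0 scale0r subr0.
have [+ _] := uP m => /(_ (- c^-1 *: (y - c *: u m))); case.
  exact: (subspZ (subsp_lspan _)).
rewrite scaleNr opprK scalerBr scalerA mulVf// scale1r addrC subrK.
by rewrite (snZ (pS n)) yk mulr0.
Qed.

(** Maps between subspaces are total maps of [X] constrained only on [E]; this avoids subtypes until
    the final translation. *)
Definition lin_on E (f : X -> X) :=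
  forall a x y, E x -> E y -> f (a *: x + y) = a *: f x + f y.
Definition bounded_on E (f : X -> X) :=
  forall k, exists m C, forall x, E x -> p k (f x) <= C * p m x.

Definition isomorphic_sets E F := exists f g : X -> X,
  [/\ lin_on E f, forall x, E x -> F (f x) /\ g (f x) = x,
      forall y, F y -> E (g y) /\ f (g y) = y,
      bounded_on E f & bounded_on F g].

Lemma bounded_onP E f : bounded_on E f -> forall k, exists m C,
  [/\ (k <= m)%N, 0 < C & forall x, E x -> p k (f x) <= C * p m x].
Proof.
move=> fE k; have [m [C CP]] := fE k; exists (maxn k m), (`|C| + 1).
split; [exact: leq_maxl|by rewrite ltr_wpDl|move=> x Ex].
rewrite (le_trans (CP x Ex))//.
rewrite (le_trans (y := `|C| * p m x))//.
  by rewrite ler_wpM2r// ler_norm.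
rewrite (le_trans (y := `|C| * p (maxn k m) x))//.
  by rewrite ler_wpM2l// (calibrated_le pC)// leq_maxr.
by rewrite ler_wpM2r// lerDl.
Qed.

Lemma isomorphic_sets_refl E : isomorphic_sets E E.
Proof.
by exists id, id; split => // k; exists k, 1 => x _; rewrite mul1r.
Qed.

Lemma lin_on_inverse E F (f g : X -> X) : subsp E -> lin_on E f ->
  (forall x, E x -> F (f x) /\ g (f x) = x) ->
  (forall y, F y -> E (g y) /\ f (g y) = y) -> lin_on F g.
Proof.
move=> sE fl fP gP a x y Fx Fy.
have [Ex fx] := gP _ Fx; have [Ey fy] := gP _ Fy.
rewrite -{1}fx -{1}fy -fl//; have /fP[] // : E (a *: g x + g y).
exact: sE.2.
Qed.

Lemma isomorphic_sets_sym E F : subsp E ->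
  isomorphic_sets E F -> isomorphic_sets F E.
Proof.
move=> sE [f [g [fl fP gP fb gb]]]; exists g, f; split => //.
exact: lin_on_inverse sE fl fP gP.
Qed.

Lemma isomorphic_sets_trans E F G :
  isomorphic_sets E F -> isomorphic_sets F G -> isomorphic_sets E G.
Proof.
move=> [f [g [fl fP gP fb gb]]] [h [i [hl hP iP hb ib]]].
exists (h \o f), (g \o i); split => /=.
- by move=> a x y Ex Ey; rewrite /= fl// (hl _ _ _ (fP x Ex).1 (fP y Ey).1).
- by move=> x /fP[/[dup] ? /hP[? ->] ->].
- by move=> x /iP[/[dup] ? /gP[? ->] ->].
- move=> k; have [m [C [_ C0 CP]]] := bounded_onP hb k.
  have [n [D DP]] := fb m; exists n, (C * D) => x Ex /=.
  have [Fx _] := fP x Ex.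
  by rewrite (le_trans (CP _ Fx))// -mulrA ler_wpM2l ?DP// ltW.
- move=> k; have [m [C [_ C0 CP]]] := bounded_onP gb k.
  have [n [D DP]] := ib m; exists n, (C * D) => x Gx /=.
  have [Fx _] := iP x Gx.
  by rewrite (le_trans (CP _ Fx))// -mulrA ler_wpM2l ?DP// ltW.
Qed.

Section CommonKernel.
Variable (m : nat).

(** One seminorm [p m] serves all [k]: for linear [T], [T - id] factors through the quotient by
    [ker p_m], which keeps the common trace fixed. *)
Definition near_id (T : X -> X) :=
  forall k, exists2 C, 0 < C & forall x, p k (T x - x) <= C * p m x.

Lemma near_id_bounded T : near_id T ->
  exists2 C, 0 < C & forall x, p m (T x) <= C * p m x.
Proof.
move=> /(_ m)[C C0 CP]; exists (C + 1); first by rewrite addr_gt0.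
move=> x; have := CP x; have := snD (pS m) (T x - x) x.
by rewrite subrK mulrDl mul1r; lra.
Qed.

Lemma near_id_ker T x : near_id T -> p m x = 0 -> T x = x.
Proof.
move=> Tn xm; apply/eqP; rewrite -subr_eq0; apply/eqP/(calibrated_sep pC) => k.
have [C _ CP] := Tn k; apply/eqP; rewrite eq_le p_ge0 andbT.
by rewrite (le_trans (CP x))// xm mulr0.
Qed.

(** [T] and [T'] are mutually inverse on all of [X]; [L] lists the pairs to which later maps are
    committed. *)
Definition partial_iso E F (T T' : X -> X) (L : seq (X * X)) :=
  [/\ linear T, linear T', cancel T T' & cancel T' T] /\
  [/\ near_id T, near_id T' &
      forall u, u \in L -> [/\ E u.1, F u.2 & T u.1 = u.2]].

Lemma partial_iso_sym E F T T' L : partial_iso E F T T' L ->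
  partial_iso F E T' T [seq (u.2, u.1) | u <- L].
Proof.
move=> [[? ? c1 c2] [? ? LP]]; split=> //; split=> // _ /mapP[u /LP[? ? Tu] ->].
by split=> //=; rewrite -Tu c1.
Qed.

(** Step [n] controls only the seminorms with index [k <= n]: for fixed [k] this covers all steps
    from [k] on, and they add up to at most [p m x]. *)
Definition small_step n (T T2 : X -> X) :=
  forall k, (k <= n)%N -> forall x, p k (T2 x - T x) <= (2^-1) ^+ n.+1 * p m x.

(** [f] is 1 at [T e] and kills the images already committed, so [T2] sends [e] to the chosen [f0]
    of [F] near [T e] and keeps every pair of [L]. If [e] is in the committed span modulo [ker p_m],
    nothing has to be done. *)
Lemma forth E F T T' L n e : pdense p F -> partial_iso E F T T' L -> E e ->
  exists T2 T2' L2,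
    [/\ partial_iso E F T2 T2' L2, {subset L <= L2}, small_step n T T2,
        small_step n T' T2' & exists2 y, lspan (unzip1 L2) y & p m (e - y) = 0].
Proof.
move=> dF [[Tl T'l c1 c2] [Tn T'n LP]] Ee.
have h_gt0 : 0 < (2^-1 : R) ^+ n.+1 by rewrite exprn_gt0// invr_gt0.
have [inL|outL] := pselect (exists2 y, lspan (unzip1 L) y & p m (e - y) = 0).
  exists T, T', L; split => // k _ x.
    by rewrite subrr (sn0 (pS k)) mulr_ge0// ltW.
  by rewrite subrr (sn0 (pS k)) mulr_ge0// ltW.
have [A A0 TA] := near_id_bounded Tn; have [A' A'0 T'A] := near_id_bounded T'n.
have [|f [fl fb fL fe]] := @separation _ _ S _ _ (pS m) (unzip2 L) (T e).
  move=> y Ly; apply/eqP => ey; apply: outL; exists (T' y).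
    have := lin_lspan T'l Ly; rewrite -map_comp; apply: lspan_subset.
    move=> _ /mapP[u uL ->] /=; have [_ _ <-] := LP _ uL.
    by rewrite c1; apply: map_f.
  apply/eqP; rewrite eq_le p_ge0 andbT -{1}(c1 e) -(linB T'l).
  by rewrite (le_trans (T'A _))// ey mulr0.
have [D D0 fD] := boundedP (pS m) fb.
(* [p M] dominates [p m], which bounds [f], and every [p k] with [k <= n]. *)
set M := maxn m n.
have [B B0 BP] : exists2 B, 0 < B & forall x, p M (T' x) <= B * p M x.
  have [C C0 CP] := T'n M; exists (C + 1); first by rewrite addr_gt0.
  move=> x; have := CP x; have := snD (pS M) (T' x - x) x.
  have := calibrated_le pC x (leq_maxl m n); rewrite -/M -(ler_pM2l C0).
  by rewrite subrK mulrDl mul1r; lra.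
pose h : R := 2^-1 ^+ n.+1.
pose d := Num.min (2 * D)^-1 (Num.min (h / (D * A)) (h / (2 * D * B))).
have d0 : 0 < d.
  by rewrite !lt_min invr_gt0 !divr_gt0 ?mulr_gt0.
have [f0 Ff0 ef0] := dF (T e) M d d0.
have [y yE] : exists y, y = f0 - T e by exists (f0 - T e).
have yd : p M y < d by rewrite yE (snC (pS M)).
have [d1 d2 d3] : [/\ 2 * D * d <= 1, D * A * d <= h & 2 * D * B * d <= h].
  have DA : 0 < D * A by exact: mulr_gt0.
  have DB : 0 < 2 * D * B by rewrite !mulr_gt0.
  have D2 : 0 < 2 * D by rewrite mulr_gt0.
  rewrite -ler_pdivlMl// mulr1 -!(ler_pdivlMl _ _ DA) -(ler_pdivlMl _ _ DB).
  by rewrite ![_^-1 * h]mulrC /d !ge_min !lexx !orbT.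
have fy : nrm (f y) <= 2^-1.
  have := fD y; have := calibrated_le pC y (leq_maxl m n); rewrite -/M => my.
  have : D * p m y <= D * d by rewrite ler_pM2l// ltW// (le_lt_trans my).
  by move: d1; rewrite -mulrA; lra.
have g2 : 2^-1 <= nrm (1 + f y).
  have := nrmD S (1 + f y) (- f y); rewrite addrK nrmN nrm1; lra.
have g0 : 1 + f y != 0.
  by apply: contraTN isT => /eqP g0; move: g2; rewrite g0 nrm0; lra.
(* T2 = (1 + f (x) y) T, inverted by the Sherman-Morrison formula. *)
pose T2 x := T x + f (T x) *: y.
pose T2' x := T' (x - (f x / (1 + f y)) *: y).
have fZ := scalZ fl; have fDD := scalD fl.
exists T2, T2', ((e, f0) :: L); split.
- split; split.
  + by move=> a x z; rewrite /T2 Tl fl scalerDl [in RHS]scalerDr scalerA addrACA.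
  + move=> a x z; rewrite /T2' -T'l; congr T'.
    by rewrite fl mulrDl scalerDl opprD addrACA -mulrA -scalerA -scalerBr.
  + move=> x; rewrite /T2 /T2' -[RHS]c1; congr T'.
    have -> : f (T x + f (T x) *: y) = f (T x) * (1 + f y).
      by rewrite fDD fZ mulrDr mulr1.
    by rewrite mulfK// addrK.
  + move=> x; rewrite /T2 /T2' c2 (scalB fl) fZ.
    rewrite -[RHS]addr0 -addrA; congr (_ + _); rewrite addrC -scalerBl.
    suff -> : f x - f x / (1 + f y) * f y - f x / (1 + f y) = 0 by rewrite scale0r.
    by field.
  + move=> k; have [C C0 CP] := Tn k.
    exists (C + D * A * p k y + 1).
      by rewrite ltr_wpDl// addr_ge0 ?mulr_ge0// ltW.
    move=> x; rewrite /T2 addrAC (le_trans (snD (pS k) _ _))//.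
    rewrite !mulrDl mul1r -addrA lerD// ler_wpDr//.
    rewrite (snZ (pS k)) [D * A * _ * _]mulrAC ler_wpM2r//.
    by rewrite (le_trans (fD _))// -mulrA ler_pM2l.
  + move=> k; have [C C0 CP] := T'n k.
    exists (C + D * 2 * p k (T' y) + 1).
      by rewrite ltr_wpDl// addr_ge0 ?mulr_ge0// ltW.
    move=> x; rewrite /T2' (linB T'l) (linZ T'l) addrAC (le_trans (snB (pS k) _ _))//.
    rewrite !mulrDl mul1r -addrA lerD// ler_wpDr//.
    rewrite (snZ (pS k)) [D * _ * _ * _]mulrAC ler_wpM2r//.
    rewrite nrmM nrmV [D * 2 * _]mulrAC ler_pM ?nrm_ge0 ?invr_ge0 ?nrm_ge0//.
    by rewrite -[leRHS]invrK lef_pV2 ?posrE ?invr_gt0// nrm_gt0.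
  + move=> u; rewrite inE => /predU1P[->|uL] /=.
      by split=> //; rewrite /T2 fe scale1r yE addrC subrK.
    have [Eu Fu Tu] := LP u uL; split=> //; rewrite /T2 Tu fL ?scale0r ?addr0//.
    exact: map_f.
- by move=> u uL; rewrite inE uL orbT.
- move=> k kn x; rewrite /T2 addrAC subrr add0r (snZ (pS k)).
  have yk : p k y <= d.
    rewrite ltW// (le_lt_trans _ yd)// (calibrated_le pC)// (leq_trans kn)//.
    exact: leq_maxr.
  rewrite -/h (le_trans (y := D * A * p m x * d))//.
    apply: ler_pM; rewrite ?nrm_ge0//.
    by rewrite (le_trans (fD _))// -mulrA ler_pM2l.
  by rewrite mulrAC ler_wpM2r.
- move=> k kn x; rewrite /T2' (linB T'l) (linZ T'l) addrAC subrr add0r.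
  rewrite (snN (pS k)) (snZ (pS k)).
  have yk : p k (T' y) <= B * d.
    rewrite (le_trans (y := p M (T' y)))// ?(calibrated_le pC)// ?(leq_trans kn)// ?leq_maxr//.
    by rewrite (le_trans (BP _))// ler_pM2l// ltW.
  rewrite -/h (le_trans (y := (D * p m x * 2) * (B * d)))//.
    apply: ler_pM; rewrite ?nrm_ge0//.
    rewrite nrmM nrmV ler_pM ?nrm_ge0 ?invr_ge0 ?nrm_ge0//.
    by rewrite -[leRHS]invrK lef_pV2 ?posrE ?invr_gt0// nrm_gt0.
  have -> : D * p m x * 2 * (B * d) = (2 * D * B * d) * p m x by ring.
  by rewrite ler_wpM2r.
- exists e; first by apply: mem_lspan; rewrite inE eqxx.
  by rewrite subrr (sn0 (pS m)).
Qed.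

(** Up to a vector of [ker p_m], where every [T n] is the identity, [x] lies in a committed span,
    where [T n] is eventually constant: the limit is attained at each [x]. The remaining vector is
    its own image, so the trace of [E] has to be contained in [F]. *)
Lemma limit_map E F (T : nat -> X -> X) (L : nat -> seq (X * X)) :
  subsp F -> E `&` kerp p m `<=` F -> subsp E ->
  (forall n, linear (T n)) -> (forall n, near_id (T n)) ->
  (forall n u, u \in L n -> [/\ E u.1, F u.2 & T n u.1 = u.2]) ->
  (forall n, {subset L n <= L n.+1}) ->
  (forall n, small_step n (T n) (T n.+1)) ->
  (forall x, E x ->
    exists n, exists2 y, lspan (unzip1 (L n)) y & p m (x - y) = 0) ->
  exists f, [/\ forall x, E x -> exists N, forall n, (N <= n)%N -> T n x = f x,
    lin_on E f, forall x, E x -> F (f x) & bounded_on E f].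
Proof.
move=> sF EF sE Tl Tn TL LS Tsmall gen.
have LS_le n k : (n <= k)%N -> {subset L n <= L k}.
  by move=> /subnK <-; elim: (k - n)%N => // j IH u /IH; exact: LS.
have stab x : exists z, E x -> exists N, forall n, (N <= n)%N -> T n x = z /\ F z.
  have [Ex|nEx] := pselect (E x); last by exists 0.
  have [N [y Ly xy]] := gen _ Ex.
  have Ey : E y.
    apply: lspan_sub Ly => // _ /mapP[u uL ->]; by case: (TL _ _ uL).
  have Fxy : F (x - y) by apply: EF; split => //; exact: (subspB sE).
  have [w wF wE] : exists2 w, F w & forall n, (N <= n)%N -> T n y = w.
    have := fun n (Nn : (N <= n)%N) u (uL : u \in L N) => TL n u (LS_le _ _ Nn u uL).
    move: Ly; move: (L N) => l; elim: l y {xy Ey Fxy} => [|u l IH] y /=.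
      move=> -> _; exists 0; first exact: subsp0.
      by move=> n _; exact: (lin0 (Tl n)).
    move=> [a ya] lP; have [|w Fw wP] := IH _ ya.
      by move=> n Nn v vl; apply: lP => //; rewrite inE vl orbT.
    have uP n Nn := lP n Nn u (mem_head _ _).
    exists (w + a *: u.2).
      apply: (subspD sF) => //; apply: (subspZ sF).
      by case: (uP N (leqnn N)).
    move=> n Nn; rewrite -(subrK (a *: u.1) y) (linD (Tl n)) wP// (linZ (Tl n)).
    by case: (uP n Nn) => _ _ ->.
  exists (x - y + w) => _; exists N => n Nn; split; last exact: (subspD sF).
  by rewrite -{1}(subrK y x) (linD (Tl n)) wE// (near_id_ker (Tn n)).
have [f fP] := choice stab; exists f.
have fN x : E x -> exists N, forall n, (N <= n)%N -> T n x = f x.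
  by move=> /fP[N NP]; exists N => n /NP[].
split => //.
- move=> a x y Ex Ey; have [N1 H1] := fN _ Ex; have [N2 H2] := fN _ Ey.
  have [|N3 H3] := fN (a *: x + y); first exact: sE.2.
  set N := maxn N1 (maxn N2 N3).
  rewrite -(H3 N) ?(Tl N) ?H1 ?H2// /N; lia.
- by move=> x /fP[N /(_ N (leqnn N))[]].
(* [C] bounds [T k - id]; one unit accounts for [x] itself and one for the steps after [k]. *)
- move=> k; have [C C0 CP] := Tn k k; exists (maxn k m), (C + 2) => x Ex.
  have [N NP] := fN _ Ex; rewrite -(NP (maxn k N)) ?leq_maxr//.
  have tele j : (k <= j)%N -> p k (T j x - T k x) <= (1 - 2^-1 ^+ j) * p m x.
    move=> /subnK <-; elim: (j - k)%N => [|i IH].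
      rewrite subrr (sn0 (pS k)) mulr_ge0// subr_ge0.
      by rewrite exprn_ile1// ?invr_ge0// invf_le1// ler1n.
    rewrite addSn (le_trans (sn_tri (pS k) (T (i + k)%N x) _ _))//.
    have := Tsmall (i + k)%N k (leq_addl _ _) x.
    move: IH; rewrite exprS; set h := _ ^+ (i + k); set t := p m x.
    rewrite !mulrBl !mul1r -mulrA; lra.
  have := tele _ (leq_maxl k N); have := CP x.
  set y := T (maxn k N) x.
  have := snD (pS k) (T k x - x) x; rewrite subrK.
  have := sn_tri (pS k) (T k x) y 0; rewrite !subr0.
  have := calibrated_le pC x (leq_maxl k m); have := calibrated_le pC x (leq_maxr k m).
  have h0 : 0 <= (2^-1 : R) ^+ maxn k N by rewrite exprn_ge0// invr_ge0.
  have : 0 <= 2^-1 ^+ maxn k N * p m x by rewrite mulr_ge0.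
  rewrite mulrBl mul1r mulrDl; set M := maxn k m => ? l1 l2 *.
  have : C * p m x <= C * p M x by rewrite ler_pM2l.
  lra.
Qed.

Lemma partial_iso_step E F (e f : nat -> X) n (st : (X -> X) * (X -> X) * seq (X * X)) :
    pdense p E -> pdense p F -> (forall i, E (e i)) -> (forall i, F (f i)) ->
    partial_iso E F st.1.1 st.1.2 st.2 ->
  exists st2 : (X -> X) * (X -> X) * seq (X * X),
    [/\ partial_iso E F st2.1.1 st2.1.2 st2.2, {subset st.2 <= st2.2},
     small_step n st.1.1 st2.1.1, small_step n st.1.2 st2.1.2 &
     if odd n then exists2 y, lspan (unzip2 st2.2) y & p m (f n./2 - y) = 0
     else exists2 y, lspan (unzip1 st2.2) y & p m (e n./2 - y) = 0].
Proof.
move=> dE dF eE fF; case: st => -[T T'] L /= iso; case: (odd n).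
  have [T2' [T2 [L2 [iso2 LL2 s1 s2 [y yL ey]]]]] :=
    forth n dE (partial_iso_sym iso) (fF n./2).
  exists (T2, T2', [seq (u.2, u.1) | u <- L2]); split => //=.
  - exact: partial_iso_sym.
  - move=> u uL; apply/mapP; exists (u.2, u.1); last by case: (u).
    by apply: LL2; apply/mapP; exists u.
  - by exists y => //; rewrite /unzip2 -map_comp.
have [T2 [T2' [L2 [iso2 LL2 s1 s2 [y yL ey]]]]] := forth n dF iso (eE n./2).
by exists (T2, T2', L2); split => //=; exists y.
Qed.

(** Even steps extend the map at the [e i], odd steps its inverse at the [f i]. Both limits are the
    identity on the trace, so equality of the traces makes them land in the right subspaces. *)
Lemma same_kernel_isomorphic (e f : nat -> X) :
  pdense p (cspan e) -> pdense p (cspan f) ->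
  cspan e `&` kerp p m = cspan f `&` kerp p m ->
  isomorphic_sets (cspan e) (cspan f).
Proof.
set E := cspan e; set F := cspan f => dE dF EF.
have sE : subsp E := subsp_cspan e; have sF : subsp F := subsp_cspan f.
have step n st := @partial_iso_step E F e f n st dE dF (mem_cspan e) (mem_cspan f).
pose State := ((X -> X) * (X -> X) * seq (X * X))%type.
pose good (st : State) := partial_iso E F st.1.1 st.1.2 st.2.
have /choice[next nextP] : forall u : nat * State, exists st2 : State, good u.2 ->
    [/\ partial_iso E F st2.1.1 st2.1.2 st2.2, {subset u.2.2 <= st2.2},
     small_step u.1 u.2.1.1 st2.1.1, small_step u.1 u.2.1.2 st2.1.2 &
     if odd u.1 then exists2 y, lspan (unzip2 st2.2) y & p m (f u.1./2 - y) = 0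
     else exists2 y, lspan (unzip1 st2.2) y & p m (e u.1./2 - y) = 0].
  move=> [n st]; have [gst|ngst] := pselect (good st); last by exists st.
  by have [st2 ?] := step n st gst; exists st2.
pose st := fix st n : State := if n is n'.+1 then next (n', st n') else (id, id, [::]).
have near_id_id : near_id id.
  by move=> k; exists 1 => // x; rewrite subrr (sn0 (pS k)) mul1r.
have stG n : good (st n).
  elim: n => [|n IH]; first by split; split.
  by have [] := nextP (n, st n) IH.
have stP n := nextP (n, st n) (stG n).
(* Common to both directions: [par] is the parity of the steps that treat [sub], and [z] selects the
   component of the committed pairs. *)
have half (sub : nat -> X) (z : (X * X -> X)) (par : bool) :
    (forall n, odd n = par -> exists2 y, lspan (map z (st n.+1).2) y & p m (sub n./2 - y) = 0) ->
    forall x, cspan sub x ->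
      exists n, exists2 y, lspan (map z (st n).2) y & p m (x - y) = 0.
  move=> H x [k]; elim: k x => [|k IH] x.
    by move=> ->; exists 0%N, 0 => //; rewrite subrr (sn0 (pS m)).
  rewrite mkseqS lspan_rcons => -[a /IH[n1 [y1 Ly1 xy1]]].
  have [|y2] := H (par + k.*2)%N; first by rewrite oddD odd_double addbF; case: par {H}.
  rewrite half_bit_double => Ly2 xy2.
  have mono i j : (i <= j)%N -> lspan (map z (st i).2) `<=` lspan (map z (st j).2).
    move=> /subnK <-; elim: (j - i)%N => // l IHl y /IHl.
    apply: lspan_subset => _ /mapP[u uL ->]; apply: map_f.
    by have [_ + _ _ _] := stP (l + i)%N; apply.
  exists (maxn n1 (par + k.*2).+1), (y1 + a *: y2).
    apply: (subspD (subsp_lspan _)).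
      by apply: mono Ly1; exact: leq_maxl.
    apply: (subspZ (subsp_lspan _)); apply: mono Ly2; exact: leq_maxr.
  suff -> : x - (y1 + a *: y2) = (x - a *: sub k - y1) + a *: (sub k - y2).
    by rewrite (sn_kerD (pS m))// (sn_kerZ (pS m)).
  by rewrite opprD scalerBr addrACA subrK.
have LS n : {subset (st n).2 <= (st n.+1).2} by case: (stP n).
have gen1 : forall x, E x ->
    exists n, exists2 y, lspan (unzip1 (st n).2) y & p m (x - y) = 0.
  by apply: (half e fst false) => n on; have [_ _ _ _] := stP n; rewrite /= on.
have gen2 : forall x, F x -> exists n, exists2 y,
    lspan (unzip1 [seq (u.2, u.1) | u <- (st n).2]) y & p m (x - y) = 0.
  move=> x Fx; have [n on|n [y yL xy]] := half f snd true _ x Fx.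
    by have [_ _ _ _] := stP n; rewrite /= on.
  by exists n, y => //; rewrite /unzip1 -map_comp.
have [f1 [f1N f1l f1F f1b]] :
    exists f, [/\ forall x, E x -> exists N, forall n, (N <= n)%N -> (st n).1.1 x = f x,
      lin_on E f, forall x, E x -> F (f x) & bounded_on E f].
  apply: (limit_map (L := fun n => (st n).2)) => //.
  - by rewrite EF; exact: subIsetl.
  - by move=> n; have [[]] := stG n.
  - by move=> n; have [_ []] := stG n.
  - by move=> n; have [_ []] := stG n.
  - by move=> n; case: (stP n).
have [g1 [g1N g1l g1E g1b]] :
    exists f, [/\ forall x, F x -> exists N, forall n, (N <= n)%N -> (st n).1.2 x = f x,
      lin_on F f, forall x, F x -> E (f x) & bounded_on F f].
  apply: (limit_map (L := fun n => [seq (u.2, u.1) | u <- (st n).2])) => //.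
  - by rewrite -EF; exact: subIsetl.
  - by move=> n; have [[]] := stG n.
  - by move=> n; have [_ []] := stG n.
  - by move=> n; have [_ []] := partial_iso_sym (stG n).
  - by move=> n _ /mapP[u uL ->]; apply: map_f; exact: LS.
  - by move=> n; case: (stP n).
exists f1, g1; split => //.
- move=> x Ex; split; first exact: f1F.
  have [N1 H1] := f1N _ Ex; have [N2 H2] := g1N _ (f1F _ Ex).
  rewrite -(H2 (maxn N1 N2)) ?leq_maxr// -(H1 (maxn N1 N2)) ?leq_maxl//.
  by have [[_ _ c _] _] := stG (maxn N1 N2); exact: c.
- move=> x Fx; split; first exact: g1E.
  have [N1 H1] := g1N _ Fx; have [N2 H2] := f1N _ (g1E _ Fx).
  rewrite -(H2 (maxn N1 N2)) ?leq_maxr// -(H1 (maxn N1 N2)) ?leq_maxl//.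
  by have [[_ _ _ c] _] := stG (maxn N1 N2); exact: c.
Qed.

End CommonKernel.
End BackAndForth.

(** * Complemented copies of the space of all sequences *)

Section OmegaSystems.
Context (K : numFieldType) (R : realType) (S : scalars K R).
Local Notation nrm := (nrm S).
Local Notation emb := (emb S).
Context (X : lmodType K) (p : nat -> X -> R) (pC : calibrated S p).
Implicit Types (E F U V W : set X) (x y : X) (s t v : nat -> X)
  (sg : nat -> X -> K).
Let pS n : rseminorm S (p n) := calibrated_seminorm pC n.
Hint Resolve pS : core.
Let p_ge0 n x : 0 <= p n x := calibrated_ge0 pC n x.
Hint Resolve p_ge0 : core.
Let subsp_kerp n : subsp (kerp p n) := subsp_kerp pC n.
Hint Resolve subsp_kerp : core.

Definition pbounded (f : X -> K) := exists k, bounded S (p k) f.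

Lemma bounded_le f k l : (k <= l)%N -> bounded S (p k) f -> bounded S (p l) f.
Proof.
move=> kl /(boundedP (pS k))[C C0 CP]; exists C => x.
by rewrite (le_trans (CP x))// ler_pM2l// (calibrated_le pC).
Qed.

Lemma pboundedZB f g a : pbounded f -> pbounded g ->
  pbounded (fun x => f x - a * g x).
Proof.
move=> [k fk] [l gl]; exists (maxn k l); apply: boundedZB.
  by apply: bounded_le fk; exact: leq_maxl.
by apply: bounded_le gl; exact: leq_maxr.
Qed.

Lemma pbounded_sub_sum f (c : nat -> K) (g : nat -> X -> K) n : pbounded f ->
  (forall i, (i < n)%N -> pbounded (g i)) ->
  pbounded (fun x => f x - \sum_(i < n) c i * g i x).
Proof.
move=> fb; elim: n => [|n IH] gb.
  by have := pboundedZB 0 fb fb; under eq_fun do rewrite mul0r;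
    under [X in _ -> pbounded X]eq_fun do rewrite big_ord0.
have := pboundedZB (c n) (IH (fun i i_n => gb i (ltnW i_n))) (gb n (ltnSn n)).
by under [X in _ -> pbounded X]eq_fun do rewrite big_ord_recr/= opprD addrA.
Qed.

(** One functional for each generator that is new modulo [ker p_k], equal to 1 there and killing the
    generators treated before. *)
Lemma detecting_functionals V k : fdq V (kerp p k) -> exists N (d : nat -> X -> K),
  (forall i, scalar (d i) /\ bounded S (p k) (d i)) /\
  forall x, V x -> (forall i, (i < N)%N -> d i x = 0) -> p k x = 0.
Proof.
move=> [L _ Lgen].
(* Stated for all [x] congruent to the span of [L], so that the induction does not involve [V]. *)
suff [N [d [dP dN]]] : exists N (d : nat -> X -> K),
    (forall i, scalar (d i) /\ bounded S (p k) (d i)) /\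
    forall x y, lspan L y -> p k (x - y) = 0 ->
      (forall i, (i < N)%N -> d i x = 0) -> p k x = 0.
  exists N, d; split => // x Vx dx; have [y Ly xy] := Lgen x Vx.
  exact: dN Ly xy dx.
elim: L {Lgen} => [|l L [N [d [dP dN]]]] /=.
  exists 0%N, (fun _ _ => 0); split.
    move=> _; split; first by move=> a x y /=; rewrite mulr0 addr0.
    by exists 0 => x; rewrite nrm0 mul0r.
  by move=> x y ->; rewrite subr0.
have [[y Ly yl]|nl] := pselect (exists2 y, lspan L y & p k (l - y) = 0).
  exists N, d; split => // x z [a za] xz dx.
  apply: (dN x (z - a *: l + a *: y)) => //.
    by apply: (subspD (subsp_lspan _)) => //; exact: (subspZ (subsp_lspan _)).
  suff -> : x - (z - a *: l + a *: y) = (x - z) + a *: (l - y).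
    by rewrite (sn_kerD (pS k))// (sn_kerZ (pS k)).
  by rewrite scalerBr !opprD opprK !addrA.
have [|f [fl fb fL f1]] := @separation _ _ S _ _ (pS k) L l.
  by move=> y Ly; apply/eqP => yl; apply: nl; exists y.
exists N.+1, (fun i => if i == N then f else d i); split.
  by move=> i; case: ifP.
move=> x y [a Ly] xy dx.
have := dx N (ltnSn N); rewrite eqxx => fx.
have a0 : a = 0.
  have := bounded_ker fb xy; rewrite (scalB fl) fx sub0r => /eqP.
  rewrite oppr_eq0 -(subrK (a *: l) y) (scalD fl) (scal_ker_lspan fl fL Ly).
  by rewrite add0r (scalZ fl) f1 mulr1 => /eqP.
apply: (dN x y) => //; first by rewrite a0 scale0r subr0 in Ly.
by move=> i iN; have := dx i (ltnW iN); rewrite ltn_eqF.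
Qed.

Lemma detecting_sequence V : (forall k, fdq V (kerp p k)) ->
  exists d : nat -> X -> K, (forall i, scalar (d i) /\ pbounded (d i)) /\
    forall k, exists N, forall x, V x -> (forall i, (i < N)%N -> d i x = 0) -> p k x = 0.
Proof.
move=> Vf.
have /choice[D DP] : forall k, exists u : nat * (nat -> X -> K),
    (forall i, scalar (u.2 i) /\ bounded S (p k) (u.2 i)) /\
    forall x, V x -> (forall i, (i < u.1)%N -> u.2 i x = 0) -> p k x = 0.
  by move=> k; have [N [d ?]] := detecting_functionals (Vf k); exists (N, d).
exists (fun j => (D (decode j).1).2 (decode j).2); split.
  move=> i; have [/(_ (decode i).2)[? ?] _] := DP (decode i).1.
  by split => //; exists (decode i).1.
move=> k; exists (\max_(i < (D k).1) (encode (k, val i)).+1) => x Vx dx.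
have [_] := DP k; apply => // i iN.
have := dx (encode (k, i)); rewrite encodeK; apply.
exact: (@leq_bigmax _ (fun j : 'I_(D k).1 => (encode (k, val j)).+1) (Ordinal iN)).
Qed.

(** Much stronger than convergence to 0: a series of multiples of the [t j] is a finite sum modulo
    each kernel, whatever its coefficients. *)
Definition nullseq t := forall k, exists M, forall j, (M <= j)%N -> p k (t j) = 0.

Definition omega_system s sg :=
  [/\ forall j, scalar (sg j) /\ pbounded (sg j),
      forall i j, sg i (s j) = (i == j)%:R & nullseq s].

Lemma biorth_comb sg s (c : nat -> K) n i :
  (forall j, (j < n)%N -> sg i (s j) = (i == j)%:R) -> scalar (sg i) ->
  (i < n)%N -> sg i (comb c s n) = c i.
Proof.
move=> sgs sgl i_n; rewrite (scal_sum sgl).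
rewrite (bigD1 (Ordinal i_n))//= (scalZ sgl) sgs// eqxx mulr1 big1 ?addr0//.
move=> j ji; rewrite (scalZ sgl) sgs// (_ : (i == j) = false) ?mulr0//.
by apply: contraNF ji => /eqP ij; apply/eqP/val_inj.
Qed.

(** A biorthogonalisation run on vectors and functionals at once. Exhausting a detecting sequence of
    functionals makes [s] a null sequence and expansions exact modulo each kernel. [v] lists vectors
    that must lie in the algebraic span; it is constantly 0 where only the closure matters. *)
Lemma omega_system_exists V v : subsp V -> (forall k, fdq V (kerp p k)) ->
    ~ fdq V [set 0] -> (forall i, V (v i)) ->
  exists s sg, [/\ omega_system s sg, forall j, V (s j),
    forall i, cspan s (v i) &
    forall k, exists M, forall n, (M <= n)%N -> forall x, V x ->
      p k (x - comb (sg^~ x) s n) = 0].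
Proof.
move=> sV Vf Vinf Vv.
have [d [dP dN]] := detecting_sequence Vf.
pose T := (X * (X -> K))%type.
pose dflt : T := (0, fun=> 0).
pose P (h : seq T) (u : T) := let w := nth dflt h in let n := size h in
  [/\ V u.1 /\ u.2 u.1 = 1, scalar u.2 /\ pbounded u.2,
      forall i, (i < n)%N -> (w i).2 u.1 = 0,
      forall i, (i < n)%N -> u.2 (w i).1 = 0 &
      if odd n then forall x, V x -> (forall i, (i < n)%N -> (w i).2 x = 0) ->
        u.2 x = 0 -> d n./2 x = 0
      else exists a, v n./2 - \sum_(i < n) (w i).2 (v n./2) *: (w i).1 = a *: u.1].
(* Even steps bring v n./2 into the span of the s i; odd steps bring d n./2,
   restricted to V, into the span of the functionals. *)
have step (b : nat -> T) n : (forall m, (m < n)%N -> P (mkseq b m) (b m)) ->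
    exists u, P (mkseq b n) u.
  move=> bP; rewrite /P size_mkseq.
  have nthb i : (i < n)%N -> nth dflt (mkseq b n) i = b i by move=> ?; rewrite nth_mkseq.
  pose s i := (b i).1; pose sg i := (b i).2.
  have sgl i : (i < n)%N -> scalar (sg i) by move=> /bP[_ []].
  have sgb i : (i < n)%N -> pbounded (sg i) by move=> /bP[_ []].
  have Vs i : (i < n)%N -> V (s i) by move=> /bP[[]].
  have sgs i j : (i < n)%N -> (j < n)%N -> sg i (s j) = (i == j)%:R.
    move=> i_n jn; have [ij|ij|->] := ltngtP i j.
    - have [_ _ + _ _] := bP j jn; rewrite size_mkseq => /(_ i ij).
      by rewrite nth_mkseq.
    - have [_ _ _ + _] := bP i i_n; rewrite size_mkseq => /(_ j ij).
      by rewrite nth_mkseq.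
    - by rewrite /sg /s; have [[_ ->]] := bP j jn.
  pose proj x := comb (sg^~ x) s n.
  have projE x : \sum_(i < n) (nth dflt (mkseq b n) i).2 x *: (nth dflt (mkseq b n) i).1 = proj x.
    by apply: eq_bigr => i _; rewrite nthb.
  have Vproj x : V (proj x) by apply: subsp_sum => // i _; apply: subspZ => //; exact: Vs.
  have sgproj i x : (i < n)%N -> sg i (x - proj x) = 0.
    move=> i_n; rewrite (scalB (sgl _ i_n)) biorth_comb ?subrr//; last exact: sgl.
    by move=> j; exact: sgs.
  pose V' x := V x /\ forall i, (i < n)%N -> sg i x = 0.
  (* Infinite dimension leaves a nonzero vector with all earlier coordinates 0, used when the task
     of the step is already done. *)
  have [z0 [z0V z00]] : exists z, V' z /\ z <> 0.
    apply: contrapT => H; apply: Vinf; exists (mkseq s n).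
      by move=> _ /mapP[i + ->]; rewrite mem_iota => /andP[_]; exact: Vs.
    move=> x Vx; exists (proj x); first by apply/lspan_comb; exists (sg^~ x).
    apply: contrapT => x0; apply: H; exists (x - proj x); split => //.
    by split; [exact: subspB|by move=> i; exact: sgproj].
  (* Normalising [z] and subtracting from [d j] its values at the earlier [s i] gives a new
     biorthogonal pair; the correction is invisible on vectors whose earlier coordinates vanish. *)
  have make z j : V' z -> d j z <> 0 -> exists u : T, exists a, u.1 = a *: z /\
      [/\ a != 0, V u.1 /\ u.2 u.1 = 1, scalar u.2 /\ pbounded u.2,
        forall i, (i < n)%N -> (nth dflt (mkseq b n) i).2 u.1 = 0 &
        forall i, (i < n)%N -> u.2 (nth dflt (mkseq b n) i).1 = 0] /\
      forall x, (forall i, (i < n)%N -> sg i x = 0) -> u.2 x = d j x.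
    move=> [Vz sgz] /eqP dz; have [djl djb] := dP j.
    pose g x := d j x - \sum_(i < n) d j (s i) * sg i x.
    have gV' x : (forall i, (i < n)%N -> sg i x = 0) -> g x = d j x.
      by move=> sgx; rewrite /g big1 ?subr0// => i _; rewrite sgx// mulr0.
    exists ((d j z)^-1 *: z, g), (d j z)^-1; split => //=; split; last exact: gV'.
    have gz : g z = d j z by rewrite gV'.
    have gl : scalar g.
      move=> a x y; rewrite /g djl mulrBr addrACA -opprD; congr (_ - _).
      rewrite mulr_sumr -big_split; apply: eq_bigr => i _.
      by rewrite (sgl i)//= mulrDr mulrCA.
    split.
    - by rewrite invr_eq0.
    - by split; [exact: subspZ|rewrite (scalZ gl) gz mulVf].
    - split => //; exact: (@pbounded_sub_sum (d j) (fun i => d j (s i)) sg n djb sgb).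
    - by move=> i i_n; rewrite nthb// -/(sg i) (scalZ (sgl i i_n)) sgz// mulr0.
    - move=> i i_n; rewrite nthb// /g (bigD1 (Ordinal i_n))//= sgs// eqxx mulr1.
      rewrite big1 ?addr0 ?subrr// => l li; rewrite sgs//.
      rewrite (_ : (nat_of_ord l == i) = false) ?mulr0//.
      by apply: contraNF li => /eqP ij; apply/eqP/val_inj.
  have any z : V' z -> z <> 0 -> exists j, d j z <> 0.
    move=> [Vz _] z1; apply: contrapT => H; apply: z1; apply: (calibrated_sep pC) => k.
    have [N NP] := dN k; apply: NP => // i _.
    by apply: contrapT => dz; apply: H; exists i.
  have [on|en] := boolP (odd n).
    have [[z [V'z dz]]|nz] := pselect (exists z, V' z /\ d n./2 z <> 0).
      have [u [a [_ [[_ ? ? ? ?] uP]]]] := make _ _ V'z dz; exists u; split => //.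
      move=> x Vx sgx ux; rewrite -uP// => i i_n.
      by have := sgx i i_n; rewrite nthb.
    have [j dz] := any _ z0V z00.
    have [u [a [_ [[_ ? ? ? ?] uP]]]] := make _ _ z0V dz; exists u; split => //.
    move=> x Vx sgx ux; apply: contrapT => dx; apply: nz; exists x; split => //.
    by split => // i i_n; have := sgx i i_n; rewrite nthb.
  have [z1|z1] := pselect (v n./2 - proj (v n./2) = 0).
    have [j dz] := any _ z0V z00.
    have [u [a [_ [[_ ? ? ? ?] uP]]]] := make _ _ z0V dz; exists u; split => //.
    by exists 0; rewrite projE z1 scale0r.
  have zV : V' (v n./2 - proj (v n./2)).
    by split; [exact: subspB|move=> i; exact: sgproj].
  have [j dz] := any _ zV z1.
  have [u [a [uz [[a0 ? ? ? ?] uP]]]] := make _ _ zV dz; exists u; split => //.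
  by exists a^-1; rewrite projE uz scalerA mulVf// scale1r.
have [|b bP] := history_choice_cond step; first exact: (step (fun=> dflt) 0%N).
pose s i := (b i).1; pose sg i := (b i).2; exists s, sg.
have sgP i : scalar (sg i) /\ pbounded (sg i) by have [_ [? ?] _ _ _] := bP i.
have Vs i : V (s i) by have [[]] := bP i.
have sgs i j : sg i (s j) = (i == j)%:R.
  have [ij|ij|->] := ltngtP i j.
  - have [_ _ + _ _] := bP j; rewrite size_mkseq => /(_ i ij).
    by rewrite nth_mkseq.
  - have [_ _ _ + _] := bP i; rewrite size_mkseq => /(_ j ij).
    by rewrite nth_mkseq.
  - by rewrite /sg /s; have [[_ ->]] := bP j.
(* [d i] is treated at step [2 i + 1], so the first [2 N] coordinates control the first [N]
   detecting functionals. *)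
have kill k : exists M, forall n, (M <= n)%N -> forall x, V x ->
    (forall i, (i < n)%N -> sg i x = 0) -> p k x = 0.
  have [N NP] := dN k; exists (N.*2) => n Nn x Vx sgx; apply: NP => // i iN.
  have [_ _ _ _] := bP i.*2.+1.
  have lt2 : (i.*2.+1 < n)%N by rewrite (leq_trans _ Nn)// ltn_Sdouble.
  rewrite size_mkseq /= odd_double /= uphalf_double; apply => //.
    by move=> j ji; rewrite nth_mkseq//; apply: sgx; exact: ltn_trans ji _.
  exact: sgx.
split => //.
- split => // k; have [M MP] := kill k; exists M => j Mj; apply: MP Mj _ _ _ => //.
  by move=> i ij; rewrite sgs ltn_eqF.
- move=> i; have [_ _ _ _] := bP i.*2.
  rewrite size_mkseq odd_double doubleK => -[a].
  rewrite (_ : \sum_(j < _) _ = comb (sg^~ (v i)) s i.*2); last first.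
    by apply: eq_bigr => j _; rewrite nth_mkseq.
  move=> /eqP; rewrite subr_eq => /eqP ->; apply: (subspD (subsp_cspan _)).
    by apply: (subspZ (subsp_cspan _)); exact: mem_cspan.
  by exists i.*2; apply/lspan_comb; exists (sg^~ (v i)).
- move=> k; have [M MP] := kill k; exists M => n Mn x Vx.
  apply: (MP n Mn).
    apply: subspB => //; apply: subsp_sum => // i _; exact: subspZ.
  move=> i i_n; have [sgl _] := sgP i.
  by rewrite (scalB sgl) biorth_comb ?subrr.
Qed.

End OmegaSystems.

(** * Series along null sequences, projections and exchange automorphisms *)

Section Series.
Context (K : numFieldType) (R : realType) (S : scalars K R).
Local Notation nrm := (nrm S).
Local Notation emb := (emb S).
Context (X : lmodType K) (p : nat -> X -> R) (pC : calibrated S p).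
Implicit Types (E F U V W Z : set X) (x y : X) (s t v : nat -> X)
  (sg : nat -> X -> K) (A B P Q : X -> X).
Let pS n : rseminorm S (p n) := calibrated_seminorm pC n.
Hint Resolve pS : core.
Let p_ge0 n x : 0 <= p n x := calibrated_ge0 pC n x.
Hint Resolve p_ge0 : core.
Let subsp_kerp n : subsp (kerp p n) := subsp_kerp pC n.
Hint Resolve subsp_kerp : core.

Definition pcomplete := forall u : nat -> X,
  (forall k (e : R), 0 < e -> exists N, forall i j, (N <= i)%N -> (N <= j)%N ->
    p k (u i - u j) < e) ->
  exists x, forall k (e : R), 0 < e -> exists N, forall i, (N <= i)%N -> p k (u i - x) < e.

(** [A x] is the sum of the [sg j x *: t j] in the strong sense available for null sequences: modulo
    each kernel the partial sums are exact from an index that does not depend on [x]. *)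
Definition series sg t A := forall k, exists M, forall n, (M <= n)%N ->
  forall x, p k (A x - comb (sg^~ x) t n) = 0.

Lemma eq_p0 x y : (forall k, p k (x - y) = 0) -> x = y.
Proof. by move=> xy; apply/eqP; rewrite -subr_eq0; apply/eqP/(calibrated_sep pC). Qed.

Lemma p_lt_eq0 k x : (forall e : R, 0 < e -> p k x < e) -> p k x = 0.
Proof.
move=> H; apply/eqP; rewrite eq_le p_ge0 andbT leNgt; apply/negP => /H.
by rewrite ltxx.
Qed.

Lemma comb_tail k t (c : nat -> K) M m n :
  (forall j, (M <= j)%N -> p k (t j) = 0) -> (M <= m)%N -> (m <= n)%N ->
  p k (comb c t n - comb c t m) = 0.
Proof.
move=> tM Mm /subnK <-; elim: (n - m)%N => [|i IH].
  by rewrite subrr (sn0 (pS k)).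
rewrite addSn combS addrAC (sn_kerD (pS k))// (sn_kerZ (pS k))// tM//.
by rewrite (leq_trans Mm)// leq_addl.
Qed.

Lemma series_exists sg t : pcomplete -> nullseq p t -> exists A, series sg t A.
Proof.
move=> cplt t0.
have /choice[A AP] : forall x, exists y, forall k (e : R), 0 < e ->
    exists N, forall i, (N <= i)%N -> p k (comb (sg^~ x) t i - y) < e.
  move=> x; apply: cplt => k e e0; have [M MP] := t0 k; exists M => i j Mi Mj.
  have [ij|/ltnW ij] := leqP i j.
    by rewrite (snC (pS k)) (comb_tail _ MP Mi ij).
  by rewrite (comb_tail _ MP Mj ij).
exists A => k; have [M MP] := t0 k; exists M => n Mn x.
apply: p_lt_eq0 => e e0; have [N NP] := AP x k e e0.
have := NP (maxn N n) (leq_maxl _ _).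
rewrite (snC (pS k)) => /(le_lt_trans _); apply.
rewrite (le_trans (sn_tri (pS k) (comb (sg^~ x) t (maxn N n)) _ _))//.
by rewrite (comb_tail _ MP Mn (leq_maxr _ _)) addr0.
Qed.

Lemma series_unique sg t A B : series sg t A -> series sg t B -> forall x, A x = B x.
Proof.
move=> At Bt x; apply: eq_p0 => k; have [M MP] := At k; have [N NP] := Bt k.
have -> : A x - B x = (A x - comb (sg^~ x) t (maxn M N)) -
    (B x - comb (sg^~ x) t (maxn M N)) by rewrite opprB addrA subrK.
by rewrite (sn_kerB (pS k))// ?MP ?NP ?leq_maxl ?leq_maxr.
Qed.

Lemma eq_series sg t t' A : (forall j, t j = t' j) -> series sg t A -> series sg t' A.
Proof.
move=> tt' At k; have [M MP] := At k; exists M => n Mn x.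
by rewrite -(MP n Mn x); congr (p k (_ - _)); apply: eq_comb.
Qed.

Definition clin A := linear A /\ bounded_on p setT A.

Lemma series_clin sg t A : (forall j, scalar (sg j) /\ pbounded S p (sg j)) ->
  series sg t A -> clin A.
Proof.
move=> sgP At; split.
  move=> a x y; apply: eq_p0 => k; have [M MP] := At k.
  set c := fun x => comb (sg^~ x) t M.
  have cl : c (a *: x + y) = a *: c x + c y.
    rewrite /c /comb scaler_sumr -big_split; apply: eq_bigr => i _ /=.
    by rewrite (sgP i).1 scalerDl scalerA.
  suff -> : A (a *: x + y) - (a *: A x + A y) =
      (A (a *: x + y) - c (a *: x + y)) - (a *: (A x - c x) + (A y - c y)).
    have cP z : p k (A z - c z) = 0 by exact: (MP M (leqnn M)).
    by rewrite (sn_kerB (pS k))// (sn_kerD (pS k))// (sn_kerZ (pS k)).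
  by rewrite cl scalerBr addrACA -opprD [in RHS]opprB addrA subrK.
move=> k; have [M MP] := At k.
have [m [C CP]] : exists m C, forall x, p k (comb (sg^~ x) t M) <= C * p m x.
  elim: M {MP} => [|M [m [C CP]]].
    by exists k, 0 => x; rewrite /comb big_ord0 (sn0 (pS k)) mul0r.
  have [_ [l /(boundedP (pS l))[D D0 DP]]] := sgP M.
  exists (maxn m l), (`|C| + D * p k (t M)) => x.
  rewrite combS (le_trans (snD (pS k) _ _))// mulrDl lerD//.
    rewrite (le_trans (CP x))// (le_trans (y := `|C| * p m x))//.
      by rewrite ler_wpM2r// ler_norm.
    by rewrite ler_wpM2l// (calibrated_le pC)// leq_maxl.
  rewrite (snZ (pS k)) mulrAC ler_wpM2r// (le_trans (DP x))// ler_pM2l//.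
  by rewrite (calibrated_le pC)// leq_maxr.
exists m, C => x _; rewrite -(subrK (comb (sg^~ x) t M) (A x)).
by rewrite (snDl0 (pS k))// MP.
Qed.

Lemma clin_id : clin id.
Proof. by split => // k; exists k, 1 => x _; rewrite mul1r. Qed.

Lemma clinP A k : clin A -> exists m C,
  [/\ (k <= m)%N, 0 < C & forall x, p k (A x) <= C * p m x].
Proof.
move=> [_ /(bounded_onP pC)] /(_ k)[m [C [km C0 CP]]].
by exists m, C; split => // x; exact: CP.
Qed.

Lemma clin_ker A k : clin A -> exists2 m, (k <= m)%N &
  forall x, p m x = 0 -> p k (A x) = 0.
Proof.
move=> /(@clinP _ k)[m [C [km C0 CP]]]; exists m => // x xm.
by apply/eqP; rewrite eq_le p_ge0 andbT (le_trans (CP x))// xm mulr0.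
Qed.

Lemma clin_comp A B : clin A -> clin B -> clin (A \o B).
Proof.
move=> Ac Bc; split; first by move=> a x y /=; rewrite Bc.1 Ac.1.
move=> k; have [m [C [_ C0 CP]]] := clinP k Ac; have [n [D [_ D0 DP]]] := clinP m Bc.
by exists n, (C * D) => x _ /=; rewrite (le_trans (CP _))// -mulrA ler_pM2l.
Qed.

Lemma clinD A B : clin A -> clin B -> clin (fun x => A x + B x).
Proof.
move=> Ac Bc; split; first by move=> a x y /=; rewrite Bc.1 Ac.1 scalerDr addrACA.
move=> k; have [m [C [_ C0 CP]]] := clinP k Ac; have [n [D [_ D0 DP]]] := clinP k Bc.
exists (maxn m n), (C + D) => x _; rewrite (le_trans (snD (pS k) _ _))// mulrDl.
rewrite lerD// ?(le_trans (CP x)) ?(le_trans (DP x))// ler_pM2l// (calibrated_le pC)//.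
  by rewrite leq_maxl.
by rewrite leq_maxr.
Qed.

Lemma clinB A B : clin A -> clin B -> clin (fun x => A x - B x).
Proof.
move=> Ac Bc; apply: clinD => //; split.
  by move=> a x y; rewrite Bc.1 opprD scalerN.
by move=> k; have [n [D DP]] := Bc.2 k; exists n, D => x; rewrite (snN (pS k)); exact: DP.
Qed.

Lemma pbounded_comp f A : pbounded S p f -> clin A -> pbounded S p (f \o A).
Proof.
move=> [k /(boundedP (pS k))[C C0 CP]] /(@clinP _ k)[m [D [_ D0 DP]]].
by exists m, (C * D) => x /=; rewrite (le_trans (CP _))// -mulrA ler_pM2l.
Qed.

Lemma clin_comb A c t n : linear A -> A (comb c t n) = comb c (A \o t) n.
Proof.
by move=> Al; rewrite (lin_sum Al); apply: eq_bigr => i _; rewrite (linZ Al).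
Qed.

Lemma series_comp sg t A Q : clin Q -> series sg t A -> series sg (Q \o t) (Q \o A).
Proof.
move=> Qc At k; have [m km Qm] := clin_ker k Qc; have [M MP] := At m.
exists M => n Mn x /=; rewrite -(clin_comb _ _ _ (proj1 Qc)) -(linB (proj1 Qc)) Qm//.
exact: MP.
Qed.

Lemma series_at sg s t A j : (forall i, sg i (s j) = (i == j)%:R) ->
  series sg t A -> A (s j) = t j.
Proof.
move=> sgs At; apply: eq_p0 => k; have [M MP] := At k.
have := MP (maxn M j.+1) (leq_maxl _ _) (s j).
suff -> : comb (sg^~ (s j)) t (maxn M j.+1) = t j by [].
have jl : (j < maxn M j.+1)%N by exact: leq_maxr.
rewrite /comb (bigD1 (Ordinal jl))//= sgs eqxx scale1r big1 ?addr0// => i ij.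
rewrite sgs (_ : (nat_of_ord i == j) = false) ?scale0r//.
by apply: contraNF ij => /eqP ij; apply/eqP/val_inj.
Qed.

(** The intersection of the [U + ker p_k]. It is the topological closure when [U] is a subspace of
    finite dimension modulo every kernel, because finite spans are closed modulo a kernel. *)
Definition clo U : set X := [set x | forall k, exists2 u, U u & p k (x - u) = 0].

Lemma subsp_clo U : subsp U -> subsp (clo U).
Proof.
move=> sU; split; first by move=> k; exists 0; [exact: subsp0|rewrite subrr (sn0 (pS k))].
move=> a x y xU yU k; have [u Uu xu] := xU k; have [w Uw yw] := yU k.
exists (a *: u + w); first exact: sU.2.
by rewrite opprD addrACA -scalerBr (sn_kerD (pS k))// (sn_kerZ (pS k)).
Qed.

Lemma sub_clo U : U `<=` clo U.
Proof. by move=> x Ux k; exists x; rewrite // subrr (sn0 (pS k)). Qed.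

Lemma clo_sub U V : U `<=` V -> clo U `<=` clo V.
Proof. by move=> UV x xU k; have [u /UV ? ?] := xU k; exists u. Qed.

Lemma clo_fix U P : clin P -> (forall x, U x -> P x = x) ->
  forall x, clo U x -> P x = x.
Proof.
move=> Pc PU x xU; apply: eq_p0 => k; have [m km Pm] := clin_ker k Pc.
have [u Uu xu] := xU m.
have -> : P x - x = P (x - u) - (x - u).
  by rewrite (linB (proj1 Pc)) (PU u)// opprB addrA subrK.
by rewrite (sn_kerB (pS k)) ?Pm// (calibrated_ker pC km).
Qed.

Lemma series_clo sg s P x : series sg s P -> clo (cspan s) (P x).
Proof.
move=> Ps k; have [M MP] := Ps k; exists (comb (sg^~ x) s M); last exact: MP.
by exists M; apply/lspan_comb; exists (sg^~ x).
Qed.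

Section Exchange.
Variables (s s' : nat -> X) (sg sg' : nat -> X -> K) (P P' : X -> X).
Hypotheses (cplt : pcomplete)
  (om : omega_system S p s sg) (om' : omega_system S p s' sg')
  (Ps : series sg s P) (Ps' : series sg' s' P')
  (Pfix : forall j, P (s' j) = s' j) (P'fix : forall j, P' (s j) = s j).

(* J = id - P + A where A carries s to s'. *)
Lemma exchange : exists J J', [/\ clin J, clin J', cancel J J', cancel J' J &
  forall j, J (s j) = s' j].
Proof.
case: om => sgP sgs s0; case: om' => sgP' sgs' s0'.
have [A As] := series_exists sg cplt s0'; have [B Bs] := series_exists sg' cplt s0.
have Ac := series_clin sgP As; have Bc := series_clin sgP' Bs.
have Pc := series_clin sgP Ps; have P'c := series_clin sgP' Ps'.
have Pat j : P (s j) = s j by exact: (@series_at sg s s).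
have Aat j : A (s j) = s' j by exact: (@series_at sg s s').
have Bat j : B (s' j) = s j by exact: (@series_at sg' s' s).
(* Each identity compares two series over the same functionals: a continuous operator acts termwise,
   and the terms agree by biorthogonality or by [Pfix] and [P'fix]. *)
have PA x : P (A x) = A x.
  exact: (series_unique (eq_series Pfix (series_comp Pc As)) As).
have PP x : P (P x) = P x.
  exact: (series_unique (eq_series Pat (series_comp Pc Ps)) Ps).
have AP x : A (P x) = A x.
  exact: (series_unique (eq_series Aat (series_comp Ac Ps)) As).
have BA x : B (A x) = P x.
  exact: (series_unique (eq_series Bat (series_comp Bc As)) Ps).
have AB x : A (B x) = P' x.
  exact: (series_unique (eq_series Aat (series_comp Ac Bs)) Ps').
have PB x : P (B x) = B x.
  exact: (series_unique (eq_series Pat (series_comp Pc Bs)) Bs).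
have P'P x : P' (P x) = P x.
  exact: (series_unique (eq_series P'fix (series_comp P'c Ps)) Ps).
have [Pl _] := Pc; have [Al _] := Ac; have [Bl _] := Bc.
(* The inverse replaces [A] by [B P]; it works because [B A = P], [A B = P'] and [P' P = P]. *)
exists (fun x => x - P x + A x), (fun x => x - P x + B (P x)); split.
- by apply: clinD => //; apply: clinB => //; exact: clin_id.
- apply: clinD; last exact: clin_comp.
  by apply: clinB => //; exact: clin_id.
- move=> x /=.
  have -> : P (x - P x + A x) = A x by rewrite (linD Pl) (linB Pl) PP PA subrr add0r.
  by rewrite addrK BA subrK.
- move=> x /=.
  have -> : P (x - P x + B (P x)) = B (P x).
    by rewrite (linD Pl) (linB Pl) PP PB subrr add0r.
  by rewrite addrK (linD Al) (linB Al) AP AB P'P subrr add0r subrK.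
- by move=> j; rewrite Pat subrr add0r.
Qed.

End Exchange.

Lemma cspan_image A v x : linear A -> cspan v x -> cspan (A \o v) (A x).
Proof.
move=> Al [n vx]; exists n; have := lin_lspan Al vx.
by rewrite -map_comp.
Qed.

Lemma pdense_image J J' v : clin J -> clin J' -> cancel J' J ->
  pdense p (cspan v) -> pdense p (cspan (J \o v)).
Proof.
move=> Jc J'c J'K dv x k e e0; have [m [C [_ C0 CP]]] := clinP k Jc.
have [|y vy ye] := dv (J' x) m (e / C); first by rewrite divr_gt0.
exists (J y); first exact: cspan_image Jc.1 vy.
rewrite -{1}(J'K x) -(linB Jc.1) (le_lt_trans (CP _))//.
by rewrite mulrC -ltr_pdivlMr.
Qed.

(** If [J'] maps [ker p_m] into [ker p_n], then the image under [J] of the first subspace and the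
    second subspace have the same trace on the deeper kernel [ker p_m], because [J] carries the span
    of [z] onto that of [z']. *)
Lemma transport_isomorphic (e f z z' : nat -> X) n J J' :
  clin J -> clin J' -> cancel J J' -> cancel J' J ->
  (forall j, J (z j) = z' j) ->
  pdense p (cspan e) -> pdense p (cspan f) ->
  cspan e `&` kerp p n = cspan z -> cspan f `&` kerp p n = cspan z' ->
  isomorphic_sets p (cspan e) (cspan f).
Proof.
move=> Jc J'c JK J'K Jz de df ez fz.
have JE y : cspan (J \o e) y -> cspan e (J' y).
  move=> /(cspan_image J'c.1); congr (cspan _ _).
  by apply/funext => i /=; rewrite JK.
have [m nm Jm] := clin_ker n J'c.
apply: (@isomorphic_sets_trans _ _ _ _ _ pC _ (cspan (J \o e))).
  exists J, J'; split.
  - by move=> a x y _ _; exact: Jc.1.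
  - by move=> x ex; split; [exact: cspan_image Jc.1 ex|exact: JK].
  - by move=> y /JE.
  - by move=> k; have [l [C [_ _ CP]]] := clinP k Jc; exists l, C => x _; exact: CP.
  - by move=> k; have [l [C [_ _ CP]]] := clinP k J'c; exists l, C => x _; exact: CP.
apply: (same_kernel_isomorphic pC (m := m)) => //; first exact: pdense_image J'K de.
apply/seteqP; split => y [yE ym]; split => //.
  suff : (cspan f `&` kerp p n) y by case.
  rewrite fz -(J'K y) (_ : z' = J \o z); last by apply/funext => j /=; rewrite Jz.
  apply: (cspan_image Jc.1); rewrite -ez; split; first exact: JE.
  exact: Jm.
have : (cspan f `&` kerp p n) y by split => //; exact: (kerp_le pC nm).
rewrite fz (_ : z' = J \o z); last by apply/funext => j /=; rewrite Jz.
apply: cspan_sub; first exact: subsp_cspan.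
move=> j /=; apply: (cspan_image Jc.1).
have : (cspan e `&` kerp p n) (z j) by rewrite ez; exact: mem_cspan.
by case.
Qed.

Lemma fdq_image A V k m : linear A -> (forall x, p m x = 0 -> p k (A x) = 0) ->
  fdq V (kerp p m) -> fdq (A @` V) (kerp p k).
Proof.
move=> Al Am [L LV Lgen]; exists (map A L).
  by move=> _ /mapP[x xL ->]; exists x => //; exact: LV.
move=> _ [x Vx <-]; have [y Ly xy] := Lgen x Vx; exists (A y).
  exact: lin_lspan.
by rewrite /kerp /= -(linB Al) Am.
Qed.

Lemma comb_interleave (c d : nat -> K) v w n :
  comb (interleave c d) (interleave v w) n.*2 = comb c v n + comb d w n.
Proof.
elim: n => [|n IH]; first by rewrite /comb !big_ord0 addr0.
rewrite doubleS !combS IH /interleave /= odd_double /= uphalf_double doubleK.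
by rewrite addrACA addrA.
Qed.

Lemma nullseq_interleave s t : nullseq p s -> nullseq p t -> nullseq p (interleave s t).
Proof.
move=> s0 t0 k; have [M MP] := s0 k; have [N NP] := t0 k.
exists (maxn M N).*2 => j Mj; rewrite /interleave.
have Mj2 : (maxn M N <= j./2)%N by rewrite -(doubleK (maxn M N)) half_leq.
by case: ifP => _; [apply: NP|apply: MP]; rewrite (leq_trans _ Mj2)// ?leq_maxl ?leq_maxr.
Qed.

(** Feeding a spanning sequence to the biorthogonalisation makes the algebraic span of [s] equal to
    [V], while the series [P] is a continuous projection onto its closure. *)
Lemma omega_projection V b : pcomplete -> subsp V -> V = cspan b ->
  (forall k, fdq V (kerp p k)) -> ~ fdq V [set 0] ->
  exists s sg P, [/\ omega_system S p s sg, cspan s = V, series sg s P &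
    forall x, clo V x -> P x = x].
Proof.
move=> cplt sV Vb Vf Vinf.
have [|s [sg [om Vs sb sser]]] := omega_system_exists pC (v := b) sV Vf Vinf.
  by rewrite Vb; exact: mem_cspan.
have [sgP sgs s0] := om.
have [P PP] := series_exists sg cplt s0.
exists s, sg, P; split => //.
  apply/seteqP; split; first exact: cspan_sub.
  by rewrite Vb; apply: cspan_sub => //; exact: subsp_cspan.
apply: clo_fix; first exact: series_clin PP.
move=> x Vx; apply: eq_p0 => k; have [M MP] := PP k; have [N NP] := sser k.
rewrite -(opprB x) (snN (pS k)).
have -> : x - P x = (x - comb (sg^~ x) s (maxn M N)) - (P x - comb (sg^~ x) s (maxn M N)).
  by rewrite opprB addrA subrK.
by rewrite (sn_kerB (pS k))// ?MP ?NP// ?leq_maxl ?leq_maxr.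
Qed.

(** [Q = id - Pz] removes the closure of [Z], and [Q V] is infinite dimensional because that closure
    has infinite codimension in [V]. A basis of [Z] at even places and one for [Q V] at odd places,
    the functionals of the latter composed with [Q], form a basis for the closure of [V]. *)
Lemma adapted_omega_system V Z b : pcomplete -> subsp V -> Z `<=` V -> Z = cspan b ->
  (forall k, fdq V (kerp p k)) -> ~ fdq Z [set 0] -> ~ fdq V (clo Z) ->
  exists s sg P, [/\ omega_system S p s sg, cspan (fun j => s j.*2) = Z,
    series sg s P, forall j, clo V (s j) & forall x, clo V x -> P x = x].
Proof.
move=> cplt sV ZV Zb Vf Zinf Vinf.
have sZ : subsp Z by rewrite Zb; exact: subsp_cspan.
have Zf k : fdq Z (kerp p k) by apply: fdq_subl (Vf k).
have [z [zg [Pz [omz zZ Pzs Pzfix]]]] := omega_projection cplt sZ Zb Zf Zinf.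
have [zgP zgz z0] := omz; have Pzc := series_clin zgP Pzs.
have Qc : clin (fun x => x - Pz x) by apply: clinB => //; exact: clin_id.
set Q := fun x => x - Pz x in Qc.
have PzZ x : clo Z (Pz x) by rewrite -zZ; exact: series_clo.
have Qz j : Q (z j) = 0.
  by rewrite /Q Pzfix ?subrr//; apply: sub_clo; rewrite -zZ; exact: mem_cspan.
have zgQ i x : zg i (Q x) = 0.
  have [sgl [k sgb]] := zgP i; have [M MP] := Pzs k.
  rewrite (scalB sgl).
  have -> : zg i (Pz x) = zg i (comb (zg^~ x) z (maxn M i.+1)).
    apply/eqP; rewrite -subr_eq0 -(scalB sgl); apply/eqP/(bounded_ker sgb).
    by rewrite MP// leq_maxl.
  by rewrite biorth_comb ?subrr// leq_maxr.
pose W := Q @` V.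
have sW : subsp W.
  split; first by exists 0; [exact: subsp0|exact: (lin0 Qc.1)].
  move=> a _ _ [x Vx <-] [y Vy <-]; exists (a *: x + y); last exact: Qc.1.
  exact: sV.2.
have Wf k : fdq W (kerp p k).
  have [m km Qm] := clin_ker k Qc.
  exact: fdq_image Qc.1 Qm (Vf m).
have Winf : ~ fdq W [set 0].
  move=> /(fdq_indep W (@subsp_set0 _ _))[N NP].
  have [v vV iv] := not_fdq (subsp_clo sZ) Vinf N.
  apply: (NP (Q \o v)); first by move=> i iN; exists (v i) => //; exact: vV.
  move=> c; rewrite -(clin_comb _ _ _ (proj1 Qc)) /set1 /= /Q => /eqP.
  by rewrite subr_eq0 => /eqP cv; apply: iv; rewrite cv.
have [|u [ug [[ugP ugu u0] Wu _ user]]] :=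
    omega_system_exists pC (v := fun=> 0) sW Wf Winf.
  by move=> _; exact: subsp0.
have Qu j : Q (u j) = u j.
  have [x Vx <-] := Wu j; rewrite {1}/Q (_ : Pz (Q x) = 0) ?subr0//.
  by rewrite (linB Pzc.1) (Pzfix (Pz x) (PzZ x)) subrr.
pose s := interleave z u; pose sg := interleave zg (fun j => ug j \o Q).
have om : omega_system S p s sg.
  split.
  - move=> j; rewrite /sg /interleave; case: ifP => _; last exact: zgP.
    have [ugl ugb] := ugP j./2; split; last exact: pbounded_comp.
    by move=> a x y /=; rewrite Qc.1 ugl.
  - move=> i j; have -> : (i == j) = (odd i == odd j) && (i./2 == j./2).
      apply/eqP/andP => [->//|[/eqP oij /eqP hij]].
      by rewrite -(odd_double_half i) -(odd_double_half j) oij hij.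
    rewrite /sg /s /interleave; case: (odd i); case: (odd j) => /=.
    + by rewrite Qu ugu.
    + by rewrite Qz (scal0 (ugP _).1).
    + by have [x Vx <-] := Wu j./2; rewrite zgQ.
    + by rewrite zgz.
  - exact: nullseq_interleave.
have [sgP _ s0] := om; have [P PP] := series_exists sg cplt s0.
exists s, sg, P; split => //.
- by rewrite -zZ; congr cspan; apply/funext => j; rewrite /s /interleave odd_double doubleK.
- move=> j; rewrite /s /interleave; case: ifP => _; last first.
    by apply/sub_clo/ZV; rewrite -zZ; exact: mem_cspan.
  have [x Vx <-] := Wu j./2; apply: (subspB (subsp_clo sV)); first exact: sub_clo.
  exact: clo_sub ZV _ _.
apply: clo_fix; first exact: series_clin PP.
move=> x Vx; apply: eq_p0 => k; have [M MP] := PP k; have [N NP] := user k.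
have [M' MP'] := Pzs k; pose n := maxn M (maxn N M').
have Mn : (M <= n.*2)%N by rewrite -addnn (leq_trans _ (leq_addr _ _))// leq_maxl.
have := MP _ Mn x.
have -> : comb (sg^~ x) s n.*2 = comb (zg^~ x) z n + comb (ug^~ (Q x)) u n.
  rewrite -comb_interleave; apply: eq_comb => // i _.
  by rewrite /sg /interleave; case: ifP.
have WQx : W (Q x) by exists x.
have Nn : (N <= n)%N by rewrite /n; lia.
have M'n : (M' <= n)%N by rewrite /n; lia.
have := NP n Nn _ WQx; have := MP' n M'n x; set c1 := comb _ _ _; set c2 := comb _ _ _.
move=> h1 h2 h3.
have -> : P x - x = (P x - (c1 + c2)) - ((Q x - c2) + (Pz x - c1)).
  rewrite /Q addrACA subrK.
  by rewrite -[- c2 - c1]opprD (addrC c2) opprB addrA subrK.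
by rewrite (sn_kerB (pS k))// (sn_kerD (pS k)).
Qed.

(** Both traces fill the even places of bases of one host, so exchanging the bases carries one trace
    onto the other; with both closures of infinite codimension, the odd places match as well. *)
Lemma common_host_isomorphic V n (e f : nat -> X) : pcomplete -> subsp V ->
  (forall k, fdq V (kerp p k)) ->
  pdense p (cspan e) -> pdense p (cspan f) ->
  (forall Z, Z = cspan e `&` kerp p n \/ Z = cspan f `&` kerp p n ->
    [/\ Z `<=` V, ~ fdq Z [set 0] & ~ fdq V (clo Z)]) ->
  isomorphic_sets p (cspan e) (cspan f).
Proof.
move=> cplt sV Vf de df H.
have adapted (v : nat -> X) : let Z := cspan v `&` kerp p n in
    Z = cspan e `&` kerp p n \/ Z = cspan f `&` kerp p n ->
    exists s sg P, [/\ omega_system S p s sg, cspan (fun j => s j.*2) = Z,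
      series sg s P, forall j, clo V (s j) & forall x, clo V x -> P x = x].
  move=> Z /H[ZV Zinf Vinf].
  have sZ : subsp Z by apply: subspI => //; exact: subsp_cspan.
  have [b Zb] := @subsp_cspanned _ _ Z v sZ (@subIsetl _ _ _).
  exact: adapted_omega_system Zb _ _ _.
have [s [sg [P [om sZ Ps sV1 PV]]]] := adapted e (or_introl erefl).
have [s' [sg' [P' [om' sZ' Ps' sV1' PV']]]] := adapted f (or_intror erefl).
have [|j|J [J' [Jc J'c JK J'K Js]]] := exchange cplt om om' Ps Ps'.
- by move=> j; apply: PV.
- exact: PV'.
apply: (transport_isomorphic (n := n) Jc J'c JK J'K _ de df (esym sZ) (esym sZ')).
by move=> j; exact: Js.
Qed.

(** The bases of the two traces are exchanged directly: each projection fixes the common closure,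
    which contains both. *)
Lemma same_closure_isomorphic n (e f : nat -> X) : pcomplete ->
  pdense p (cspan e) -> pdense p (cspan f) ->
  (forall k, fdq (cspan e `&` kerp p n) (kerp p k)) ->
  (forall k, fdq (cspan f `&` kerp p n) (kerp p k)) ->
  ~ fdq (cspan e `&` kerp p n) [set 0] -> ~ fdq (cspan f `&` kerp p n) [set 0] ->
  clo (cspan e `&` kerp p n) = clo (cspan f `&` kerp p n) ->
  isomorphic_sets p (cspan e) (cspan f).
Proof.
move=> cplt de df ef ff einf finf clo_ef.
have sZ v : subsp (cspan v `&` kerp p n) by apply: subspI => //; exact: subsp_cspan.
have [b eb] := subsp_cspanned (sZ e) (@subIsetl _ _ _).
have [b' fb'] := subsp_cspanned (sZ f) (@subIsetl _ _ _).
have [s [sg [P [om sE Ps PV]]]] := omega_projection cplt (sZ e) eb ef einf.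
have [s' [sg' [P' [om' sF Ps' PV']]]] := omega_projection cplt (sZ f) fb' ff finf.
have [j|j|J [J' [Jc J'c JK J'K Js]]] := exchange cplt om om' Ps Ps'.
- by apply: PV; rewrite clo_ef -sF; apply: sub_clo; exact: mem_cspan.
- by apply: PV'; rewrite -clo_ef -sE; apply: sub_clo; exact: mem_cspan.
exact: (transport_isomorphic (n := n) Jc J'c JK J'K Js de df (esym sE) (esym sF)).
Qed.

End Series.

(** * The classes of dense subspaces *)

Section Classes.
Context (K : numFieldType) (R : realType) (S : scalars K R).
Local Notation nrm := (nrm S).
Local Notation emb := (emb S).
Context (X : lmodType K) (p : nat -> X -> R) (pC : calibrated S p).
Implicit Types (E F U V W Z : set X) (x y : X) (s t v e f : nat -> X)
  (sg : nat -> X -> K) (A B P Q : X -> X).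
Let pS n : rseminorm S (p n) := calibrated_seminorm pC n.
Hint Resolve pS : core.
Let p_ge0 n x : 0 <= p n x := calibrated_ge0 pC n x.
Hint Resolve p_ge0 : core.
Let subsp_kerp n : subsp (kerp p n) := subsp_kerp pC n.
Hint Resolve subsp_kerp : core.

(** The types express the conditions through one fixed sequence. The kernels of two defining
    sequences are cofinal in each other, so the choice is immaterial; the index [n] in type 2 stands
    for passing to a tail. *)
Definition type0 E := forall m, fdq E (kerp p m).
Definition type1 E := exists n, E `&` kerp p n `<=` [set 0].
(** The trace on [ker p_n] then carries its weak topology, hence the name. *)
Definition weak_at E n := forall m, fdq (E `&` kerp p n) (kerp p m).
Definition type2 E := exists n, [/\ ~ fdq E (kerp p n), weak_at E n &
  forall m, exists2 x, (E `&` kerp p m) x & x <> 0].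
Definition type3 E := forall n, exists m, ~ fdq (E `&` kerp p n) (kerp p m).

Lemma weak_at_le E m n : (m <= n)%N -> weak_at E m -> weak_at E n.
Proof.
move=> mn Em k; apply: fdq_subl (Em k) => //.
by apply: setIS; exact: (kerp_le pC mn).
Qed.

Lemma type_cases E : subsp E -> [\/ type0 E, type1 E, type2 E | type3 E].
Proof.
move=> sE; have [?|/existsNP[n nP]] := pselect (type3 E); first exact: Or44.
have weak : weak_at E n by move=> m; apply: contrapT => H; apply: nP; exists m.
have [?|n1] := pselect (type1 E); first exact: Or42.
have [fE|nE] := pselect (fdq E (kerp p n)).
  by apply: Or41 => m; apply: (fdq_trans sE fE); exact: weak.
apply: Or43; exists n; split => // m; apply: contrapT => H; apply: n1; exists m.
by move=> x [Ex xm]; apply: contrapT => x0; apply: H; exists x.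
Qed.

Lemma type01 E : subsp E -> type0 E -> type1 E -> fdq E [set 0].
Proof.
move=> sE E0 [n En]; apply: fdq_trans (E0 n) _ => //.
by exists [::] => // x /En ->; exists 0; rewrite // subrr.
Qed.
Lemma type02 E : type0 E -> type2 E -> False.
Proof. by move=> E0 [n [+ _ _]]; apply; exact: E0. Qed.
Lemma type03 E : type0 E -> type3 E -> False.
Proof. by move=> E0 /(_ 0%N)[m]; apply; apply: fdq_subl (E0 m) => // x []. Qed.
Lemma type12 E : type1 E -> type2 E -> False.
Proof. by move=> [n En] [_ [_ _ /(_ n)[x /En]]]. Qed.
Lemma type13 E : type1 E -> type3 E -> False.
Proof.
move=> [n En] /(_ n)[m]; apply; exists [::] => // x /En ->; exists 0 => //.
by rewrite subrr; exact: subsp0.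
Qed.
Lemma type0_sub E F : E `<=` F -> type0 F -> type0 E.
Proof. by move=> EF F0 m; apply: fdq_subl (F0 m). Qed.
Lemma type1_sub E F : E `<=` F -> type1 F -> type1 E.
Proof. by move=> EF [n Fn]; exists n => x [/EF Fx xn]; apply: Fn. Qed.
Lemma type3_super E F : E `<=` F -> type3 E -> type3 F.
Proof.
move=> EF E3 n; have [m Em] := E3 n; exists m; apply: contra_not Em.
by apply: fdq_subl => //; exact: setSI.
Qed.

(** A finite span meets some kernel only in 0. *)
Lemma infinite_of_nonzero Z : (forall m, exists2 x, (Z `&` kerp p m) x & x <> 0) ->
  ~ fdq Z [set 0].
Proof.
move=> Znz [L _ Lgen]; have [k kP] := lspan_kerp_trivial pC L.
have [x [Zx xk]] := Znz k; apply; have [y Ly xy] := Lgen x Zx.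
by apply: kP xk; move: xy => /= /eqP; rewrite subr_eq0 => /eqP ->.
Qed.

Lemma type2_at E n m : (n <= m)%N -> [/\ ~ fdq E (kerp p n), weak_at E n &
    forall m, exists2 x, (E `&` kerp p m) x & x <> 0] ->
  weak_at E m /\ ~ fdq (E `&` kerp p m) [set 0].
Proof.
move=> nm [_ weak nz]; split; first exact: weak_at_le weak.
apply: infinite_of_nonzero => k.
have [x [Ex xk] x0] := nz (maxn m k); exists x => //; split.
  by split => //; apply: (kerp_le pC (leq_maxl m k)).
exact: (kerp_le pC (leq_maxr m k)).
Qed.

Lemma clo_kerp n : clo p (kerp p n) `<=` kerp p n.
Proof.
move=> x xn; have [u un xu] := xn n; rewrite -(subrK u x).
exact: (subspD (subsp_kerp n)).
Qed.

Lemma fdq_cspan_tail v V M : subsp V -> (forall j, (M <= j)%N -> V (v j)) ->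
  fdq (cspan v) V.
Proof.
move=> sV vV; exists (mkseq v M).
  by move=> _ /mapP[i _ ->]; exact: mem_cspan.
move=> x vx.
have sW : subsp (sumset (lspan (mkseq v M)) V).
  by apply: subsp_sumset => //; exact: subsp_lspan.
apply: (cspan_sub sW _ vx) => j; have [Mj|jM] := leqP M j.
  by apply: sumsetr (vV _ Mj); exact: subsp_lspan.
by apply: sumsetl => //; exact: lspan_mkseq_mem.
Qed.

Lemma fdq_sumset U V W : subsp U -> subsp V -> subsp W ->
  fdq U W -> fdq V W -> fdq (sumset U V) W.
Proof.
move=> sU sV sW [L LU Lg] [L' L'V L'g]; exists (L ++ L').
  move=> x; rewrite mem_cat => /orP[/LU|/L'V].
    exact: sumsetl.
  exact: sumsetr.
move=> x [u Uu Vxu]; have [y Ly uy] := Lg u Uu; have [z Lz xz] := L'g _ Vxu.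
exists (y + z).
  by apply/lspan_cat; exists y => //; rewrite addrAC subrr add0r.
have -> : x - (y + z) = (u - y) + (x - u - z).
  by rewrite addrACA [u + _]addrC subrK opprD.
exact: (subspD sW).
Qed.

Lemma infinite_type2_dense n v : pdense p (cspan v) -> ~ fdq setT (kerp p n) ->
  weak_at (cspan v) n ->
  (forall m, exists2 x, (cspan v `&` kerp p m) x & x <> 0) -> type2 (cspan v).
Proof.
move=> dv nf weak nz; exists n; split => //.
by apply: contra_not nf; exact: (dense_fdq pC dv).
Qed.

Section Frechet.
Hypotheses (cplt : pcomplete p) (sepX : pseparable p)
  (infX : ~ fdq setT [set (0 : X)]).

Lemma dense_exists : exists v, pdense p (cspan v).
Proof. by have [d dP] := sepX; exists d; exact: pdense_cspan. Qed.

Lemma dense_type0 e : pdense p (cspan e) -> type0 (cspan e) <-> type0 setT.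
Proof.
move=> de; split; last exact: type0_sub.
by move=> e0 m; exact: (dense_fdq pC de (e0 m)).
Qed.

(** The biorthogonal basis extracted from each subspace spans all of it, and its projection is the
    identity of [X], so an exchange automorphism maps one subspace onto the other. *)
Lemma type0_isomorphic e f : type0 setT -> pdense p (cspan e) -> pdense p (cspan f) ->
  isomorphic_sets p (cspan e) (cspan f).
Proof.
move=> X0.
have H v : pdense p (cspan v) -> exists s sg P,
    [/\ omega_system S p s sg, cspan s = cspan v, series p sg s P & forall x, P x = x].
  move=> dv; have v0 : type0 (cspan v) by exact: type0_sub X0.
  have [s [sg [P [om sv Ps PV]]]] := omega_projection pC cplt (subsp_cspan v) erefl v0
    (dense_infinite pC dv infX).
  exists s, sg, P; split => // x; apply: PV => k.
  have [L Lv Lgen] := v0 k; have [y Ly xy] := dense_span_kerp pC dv Lgen x.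
  by exists y => //; apply: lspan_sub Ly => //; exact: subsp_cspan.
move=> /H[s [sg [P [om <- Ps PV]]]] /H[s' [sg' [P' [om' <- Ps' PV']]]].
have [//|//|J [J' [Jc J'c JK J'K Js]]] := exchange pC cplt om om' Ps Ps'.
have JE : J \o s = s' by apply/funext.
have J'E : J' \o s' = s by apply/funext => j /=; rewrite -Js JK.
exists J, J'; split.
- by move=> a x y _ _; exact: Jc.1.
- by move=> x sx; split => //; rewrite -JE; exact: cspan_image Jc.1 sx.
- by move=> x sx; split => //; rewrite -J'E; exact: cspan_image J'c.1 sx.
- by move=> k; have [l [C [_ _ CP]]] := clinP pC k Jc; exists l, C => x _; exact: CP.
- by move=> k; have [l [C [_ _ CP]]] := clinP pC k J'c; exists l, C => x _; exact: CP.
Qed.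

Lemma type1_exists : ~ type0 setT -> exists2 v, pdense p (cspan v) & type1 (cspan v).
Proof.
move=> /existsNP[n nf].
have [|v dv vn] := @dense_with_kernel _ _ _ _ _ pC n (fun=> 0) sepX nf.
  by move=> _; exact: subsp0.
exists v => //; exists n; rewrite vn; apply: cspan_sub => //.
exact: subsp_set0.
Qed.

Lemma dense_not_type01 e : pdense p (cspan e) -> type0 (cspan e) -> type1 (cspan e) -> False.
Proof.
move=> de e0 e1; apply: (dense_infinite pC de infX).
exact: type01 (subsp_cspan e) e0 e1.
Qed.

Lemma type1_isomorphic e f : pdense p (cspan e) -> pdense p (cspan f) ->
  type1 (cspan e) -> type1 (cspan f) -> isomorphic_sets p (cspan e) (cspan f).
Proof.
move=> de df [n en] [m fm]; apply: (same_kernel_isomorphic pC (m := maxn n m)) => //.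
have H v k : (k <= maxn n m)%N -> cspan v `&` kerp p k `<=` [set 0] ->
    cspan v `&` kerp p (maxn n m) = [set 0].
  move=> kle vk; apply/seteqP; split => x.
    by move=> [vx xm]; apply: vk; split => //; exact: (kerp_le pC kle).
  by move=> ->; split; [exact: (subsp0 (subsp_cspan v))|exact: (subsp0 (subsp_kerp _))].
by rewrite (H e n) ?leq_maxl// (H f m) ?leq_maxr.
Qed.

Lemma not_type1_nonzero : ~ type1 setT -> forall n, exists2 x, kerp p n x & x <> 0.
Proof.
move=> n1 n; apply: contrapT => H; apply: n1; exists n => x [_ xn].
by apply: contrapT => x0; apply: H; exists x.
Qed.

(** The prescribed trace is spanned by nonzero vectors [x j] of [ker p_(n + j)]. They form a null
    sequence, so their span is finite dimensional modulo every kernel and yet meets every kernel. *)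
Lemma type2_exists : ~ type0 setT -> ~ type1 setT ->
  exists2 v, pdense p (cspan v) & type2 (cspan v).
Proof.
move=> /existsNP[n nf] n1.
have /choice[x xP] : forall j, exists x, kerp p (n + j) x /\ x <> 0.
  by move=> j; have [x] := not_type1_nonzero n1 (n + j); exists x.
have [|v dv vn] := @dense_with_kernel _ _ _ _ _ pC n x sepX nf.
  by move=> i; apply: (kerp_le pC (leq_addr i n)); case: (xP i).
exists v => //; apply: infinite_type2_dense nf _ _ => //.
  move=> m; rewrite vn; apply: (@fdq_cspan_tail _ _ m) => // j mj.
  apply: (@kerp_le _ _ _ _ _ pC _ (n + j)); last by case: (xP j).
  by rewrite (leq_trans mj)// leq_addl.
move=> m; have [xm x0] := xP m; exists (x m) => //; split.
  have : (cspan v `&` kerp p n) (x m) by rewrite vn; exact: mem_cspan.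
  by case.
by apply: (kerp_le pC (leq_addl n m)).
Qed.

(* For X in F_2 this property separates the two classes of (3): the closure of
   E `&` ker p_n is all of ker p_n, as opposed to infinite codimensional. *)
Definition full_at E n := weak_at setT n /\ kerp p n `<=` clo p (E `&` kerp p n).
Definition full E := exists n, full_at E n.

Lemma full_at_le E m n : (m <= n)%N -> full_at E m -> full_at E n.
Proof.
move=> mn [weak Em]; split; first exact: weak_at_le weak.
move=> x xn k; have [u [Eu um] xu] := Em x (kerp_le pC mn xn) (maxn n k).
exists u; last by apply: (calibrated_ker pC (leq_maxr n k)).
split => //; rewrite -(subKr x u); apply: (subspB (subsp_kerp n)) => //.
by apply: (calibrated_ker pC (leq_maxl n k)).
Qed.

Lemma full_isomorphic e f : pdense p (cspan e) -> pdense p (cspan f) ->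
  type2 (cspan e) -> type2 (cspan f) -> full (cspan e) -> full (cspan f) ->
  isomorphic_sets p (cspan e) (cspan f).
Proof.
move=> de df [n1 e2] [n2 f2] [n3 e3] [n4 f4].
pose n := maxn (maxn n1 n2) (maxn n3 n4).
have [] : [/\ n1 <= n, n2 <= n, n3 <= n & n4 <= n]%N by rewrite /n; split; lia.
move=> l1 l2 l3 l4.
have [ew ei] := type2_at l1 e2; have [fw fi] := type2_at l2 f2.
have [_ efull] := full_at_le l3 e3; have [_ ffull] := full_at_le l4 f4.
apply: (same_closure_isomorphic pC (n := n)) => //.
have H v : kerp p n `<=` clo p (cspan v `&` kerp p n) ->
    clo p (cspan v `&` kerp p n) = kerp p n.
  move=> vn; apply/seteqP; split => //; apply: subset_trans (@clo_kerp n).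
  by apply: clo_sub => x [].
by rewrite (H e)// (H f).
Qed.

(** The host is [ker p_n] itself. Were the closure of a trace of finite codimension in it, the trace
    would be full at a deeper kernel. *)
Lemma not_full_isomorphic e f : type2 setT ->
  pdense p (cspan e) -> pdense p (cspan f) ->
  type2 (cspan e) -> type2 (cspan f) -> ~ full (cspan e) -> ~ full (cspan f) ->
  isomorphic_sets p (cspan e) (cspan f).
Proof.
move=> [n0 [_ weak0 _]] de df [n1 e2] [n2 f2] e3 f3.
pose n := maxn n0 (maxn n1 n2).
have [] : [/\ n0 <= n, n1 <= n & n2 <= n]%N by rewrite /n; split; lia.
move=> l0 l1 l2.
have weak : weak_at setT n := weak_at_le l0 weak0.
have key v : ~ full (cspan v) ->
    ~ fdq (kerp p n) (clo p (cspan v `&` kerp p n)).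
  move=> nfull [L Ln Lgen]; apply: nfull.
  set Z := cspan v `&` kerp p n in Lgen *.
  have sZ : subsp Z by apply: subspI => //; exact: subsp_cspan.
  have sU k : subsp (sumset Z (kerp p k)) by exact: subsp_sumset.
  (* The subspaces [Z + ker p_k] decrease to the closure of [Z]. On the span of the finitely many
     missing directions [L] they stabilise at some [k], so for vectors of [ker p_n] lying in
     [ker p_k] the component along [L] is in that closure. *)
  have [k kP] := decreasing_stab sU
    (fun k x '(ex_intro2 y Zy xy) => ex_intro2 _ _ y Zy (kerp_le pC (leqnSn k) xy)) L.
  exists (maxn n k); split; first exact: weak_at_le (leq_maxl _ _) weak.
  move=> x xm j.
  have xn := kerp_le pC (leq_maxl n k) xm; have xk := kerp_le pC (leq_maxr n k) xm.
  have [y Ly xy] := Lgen x xn.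
  have yU : forall j, sumset Z (kerp p j) y.
    apply: kP => //; rewrite -(subKr x y); apply: (subspB (sU k)).
      exact: sumsetr.
    by have [u Zu ?] := xy k; exists u.
  have xclo : clo p Z x.
    rewrite -(subrK y x); apply: (subspD (subsp_clo pC sZ)) => //.
  have [u [vu un] xu] := xclo (maxn (maxn n k) j).
  exists u; last by apply: (calibrated_ker pC (leq_maxr (maxn n k) j)).
  split => //; rewrite -(subKr x u); apply: (subspB (subsp_kerp _)) => //.
  by apply: (calibrated_ker pC (leq_maxl (maxn n k) j)).
have [ew ei] := type2_at l1 e2; have [fw fi] := type2_at l2 f2.
apply: (common_host_isomorphic pC (V := kerp p n) (n := n)) => //.
  by move=> k; have := weak k; rewrite setTI.
by move=> Z [|] ->; split => //; try exact: key; exact: subIsetr.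
Qed.

(** The two traces are spanned by all the [s j] and by those with even index. The second is never
    full: [s (2 M + 1)] lies in deep kernels, but its coordinate functional kills the trace. *)
Lemma full_and_not_full : type2 setT ->
  (exists v, [/\ pdense p (cspan v), type2 (cspan v) & full (cspan v)]) /\
  (exists v, [/\ pdense p (cspan v), type2 (cspan v) & ~ full (cspan v)]).
Proof.
move=> [n [nf weak nz]].
have weakV k : fdq (kerp p n) (kerp p k) by have := weak k; rewrite setTI.
have infV : ~ fdq (kerp p n) [set 0].
  apply: infinite_of_nonzero => m; have [x [_ xm] x0] := nz (maxn n m).
  exists x => //; split; first by apply: (kerp_le pC (leq_maxl n m)).
  by apply: (kerp_le pC (leq_maxr n m)).
have [|s [sg [[sgP sgs s0] sV _ sser]]] :=
    omega_system_exists pC (v := fun=> 0) (subsp_kerp n) weakV infV.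
  by move=> _; exact: subsp0.
have s_neq0 j : s j <> 0.
  by move=> sj; have := sgs j j; rewrite sj (scal0 (sgP j).1) eqxx => /esym/eqP;
     rewrite oner_eq0.
have sub (i : nat -> nat) : (forall j, (j <= i j)%N) ->
    exists v, [/\ pdense p (cspan v), type2 (cspan v) &
      cspan v `&` kerp p n = cspan (s \o i)].
  move=> i_ge; have [|v dv vn] := @dense_with_kernel _ _ _ _ _ pC n (s \o i) sepX nf.
    by move=> j; exact: sV.
  exists v; split => //; apply: infinite_type2_dense nf _ _ => //.
    move=> m; rewrite vn; apply: fdq_subl (weakV m) => //.
    by apply: cspan_sub => // j; exact: sV.
  move=> m; have [M MP] := s0 m; exists (s (i M)); last exact: s_neq0.
  split; last by rewrite /kerp /= MP.
  have : (cspan v `&` kerp p n) (s (i M)).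
    by rewrite vn; exact: (mem_cspan (s \o i)).
  by case.
split.
  have [//|v [dv v2 vn]] := sub id; exists v; split => //; exists n; split => //.
  move=> x xn k; rewrite vn; have [M MP] := sser k.
  exists (comb (sg^~ x) s M); last exact: MP.
  by exists M; apply/lspan_comb; exists (sg^~ x).
have [|v [dv v2 vn]] := sub double.
  by move=> j; rewrite -addnn leq_addl.
exists v; split => // -[n1 v3].
have [_ v4] := full_at_le (leq_maxr n n1) v3.
have [M MP] := s0 (maxn n n1).
have sM : kerp p (maxn n n1) (s M.*2.+1).
  by rewrite /kerp /= MP//; lia.
have [sgl [k sgb]] := sgP M.*2.+1.
have [u [vu un] su] := v4 _ sM k.
have := bounded_ker sgb su; rewrite (scalB sgl) sgs eqxx.
suff -> : sg M.*2.+1 u = 0 by rewrite subr0 => /eqP; rewrite oner_eq0.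
have : (cspan v `&` kerp p n) u by split => //; exact: (kerp_le pC (leq_maxl n n1)).
rewrite vn; apply: (@cspan_sub _ _ _ [set x | sg M.*2.+1 x = 0]).
  split; first exact: scal0.
  by move=> a x y /= x0 y0; rewrite sgl x0 y0 mulr0 addr0.
move=> j /=; rewrite sgs (_ : (_ == _) = false)//.
by apply/eqP => /(congr1 odd); rewrite /= !odd_double.
Qed.

Lemma dense_seq E x : pdense p E -> exists u : nat -> X,
  (forall j, E (u j)) /\ forall k (e : R), 0 < e -> exists N, forall j, (N <= j)%N ->
    p k (x - u j) < e.
Proof.
move=> dE; have /choice[u uP] : forall j, exists y, E y /\ p j (x - y) < j.+1%:R^-1.
  by move=> j; have [|y] := dE x j j.+1%:R^-1; [rewrite invr_gt0|exists y].
exists u; split => [j|k e e0]; first by case: (uP j).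
have [b kb be] := inv_small k e0; exists b => j bj.
have [_ uj] := uP j; apply: le_lt_trans (lt_trans _ be).
  exact: (calibrated_le pC _ (leq_trans kb bj)).
apply: lt_le_trans uj _.
by rewrite lef_pV2 ?posrE// ler_nat ltnS.
Qed.

(** Completeness lets [f] and [g] act on limits: [y] is a limit of some [u j] in [F], the [g (u j)]
    converge to some [x] in [ker p_n], a vector [z] of the trace of [E] agrees with [x] modulo a
    deep kernel, and [f z] agrees with [y] modulo the prescribed one. *)
Lemma full_invariant E F : subsp E -> subsp F -> pdense p F -> type2 setT ->
  isomorphic_sets p E F -> full E -> full F.
Proof.
move=> sE sF dF [n0 [_ weak0 _]] [f [g [fl fP gP fb gb]]] [n [weak En]].
have gl := lin_on_inverse sE fl fP gP.
have lB (G : set X) h : subsp G -> lin_on G h -> forall x y, G x -> G y -> h (x - y) = h x - h y.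
  move=> sG hl x y Gx Gy; rewrite -scaleN1r addrC hl// scaleN1r addrC.
  by [].
have [n' [C [nn' C0 CP]]] := bounded_onP pC gb n.
exists (maxn n0 n'); split; first exact: weak_at_le (leq_maxl _ _) weak0.
set N := maxn n0 n'; move=> y yN k; pose k' := maxn k N.
have [u [Fu uy]] := dense_seq y dF.
have Eu j : E (g (u j)) by case: (gP _ (Fu j)).
have [x xlim] : exists x, forall l (e : R), 0 < e ->
    exists M, forall j, (M <= j)%N -> p l (g (u j) - x) < e.
  apply: cplt => l e e0; have [m [D [_ D0 DP]]] := bounded_onP pC gb l.
  have e2 : 0 < e / D / 2 by rewrite !divr_gt0.
  have [M MP] := uy m _ e2; exists M => i j Mi Mj.
  rewrite -(lB F)// (le_lt_trans (DP _ _))//; first exact: (subspB sF).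
  rewrite mulrC -ltr_pdivlMr//.
  have := sn_tri (pS m) y (u i) (u j); have := MP i Mi; have := MP j Mj.
  by rewrite (snC (pS m) (u i) y); lra.
have xn : kerp p n x.
  apply: (p_lt_eq0 pC) => e e0.
  have e2 : 0 < e / 2 by rewrite divr_gt0.
  have e3 : 0 < e / 2 / C by rewrite divr_gt0.
  have [M1 M1P] := xlim n _ e2; have [M2 M2P] := uy n' _ e3.
  pose j := maxn M1 M2.
  have := M1P j (leq_maxl _ _).
  have : C * p n' (y - u j) < e / 2 by rewrite mulrC -ltr_pdivlMr// M2P// leq_maxr.
  have yn' : p n' y = 0 by apply: (calibrated_ker pC (leq_maxr n0 n')).
  rewrite -(snN (pS n')) opprB (snBr0 (pS n') _ yn').
  have := CP _ (Fu j); have := snB (pS n) (g (u j)) (g (u j) - x).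
  by rewrite subKr; lra.
have [M [D [_ D0 DP]]] := bounded_onP pC fb k'.
have [z [Ez zn] xz] := En x xn M.
have yz : p k' (y - f z) = 0.
  apply: (p_lt_eq0 pC) => e e0.
  have e2 : 0 < e / 2 by rewrite divr_gt0.
  have e3 : 0 < e / 2 / D by rewrite divr_gt0.
  have [M1 M1P] := xlim M _ e3; have [M2 M2P] := uy k' _ e2.
  pose j := maxn M1 M2.
  have h1 : D * p M (g (u j) - x) < e / 2.
    by rewrite mulrC -ltr_pdivlMr// M1P// leq_maxl.
  have h2 := M2P j (leq_maxr _ _).
  have zx : p M (g (u j) - z) = p M (g (u j) - x).
    have -> : g (u j) - z = (g (u j) - x) + (x - z) by rewrite addrA subrK.
    by rewrite (snDr0 (pS M)).
  have := DP (g (u j) - z) (subspB sE (Eu j) Ez).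
  rewrite (lB E)// (gP _ (Fu j)).2 zx; have := sn_tri (pS k') (u j) y (f z).
  by move: h1 h2; lra.
exists (f z); last by apply: (calibrated_ker pC (leq_maxl k N)).
split; first by case: (fP _ Ez).
rewrite -(subKr y (f z)); apply: (subspB (subsp_kerp N)) => //.
by apply: (calibrated_ker pC (leq_maxr k N)).
Qed.

Lemma scalar_kernel_infinite U V (g : X -> K) : scalar g -> subsp U -> subsp V ->
  ~ fdq U V -> ~ fdq (U `&` [set x | g x = 0]) V.
Proof.
move=> gl sU sV nf fU; apply: nf.
have [gU|/existsNP[u /not_implyP[Uu /eqP gu]]] := pselect (forall x, U x -> g x = 0).
  by apply: fdq_subl fU => // x Ux; split => //; exact: gU.
apply: (fdq_trans sU _ fU); exists [:: u].
  by move=> x; rewrite inE => /eqP ->.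
move=> x Ux; exists ((g x / g u) *: u).
  by exists (g x / g u) => /=; rewrite subrr.
by rewrite /= (scalB gl) (scalZ gl) divfK// subrr.
Qed.

Lemma vanishing_vector U V (g : nat -> X -> K) M : (forall i, scalar (g i)) ->
  subsp U -> subsp V -> ~ fdq U V ->
  exists x, [/\ U x, forall i, (i < M)%N -> g i x = 0 & ~ V x].
Proof.
move=> gl; elim: M U => [|M IH] U sU sV nf.
  apply: contrapT => H; apply: nf; exists [::] => // x Ux; exists 0 => //.
  by rewrite subr0; apply: contrapT => Vx; apply: H; exists x.
have [||x [[Ux gx] gMx Vx]] := IH (U `&` [set x | g M x = 0]) _ sV.
- apply: subspI => //; split; first exact: scal0.
  by move=> a x y /= x0 y0; rewrite gl x0 y0 mulr0 addr0.
- exact: scalar_kernel_infinite.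
exists x; split => // i; rewrite ltnS leq_eqVlt => /predU1P[->//|]; exact: gMx.
Qed.

(** The sum [V0] of the traces might contain one of their closures with finite codimension. Adding a
    null sequence [h] of nonzero vectors killed by the projection [P] onto the closure of [V0] keeps
    the host finite dimensional modulo each kernel and makes both codimensions infinite. *)
Lemma type3_isomorphic e f : type3 setT -> pdense p (cspan e) -> pdense p (cspan f) ->
  type2 (cspan e) -> type2 (cspan f) -> isomorphic_sets p (cspan e) (cspan f).
Proof.
move=> X3 de df [n1 e2] [n2 f2]; pose n := maxn n1 n2.
have [ew ei] := type2_at (leq_maxl n1 n2) e2; have [fw fi] := type2_at (leq_maxr n1 n2) f2.
rewrite -/n in ew ei fw fi.
set Ze := cspan e `&` kerp p n in ei; set Zf := cspan f `&` kerp p n in fi.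
have sZ v : subsp (cspan v `&` kerp p n) by apply: subspI => //; exact: subsp_cspan.
pose V0 := sumset Ze Zf.
have sV0 : subsp V0 := subsp_sumset (sZ e) (sZ f).
have V0f k : fdq V0 (kerp p k) by exact: (fdq_sumset (sZ e) (sZ f) (subsp_kerp k) (ew k) (fw k)).
have ZeV0 : Ze `<=` V0 := sumsetl (sZ f).
have ZfV0 : Zf `<=` V0 := sumsetr (sZ e).
have V0i : ~ fdq V0 [set 0].
  by apply: contra_not ei; apply: fdq_subl => //; exact: subsp_set0.
have [b eb] := subsp_cspanned (sZ e) (@subIsetl _ _ _).
have [b' fb'] := subsp_cspanned (sZ f) (@subIsetl _ _ _).
have V0b : V0 = cspan (interleave b b') by rewrite cspan_interleave -eb -fb'.
have [w [wg [P [[wgP wgw w0] wV0 Pw PV0]]]] := omega_projection pC cplt sV0 V0b V0f V0i.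
have Pc := series_clin pC wgP Pw.
have PV x : clo p V0 (P x) by rewrite -wV0; exact: series_clo.
(* If enough coordinates of [x] vanish, [P x] lies in [ker p_q] and in [ker p_r]. For [x] in
   [ker p_q] but not in [ker p_r], the vector [x - P x] is then a nonzero element of [ker p_q]. *)
have /choice[h hP] : forall q, exists h, [/\ kerp p q h, P h = 0 & h <> 0].
  move=> q; have [r nqr] := X3 q; rewrite setTI in nqr.
  have [M MP] := Pw q; have [M' MP'] := Pw r; pose L := maxn M M'.
  have [x [xq wgx xr]] := vanishing_vector L (fun i => (wgP i).1) (subsp_kerp q) (subsp_kerp r) nqr.
  have c0 : comb (wg^~ x) w L = 0.
    by rewrite /comb big1// => i _; rewrite wgx// scale0r.
  have := MP L (leq_maxl _ _) x; have := MP' L (leq_maxr _ _) x.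
  rewrite c0 !subr0 => Pr Pq.
  exists (x - P x); split.
  - exact: (subspB (subsp_kerp q)).
  - by rewrite (linB Pc.1) (PV0 (P x) (PV x)) subrr.
  - move=> /eqP; rewrite subr_eq0 => /eqP xP; apply: xr.
    by rewrite /kerp /= xP.
pose V := sumset V0 (cspan h).
have sV : subsp V by apply: subsp_sumset => //; exact: subsp_cspan.
have V0V : V0 `<=` V by apply: sumsetl; exact: subsp_cspan.
(* [id - P] kills the closure of [Z] and fixes every [h k], so finite codimension would put all of
   them in one finite span; that span meets some [ker p_k] only in 0, while [h k] is a nonzero
   element of this kernel. *)
have key Z : Z `<=` V0 -> ~ fdq V (clo p Z).
  move=> ZV0 [L _ Lgen].
  have Qc : clin p (fun x => x - P x) by apply: (clinB pC (clin_id p)).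
  have [k kP] := lspan_kerp_trivial pC (map (fun x => x - P x) L).
  have [hk Ph h0] := hP k; apply: h0; apply: kP => //.
  have [|y Ly hy] := Lgen (h k).
    by apply: sumsetr => //; exact: mem_cspan.
  have := lin_lspan Qc.1 Ly.
  suff -> : y - P y = h k by [].
  have := PV0 _ (clo_sub ZV0 hy); rewrite (linB Pc.1) Ph sub0r => /eqP.
  by rewrite eqr_oppLR opprB => /eqP ->; rewrite subKr.
apply: (common_host_isomorphic pC (V := V) (n := n)) => //.
  move=> k; apply: fdq_sumset => //; first exact: subsp_cspan.
  apply: (@fdq_cspan_tail _ _ k) => // j kj.
  by apply: (kerp_le pC kj); case: (hP j).
move=> Z [|] ->; split => //.
- exact: subset_trans ZeV0 V0V.
- exact: key.
- exact: subset_trans ZfV0 V0V.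
- exact: key.
Qed.

End Frechet.
End Classes.

(** * Uncountably many classes *)

Section Widths.
Context (K : numFieldType) (R : realType) (S : scalars K R).
Local Notation nrm := (nrm S).
Local Notation emb := (emb S).
Context (X : lmodType K) (p : nat -> X -> R) (pC : calibrated S p).
Implicit Types (E F U V W Z : set X) (x y : X) (s t v e f : nat -> X)
  (A B P Q : X -> X) (d : nat -> R).
Let pS n : rseminorm S (p n) := calibrated_seminorm pC n.
Hint Resolve pS : core.
Let p_ge0 n x : 0 <= p n x := calibrated_ge0 pC n x.
Hint Resolve p_ge0 : core.
Let subsp_kerp n : subsp (kerp p n) := subsp_kerp pC n.
Hint Resolve subsp_kerp : core.

Definition scalar_on E (f : X -> K) :=
  forall a x y, E x -> E y -> f (a *: x + y) = a * f x + f y.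

(* The Gelfand widths of p_k relative to p_m on E `&` ker p_n are O(1 / d). *)
Definition narrow d E := exists n, forall k, exists m (C : R), forall i,
  exists2 f : nat -> X -> K, (forall a, scalar_on E (f a)) &
    forall z, (E `&` kerp p n) z -> (forall a, (a < i)%N -> f a z = 0) ->
      d i * p k z <= C * p m z.

(** Functionals are pulled back along [g], and the constants from the continuity of [f] and [g] do
    not depend on [i]. *)
Lemma narrow_invariant d E F : (forall i, 0 <= d i) -> subsp E ->
  isomorphic_sets p E F -> narrow d E -> narrow d F.
Proof.
move=> d0 sE [f [g [fl fP gP fb gb]]] [n nE].
have gl := lin_on_inverse sE fl fP gP.
have [n' [C0 [_ C00 gn]]] := bounded_onP pC gb n.
exists n' => k; have [k' [C1 [_ C10 fk]]] := bounded_onP pC fb k.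
have [m [C2 mP]] := nE k'; have [m' [C3 [_ C30 gm]]] := bounded_onP pC gb m.
exists m', (C1 * (`|C2| * C3)) => i; have [h hl hP] := mP i.
exists (fun a y => h a (g y)).
  by move=> a c x y Fx Fy; rewrite gl// hl//; [case: (gP _ Fx)|case: (gP _ Fy)].
move=> y [Fy yn'] hy; have [Ey fy] := gP _ Fy.
have gyn : p n (g y) = 0.
  by apply/eqP; rewrite eq_le p_ge0 andbT (le_trans (gn _ Fy))// yn' mulr0.
have H := hP (g y) (conj Ey gyn) hy.
have := fk _ Ey; rewrite fy => H1.
rewrite (le_trans (ler_wpM2l (d0 i) H1))// mulrCA -!mulrA ler_pM2l//.
rewrite (le_trans H)// (le_trans (y := `|C2| * p m (g y)))//.
  by rewrite ler_wpM2r// ler_norm.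
by rewrite ler_wpM2l// gm.
Qed.

(** Equivalence of norms in finite dimension, by induction on [N]: separation makes the last
    coordinate a functional bounded by [p k], and removing its contribution leaves a shorter
    combination. *)
Lemma indep_bound k N v : indep (kerp p k) N v -> forall m, exists2 C : R, 0 < C &
  forall c, p m (comb c v N) <= C * p k (comb c v N).
Proof.
elim: N => [|N IH] iv m.
  by exists 1 => // c; rewrite /comb big_ord0 !(sn0 (pS _)) mulr0.
have [C C0 CP] := IH (indep_le (leqnSn N) iv) m.
have [|f [fl /(boundedP (pS k))[D D0 DP] fL fv]] :=
    @separation _ _ S _ _ (pS k) (mkseq v N) (v N).
  move=> y /lspan_comb[c ->]; apply/eqP => cv.
  have := iv (fun i => if i == N then -1 else c i); rewrite combS eqxx.
  have -> : comb (fun i => if i == N then -1 else c i) v N = comb c v N.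
    by apply: eq_comb => // i /ltn_eqF ->.
  rewrite scaleN1r -opprB => /(_ (subspN (subsp_kerp k) cv) N (ltnSn N)).
  by rewrite eqxx => /eqP; rewrite oppr_eq0 oner_eq0.
exists (C * (1 + D * p k (v N)) + D * p m (v N)).
  by rewrite ltr_pwDl ?mulr_ge0// ?mulr_gt0// ?ltr_pwDl// ?mulr_ge0// ltW.
move=> c; set z := comb c v N.+1.
have fc : f z = c N.
  rewrite /z combS (scalD fl) (scalZ fl) fv mulr1 (scal_ker_lspan fl fL) ?add0r//.
  by apply/lspan_comb; exists c.
have cz : nrm (c N) <= D * p k z by rewrite -fc.
have zE : comb c v N = z - c N *: v N by rewrite /z combS addrK.
have h1 : p k (comb c v N) <= (1 + D * p k (v N)) * p k z.
  rewrite zE (le_trans (snB (pS k) _ _))// mulrDl mul1r lerD2l (snZ (pS k)).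
  by rewrite mulrAC ler_wpM2r.
have -> : z = comb c v N + c N *: v N by rewrite zE subrK.
rewrite (le_trans (snD (pS m) _ _))// zE subrK mulrDl lerD//.
  by rewrite -zE (le_trans (CP c))// -mulrA ler_pM2l.
by rewrite (snZ (pS m)) mulrAC ler_wpM2r.
Qed.

(** Finite dimensional spans bound the widths from below. Type 3 supplies spans of every dimension
    in each trace on which the fixed seminorm [p (kk n)] is a norm, and so dominates [p i] up to a
    constant. *)
Lemma not_narrow_exists E : subsp E -> type3 p E -> exists2 d : nat -> R,
  (forall i, 0 < d i) &
  forall d', (exists i0, forall i, (i0 <= i)%N -> d i <= d' i) -> ~ narrow d' E.
Proof.
move=> sE /choice[kk kkP].
have /choice[D DP] : forall u : nat * nat, exists D : R, 0 < D /\ exists v,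
    [/\ forall j, (j < u.2.+1)%N -> (E `&` kerp p u.1) (v j),
        indep (kerp p (kk u.1)) u.2.+1 v &
        forall c, p u.2 (comb c v u.2.+1) <= D * p (kk u.1) (comb c v u.2.+1)].
  move=> [n i] /=; have [v vE iv] := not_fdq (subsp_kerp _) (kkP n) i.+1.
  by have [D D0 DP] := indep_bound iv i; exists D; split => //; exists v.
have D0 u : 0 < D u by case: (DP u).
have i1_gt0 i : 0 < i.+1%:R :> R by rewrite ltr0n.
(* d i beats the constants D (n, i) for all n <= i: every codimension i subspace
   of E `&` ker p_n meets the (i + 1)-dimensional span of the v j. *)
exists (fun i => \sum_(n < i.+1) i.+1%:R * D (n : nat, i)).
  move=> i; rewrite big_ord_recr /= ltr_wpDl ?mulr_gt0// sumr_ge0// => j _.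
  by rewrite mulr_ge0 ?ltW.
move=> d' [i0 d'P] [n /(_ (kk n))[m [C CP]]].
(* With [b] past [i0], [n] and [m], the constant [D (n, b)] occurs in [d b] and [p m <= p b]; its
   factor [b + 1 > |C|] then contradicts the width estimate. *)
have [b lb Cb] : exists2 b, (maxn i0 (maxn n m) <= b)%N & `|C| < b.+1%:R.
  have [|b lb] := inv_small (maxn i0 (maxn n m)) (e := (`|C| + 1)^-1).
    by rewrite invr_gt0 ltr_wpDl.
  rewrite ltf_pV2 ?posrE// ?ltr_wpDl// => Cb; exists b => //.
  by rewrite (lt_trans _ Cb)// ltrDl.
have [i0b nb mb] : [/\ i0 <= b, n <= b & m <= b]%N by split; lia.
have [_ [v [/= vE iv vb]]] := DP (n, b); have [f fl fP] := CP b.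
have [r r0 rA] := @row_dependence _ _ _ (\matrix_(i < b.+1, a < b) f a (v i)) (ltnSn b).
pose c i := if insub i is Some j then r 0 (j : 'I_b.+1) else 0.
have cE (j : 'I_b.+1) : c j = r 0 j by rewrite /c valK.
set z := comb c v b.+1 in vb.
have combE N' c' : (N' <= b.+1)%N -> E (comb c' v N').
  move=> le; apply: (subsp_sum sE) => i _; apply: (subspZ sE).
  by case: (vE i (leq_trans (ltn_ord i) le)).
have Ez : (E `&` kerp p n) z.
  split; first exact: combE.
  apply: (subsp_sum (subsp_kerp n)) => i _; apply: (subspZ (subsp_kerp n)).
  by case: (vE i (ltn_ord i)).
have fcomb a N' : (N' <= b.+1)%N -> f a (comb c v N') = \sum_(i < N') c i * f a (v i).
  elim: N' => [|N' IH] le.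
    rewrite /comb !big_ord0; have := fl a 0 0 0 (subsp0 sE) (subsp0 sE).
    by rewrite scaler0 addr0 mul0r add0r => ->; have := fl a (-1) 0 0 (subsp0 sE) (subsp0 sE);
      rewrite scaler0 addr0 mulN1r addNr.
  rewrite combS big_ord_recr /= [comb c v N' + _]addrC fl.
  - by rewrite IH 1?addrC//; exact: ltnW.
  - by case: (vE N' le).
  - by apply: combE; exact: ltnW.
have fz a : (a < b)%N -> f a z = 0.
  move=> ab; rewrite fcomb//.
  have := congr1 (fun M : 'rV_ _ => M 0 (Ordinal ab)) rA; rewrite !mxE => E0.
  by rewrite -[RHS]E0; apply: eq_bigr => i _; rewrite cE mxE.
have zk : 0 < p (kk n) z.
  rewrite lt_neqAle p_ge0 andbT eq_sym; apply: contraNN r0 => /eqP zk.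
  by apply/eqP/rowP => j; rewrite mxE -cE; apply: iv zk j (ltn_ord j).
have h1 := fP z Ez fz.
have h2 : C * p m z <= `|C| * D (n, b) * p (kk n) z.
  rewrite (le_trans (y := `|C| * p b z))//; last by rewrite -mulrA ler_wpM2l// vb.
  rewrite (le_trans (y := `|C| * p m z))//; first by rewrite ler_wpM2r// ler_norm.
  by rewrite ler_wpM2l// (calibrated_le pC).
have h3 : d' b <= `|C| * D (n, b) by rewrite -(ler_pM2r zk) (le_trans h1).
have := le_trans (d'P b i0b) h3.
rewrite (bigD1 (Ordinal (nb : (n < b.+1)%N)))//= => h4.
have : b.+1%:R * D (n, b) <= `|C| * D (n, b).
  apply: le_trans h4; rewrite lerDl sumr_ge0// => j _.
  by rewrite mulr_ge0 ?ltW.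
by rewrite ler_pM2r// leNgt Cb.
Qed.

End Widths.

(** * Dense subspaces with prescribed decay of widths *)

Section NarrowSubspaces.
Context (K : numFieldType) (R : realType) (S : scalars K R).
Local Notation nrm := (nrm S).
Local Notation emb := (emb S).
Context (X : lmodType K) (p : nat -> X -> R) (pC : calibrated S p).
Implicit Types (E F U V W Z : set X) (x y : X) (s t v e f : nat -> X).
Let pS n : rseminorm S (p n) := calibrated_seminorm pC n.
Hint Resolve pS : core.
Let p_ge0 n x : 0 <= p n x := calibrated_ge0 pC n x.
Hint Resolve p_ge0 : core.
Let subsp_kerp n : subsp (kerp p n) := subsp_kerp pC n.
Hint Resolve subsp_kerp : core.

(** The chain starts at [m 0], not at 0, so that already [ker p_(kap 0)] has infinite
    codimension. *)
Lemma steep_chain : type3 p setT -> exists kap : nat -> nat,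
  [/\ forall l, (kap l < kap l.+1)%N, ~ fdq setT (kerp p (kap 0%N)) &
      forall l, ~ fdq (kerp p (kap l)) (kerp p (kap l.+1))].
Proof.
move=> /choice[m mP].
have {}mP n : ~ fdq (kerp p n) (kerp p (m n)) by have := mP n; rewrite setTI.
exists (fun l => iter l m (m 0%N)); split => [l||l] /=; last exact: mP.
  rewrite ltnNge; apply/negP => le; apply: (mP (iter l m (m 0%N))).
  exists [::] => // x xn; exists 0 => //; rewrite subr0.
  exact: (kerp_le pC le).
by apply: contra_not (mP 0%N); exact: fdq_subl.
Qed.

(** Finitely many vectors and functionals do not exhaust the infinite dimensional quotient of
    consecutive kernels: some [y] in the larger kernel is killed by the earlier functionals and lies
    outside the smaller kernel plus the span of the earlier vectors. Separation gives its
    functional. *)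
Lemma biorthogonal_layers (kap : nat -> nat) :
  (forall l, ~ fdq (kerp p (kap l)) (kerp p (kap l.+1))) ->
  exists (y : nat -> nat -> X) (phi : nat -> nat -> X -> K),
    [/\ forall l j, kerp p (kap l) (y l j), forall l j, scalar (phi l j),
        forall l j, bounded S (p (kap l.+1)) (phi l j) &
        forall l j l' j', phi l j (y l' j') = ((l == l') && (j == j'))%:R].
Proof.
move=> kapP; pose T := (X * (X -> K))%type.
pose dflt : T := (0, fun=> 0).
pose P (h : seq T) (u : T) := let w := nth dflt h in let n := size h in
  let l := (decode n).1 in
  [/\ kerp p (kap l) u.1 /\ u.2 u.1 = 1, scalar u.2, bounded S (p (kap l.+1)) u.2,
      forall i, (i < n)%N -> (w i).2 u.1 = 0 &
      forall i, (i < n)%N -> u.2 (w i).1 = 0].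
have step (b : nat -> T) n : (forall m, (m < n)%N -> P (mkseq b m) (b m)) ->
    exists u, P (mkseq b n) u.
  move=> bP; rewrite /P size_mkseq; set l := (decode n).1.
  have gl i : scalar (nth dflt (mkseq b n) i).2.
    have [i_n|ni] := ltnP i n; first by rewrite nth_mkseq//; case: (bP i i_n).
    by rewrite nth_default ?size_mkseq// => a x y /=; rewrite mulr0 addr0.
  pose L := mkseq (fun i => (b i).1) n.
  pose V := sumset (lspan L) (kerp p (kap l.+1)).
  have sV : subsp V by exact: (subsp_sumset (subsp_lspan L) (subsp_kerp _)).
  have VL : fdq V (kerp p (kap l.+1)).
    exists L; last by [].
    by move=> x xL; apply: sumsetl => //; exact: mem_lspan.
  have nf : ~ fdq (kerp p (kap l)) V.
    apply: contra_not (@kapP l) => UV; apply: (fdq_trans (subsp_kerp _) UV).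
    by apply: fdq_subl VL => // x [].
  have [y [yk gy yV]] := vanishing_vector n gl (subsp_kerp _) sV nf.
  have [|f [fl fb fL fy]] := @separation _ _ S _ _ (pS (kap l.+1)) L y.
    by move=> z Lz; apply/eqP => yz; apply: yV; exists z.
  exists (y, f); split => //= i i_n.
  by rewrite nth_mkseq//; apply: fL; apply/mapP; exists i; rewrite // mem_iota.
have [|b bP] := history_choice_cond step; first exact: (step (fun=> dflt) 0%N).
exists (fun l j => (b (encode (l, j))).1), (fun l j => (b (encode (l, j))).2).
have lev l j : (decode (size (mkseq b (encode (l, j))))).1 = l.
  by rewrite size_mkseq encodeK.
split.
- by move=> l j; have := bP (encode (l, j)); rewrite /P lev => -[[]].
- by move=> l j; have := bP (encode (l, j)); rewrite /P lev => -[].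
- by move=> l j; have := bP (encode (l, j)); rewrite /P lev => -[].
move=> l j l' j'.
have -> : (l == l') && (j == j') = (encode (l, j) == encode (l', j')).
  by rewrite (can_eq encodeK) xpair_eqE.
have [ij|ij|->] := ltngtP (encode (l, j)) (encode (l', j')).
- have [_ _ _ + _] := bP (encode (l', j')); rewrite size_mkseq => /(_ _ ij).
  by rewrite nth_mkseq.
- have [_ _ _ _] := bP (encode (l, j)); rewrite size_mkseq => /(_ _ ij).
  by rewrite nth_mkseq.
- by have [[_ ->]] := bP (encode (l', j')).
Qed.

Lemma half_sum_le N : \sum_(j < N) (2^-1 : R) ^+ j <= 2.
Proof.
suff : \sum_(j < N) (2^-1 : R) ^+ j = 2 - 2 * 2^-1 ^+ N.
  by move=> ->; rewrite gerBl mulr_ge0// exprn_ge0// invr_ge0.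
elim: N => [|N IH]; first by rewrite big_ord0 expr0; lra.
by rewrite big_ord_recr /= IH exprS; set h := _ ^+ N; lra.
Qed.

(** Each weight only has to dominate a quantity built from the earlier ones, so they can be chosen
    in order. *)
Lemma growing_weights (d A : nat -> R) (w : R) (r : nat -> nat -> R) : 0 < w ->
  exists t : nat -> R, forall a, 0 < t a /\
    d a * A a * (\sum_(b < a) t b * r a b) <= t a * w.
Proof.
move=> w0.
have [h|t tP] := @history_choice R (fun h u => 0 < u /\
    d (size h) * A (size h) * (\sum_(b < size h) nth 0 h b * r (size h) b) <= u * w).
  set q := d _ * _ * _; exists (`|q| / w + 1); split.
    by rewrite ltr_wpDl// divr_ge0// ltW.
  rewrite mulrDl divfK ?gt_eqF// mul1r (le_trans (ler_norm q))//.
  by rewrite lerDl ltW.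
exists t => a; have [t0] := tP a; rewrite size_mkseq => ta; split => //.
apply: le_trans ta; rewrite le_eqVlt; apply/orP; left; apply/eqP.
by congr (_ * _); apply: eq_bigr => b _; rewrite nth_mkseq.
Qed.

(** Narrowness comes from comparing [p (kap k)] with [p (kap k.+1)], which detects one more layer;
    type 3 comes from making every layer the lowest one of infinitely many [x j]. *)
Lemma narrow_dense_exists (d : nat -> R) : type3 p setT -> pseparable p ->
  (forall i, 0 < d i) -> (forall i j, (i <= j)%N -> d i <= d j) ->
  exists v, [/\ pdense p (cspan v), type3 p (cspan v) & narrow p d (cspan v)].
Proof.
move=> X3 sepX d0 dle.
have [kap [kapS kap0 kapP]] := steep_chain X3.
have [y [phi [yk phil phib phiy]]] := biorthogonal_layers kapP.
have kap_le i j : (i <= j)%N -> (kap i <= kap j)%N.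
  by move=> /subnK <-; elim: (j - i)%N => // n IH; rewrite (leq_trans IH)// ltnW.
have kap_ge i : (i <= kap i)%N.
  by elim: i => // i IH; rewrite (leq_ltn_trans IH).
have /choice[A AP] : forall u : nat * nat, exists A : R, 0 < A /\
    forall x, nrm (phi u.1 u.2 x) <= A * p (kap u.1.+1) x.
  by move=> u; have [A A0 AP] := boundedP (pS _) (phib u.1 u.2); exists A.
(* The index of the lowest layer of [x j]. *)
pose n j := (decode j).1.
(* The [w j] sum to at most 2, so the dominating seminorm can be shared out among the terms of a
   combination. *)
pose w j : R := 2^-1 ^+ j.
have w0 j : 0 < w j by rewrite exprn_gt0// invr_gt0.
have /choice[t tP] : forall j, exists t : nat -> R, forall a, 0 < t a /\
    d j * A (n j + a, j)%N * (\sum_(b < a) t b * p (kap (n j + a)%N) (y (n j + b)%N j)) <= t a * w j.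
  by move=> j; exact: (growing_weights (fun=> d j) (fun a => A (n j + a, j)%N)
    (fun a b => p (kap (n j + a)%N) (y (n j + b)%N j)) (w0 j)).
(* The component of x j in layer n j + b outweighs the lower ones by a factor
   d j, so p (kap k) is tiny on span (x j, j >= i) compared with
   p (kap k.+1). *)
pose x j := \sum_(b < j.+1) emb (t j b) *: y (n j + b)%N j.
have phix l j i : i != j -> phi l j (x i) = 0.
  move=> ij; rewrite (scal_sum (phil l j)) big1// => b _.
  by rewrite (scalZ (phil l j)) phiy [j == i]eq_sym (negbTE ij) andbF mulr0.
have phixx j a : (a <= j)%N -> phi (n j + a)%N j (x j) = emb (t j a).
  move=> aj; rewrite (scal_sum (phil _ j)) (bigD1 (Ordinal (aj : (a < j.+1)%N)))//=.
  rewrite (scalZ (phil _ j)) phiy !eqxx mulr1 big1 ?addr0// => b ba.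
  rewrite (scalZ (phil _ j)) phiy eqn_add2l (_ : (a == b) = false) ?mulr0//.
  by apply: contraNF ba => /eqP ab; apply/eqP/val_inj.
have phicomb c N j a : (j < N)%N -> (a <= j)%N ->
    phi (n j + a)%N j (comb c x N) = c j * emb (t j a).
  move=> jN aj; rewrite (scal_sum (phil _ j)) (bigD1 (Ordinal jN))//=.
  rewrite (scalZ (phil _ j)) phixx// big1 ?addr0// => i ij.
  rewrite (scalZ (phil _ j)) phix ?mulr0//.
have xk k j : (k <= n j)%N -> p (kap k) (x j) = 0.
  move=> kn; apply: (sn_ker_sum (pS _)) => b _; apply: (sn_kerZ (pS _)).
  apply: (kerp_le pC _ (yk (n j + b)%N j)); apply: kap_le.
  by rewrite (leq_trans kn)// leq_addr.
(* Term [j] is bounded by its share [w j]: it vanishes for [j < i], lies in the kernel when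
   [k <= n j], and otherwise [k] is a layer of [x j], since [k <= i <= j], whose functional reads
   [c j] off [z]. *)
have main c N i k : (forall j, (j < i)%N -> (j < N)%N -> c j = 0) -> (k <= i)%N ->
    d i * p (kap k) (comb c x N) <= 2 * p (kap k.+1) (comb c x N).
  move=> c0 ki; set z := comb c x N.
  rewrite (le_trans (y := \sum_(j < N) w j * p (kap k.+1) z))//; last first.
    by rewrite -mulr_suml ler_wpM2r// half_sum_le.
  rewrite (le_trans (y := \sum_(j < N) d i * (nrm (c j) * p (kap k) (x j))))//.
    rewrite -mulr_sumr ler_wpM2l ?(ltW (d0 i))// /z /comb (le_trans (sn_sum (pS _) _ _ _))//.
    by apply: ler_sum => j _; rewrite (snZ (pS _)).
  apply: ler_sum => j _; have [ji|ij] := ltnP j i.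
    by rewrite (c0 j ji (ltn_ord j)) nrm0 mul0r mulr0 mulr_ge0// ltW.
  have [kn|nk] := leqP k (n j).
    by rewrite xk// !mulr0 mulr_ge0// ltW.
  pose a := (k - n j)%N.
  have ak : (n j + a)%N = k by rewrite subnKC// ltnW.
  have aj : (a <= j)%N by rewrite /a; lia.
  have [ta0] := tP j a; rewrite ak; set s := \sum_(b < a) _ => ta.
  have [A0 Aphi] := AP (k, (j : nat)).
  (* Layers from [k] on lie in [ker p_(kap k)], so only those with [b < a] count. *)
  have xs : p (kap k) (x j) <= s.
    rewrite /x (le_trans (sn_sum (pS _) _ _ _))// /s.
    rewrite -(subnKC (leqW aj)) big_split_ord /= [X in _ + X]big1 ?addr0.
      apply: ler_sum => b _; rewrite (snZ (pS _)) nrm_emb_ge0//.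
      by case: (tP j b) => /ltW.
    move=> b _; apply: (sn_kerZ (pS _)).
    apply: (kerp_le pC _ (yk _ _)); apply: kap_le.
    by rewrite addnA ak leq_addr.
  have cj : nrm (c j) * t j a <= A (k, (j : nat)) * p (kap k.+1) z.
    have := Aphi z; rewrite /= -ak phicomb// nrmM nrm_emb_ge0//.
    exact: ltW.
  have s0 : 0 <= s by rewrite (le_trans _ xs).
  have h1 : d i * s * A (k, (j : nat)) <= t j a * w j.
    apply: le_trans ta; rewrite mulrAC ler_wpM2r// ler_wpM2r ?(ltW A0)//.
    exact: dle.
  have h2 : d i * (nrm (c j) * p (kap k) (x j)) <= nrm (c j) * (d i * s).
    by rewrite mulrCA ler_wpM2l ?nrm_ge0// ler_wpM2l// ltW.
  rewrite (le_trans h2)// -(ler_pM2r A0) -mulrA.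
  rewrite (le_trans (ler_wpM2l (nrm_ge0 S _) h1))// mulrA.
  have -> : w j * p (kap k.+1) z * A (k, (j : nat)) = A (k, (j : nat)) * p (kap k.+1) z * w j.
    by ring.
  by rewrite ler_wpM2r// ltW.
have [|v dv vx] := @dense_with_kernel _ _ _ _ _ pC (kap 0%N) x sepX kap0.
  by move=> j; exact: xk.
exists v; split => //.
(* The [x j] with lowest layer [m] are independent modulo this kernel: the functional [phi m j]
   detects the coefficient of [x j]. *)
- move=> m; exists (kap m.+1) => /fdq_indep -/(_ (subsp_kerp _))[N NP].
  pose ix i := encode (m, i).
  have nix i : n (ix i) = m by rewrite /n encodeK.
  apply: (NP (x \o ix)).
    move=> i _ /=; split.
      have : (cspan v `&` kerp p (kap 0%N)) (x (ix i)) by rewrite vx; exact: mem_cspan.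
      by case.
    by apply: (kerp_le pC (kap_ge m)); apply: xk; rewrite nix.
  move=> c ck i iN.
  have := bounded_ker (phib m (ix i)) ck.
  rewrite (scal_sum (phil _ _)) (bigD1 (Ordinal iN))//= (scalZ (phil _ _)).
  rewrite -{1}(nix i) -{1}(addn0 (n _)) phixx// big1.
    rewrite addr0 => /eqP; rewrite mulf_eq0 => /orP[/eqP//|].
    by rewrite fmorph_eq0 gt_eqF//; case: (tP (ix i) 0%N).
  move=> j ji; rewrite (scalZ (phil _ _)) phix ?mulr0//.
  apply: contraNN ji => /eqP/(can_inj encodeK)[ji]; exact/eqP/val_inj.
(* The estimate [main] covers [k <= i] with constant 2. For the finitely many smaller [i] the
   summand [d k] suffices, as [d] is nondecreasing. *)
- exists (kap 0%N) => k; exists (kap k.+1), (2 + d k) => i.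
  exists (fun a => phi (n a) a); first by move=> a b z z' _ _; exact: phil.
  rewrite vx => z [N /lspan_comb[c ->]] fz.
  have c0 j : (j < i)%N -> (j < N)%N -> c j = 0.
    move=> ji jN; have := fz j ji; rewrite -{1}(addn0 (n j)) phicomb// => /eqP.
    rewrite mulf_eq0 => /orP[/eqP//|].
    by rewrite fmorph_eq0 gt_eqF//; case: (tP j 0%N).
  have kk : p k (comb c x N) <= p (kap k) (comb c x N) := calibrated_le pC _ (kap_ge k).
  have kk1 : p (kap k) (comb c x N) <= p (kap k.+1) (comb c x N).
    by apply: (calibrated_le pC); apply: kap_le.
  rewrite mulrDl; have [ki|ik] := leqP k i.
    rewrite (le_trans (ler_wpM2l (ltW (d0 i)) kk))//.
    by rewrite (le_trans (main _ _ _ _ c0 ki))// lerDl mulr_ge0// ltW.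
  rewrite ler_wpDl ?mulr_ge0// ler_pM ?(ltW (d0 i))//; last exact: le_trans kk kk1.
  by apply: dle; exact: ltnW.
Qed.

(** [D] eventually dominates each [d i], so no [cspan (e i)] is narrow for [D], while the new
    subspace is; narrowness is invariant under isomorphism. *)
Lemma type3_new_class (e : nat -> nat -> X) : type3 p setT -> pseparable p ->
  (forall i, type3 p (cspan (e i))) ->
  exists v, [/\ pdense p (cspan v), type3 p (cspan v) &
    forall i, ~ isomorphic_sets p (cspan v) (cspan (e i))].
Proof.
move=> X3 sepX e3.
have /choice[d dP] : forall i, exists d : nat -> R, (forall j, 0 < d j) /\
    forall d', (exists i0, forall j, (i0 <= j)%N -> d j <= d' j) ->
    ~ narrow p d' (cspan (e i)).
  move=> i; have [d d0 dP] := not_narrow_exists pC (subsp_cspan _) (e3 i).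
  by exists d.
pose D j : R := \sum_(i < j.+1) \sum_(l < j.+1) d i l.
have d_ge0 i j : 0 <= d i j by rewrite ltW//; case: (dP i).
have D_le i j : (i <= j)%N -> D i <= D j.
  move=> ij; rewrite /D -[in leRHS](subnKC (ij : (i.+1 <= j.+1)%N)).
  rewrite big_split_ord /= ler_wpDr//.
    by apply: sumr_ge0 => k _; apply: sumr_ge0 => l _.
  apply: ler_sum => k _; rewrite big_split_ord /= ler_wpDr//.
  by apply: sumr_ge0 => l _.
have dD i j : (i <= j)%N -> d i j <= D j.
  move=> ij; rewrite /D (bigD1 (Ordinal (ij : (i < j.+1)%N)))//= big_ord_recr /=.
  rewrite ler_wpDr//; first by apply: sumr_ge0 => k _; apply: sumr_ge0.
  by rewrite ler_wpDl// sumr_ge0.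
have D0 i : 0 < D i.
  apply: lt_le_trans (D_le 0%N i _) => //; rewrite (lt_le_trans _ (dD 0%N 0%N _))//.
  by case: (dP 0%N).
have [v [dv v3 vD]] := narrow_dense_exists X3 sepX D0 D_le.
exists v; split => // i iso; have [_ /(_ D)] := dP i; apply.
  by exists i => j; exact: dD.
apply: (narrow_invariant pC _ (subsp_cspan v) iso) => // j; exact: ltW.
Qed.

End NarrowSubspaces.

(** * Seminorms of a metrizable locally convex space *)

Section MetrizableSeminorms.
Context (K : numFieldType) (R : realType) (S : scalars K R).
Local Notation nrm := (nrm S).
Local Notation emb := (emb S).
Implicit Types (X E F : tvsType K).

Lemma emb_gt0P (a : K) : 0 < a -> exists2 s : R, 0 < s & a = emb s.
Proof.
move=> a0; have [s s0 aE] := emb_ge0P S (ltW a0); exists s => //.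
by rewrite -(emb_lt S) rmorph0 -aE.
Qed.

Lemma emb_gt0 (s : R) : (0 < emb s) = (0 < s).
Proof. by rewrite -(rmorph0 emb) emb_lt. Qed.

Lemma nrm_lt (a : K) s : (`|a| < emb s) = (nrm a < s).
Proof. by rewrite -(embK S) emb_lt. Qed.

Lemma nbhs_scalar0 (A : set K) : nbhs (0 : K^o) A ->
  exists2 s : R, 0 < s & forall a, nrm a < s -> A a.
Proof.
move=> /nbhs_normP[e /= /emb_gt0P[s s0 ->] sA]; exists s => // a as_.
by apply: sA; rewrite /= sub0r normrN nrm_lt.
Qed.

Section Gauge.
Variable X : tvsType K.

Lemma scale_near0 (U : set X) : nbhs 0 U ->
  exists2 s : R, 0 < s & exists2 V, nbhs 0 V & forall a x, nrm a < s -> V x -> U (a *: x).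
Proof.
move=> U0; have /= := @scale_continuous _ X (0, 0) U.
rewrite scale0r => /(_ U0)[[A1 A2] /= [A10 A20] AU].
have [s s0 sA] := nbhs_scalar0 A10; exists s => //; exists A2 => // a x /sA Aa A2x.
exact: (AU (a, x)).
Qed.

Lemma absorbing (U : set X) x : nbhs 0 U ->
  exists2 s : R, 0 < s & forall a, nrm a < s -> U (a *: x).
Proof.
move=> U0; have /= := @scale_continuous _ X (0, x) U.
rewrite scale0r => /(_ U0)[[A1 A2] /= [A10 A2x] AU].
have [s s0 sA] := nbhs_scalar0 A10; exists s => // a /sA Aa.
by apply: (AU (a, x)); split => //=; exact: nbhs_singleton.
Qed.

(** [D] is the balanced core of a convex neighbourhood [C]. Scaling preserves convexity, and joint
    continuity of the scalar product at 0 puts a multiple of a neighbourhood into the core. *)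
Lemma absolutely_convex_nbhs (U : set X) : nbhs 0 U -> exists D : set X,
  [/\ nbhs 0 D, D `<=` U, forall a x, nrm a <= 1 -> D x -> D (a *: x) &
    forall (s t : R) x y, 0 <= s -> 0 <= t -> s + t = 1 -> D x -> D y ->
      D (emb s *: x + emb t *: y)].
Proof.
move=> U0; have [B Bconvex [Bopen Bnbhs]] := @locally_convex K X.
have [C [BC C0] CU] := Bnbhs 0 U U0.
have nC : nbhs 0 C by apply: open_nbhs_nbhs; split => //; exact: Bopen.
have [s s0 [V V0 VC]] := scale_near0 nC.
pose D : set X := [set x | forall a, nrm a <= 1 -> C (a *: x)].
exists D; split.
- have s2 : emb (s / 2) != 0 by rewrite fmorph_eq0 gt_eqF// divr_gt0.
  apply: filterS (nbhs0Z s2 V0) => _ [x Vx <-] a a1.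
  rewrite scalerA; apply: VC => //.
  rewrite nrmM nrm_emb_ge0 ?divr_ge0 ?(ltW s0)//.
  by rewrite (le_lt_trans (y := 1 * (s / 2)))// ?ler_wpM2r ?divr_ge0 ?(ltW s0)//; lra.
- by move=> x /(_ 1); rewrite nrm1 scale1r => /(_ (lexx _))/CU.
- move=> a x a1 Dx b b1; rewrite scalerA; apply: Dx.
  by rewrite nrmM mulr_ile1 ?nrm_ge0.
- move=> u t x y u0 t0 ut Dx Dy a a1.
  have l0 : 0 <= emb u by rewrite -(rmorph0 emb) emb_le.
  have l1 : emb u <= 1 by rewrite -(rmorph1 emb) emb_le; lra.
  have := Bconvex C (mem_set BC) (a *: x) (a *: y) (Itv01 l0 l1)
    (mem_set (Dx a a1)) (mem_set (Dy a a1)).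
  move=> /set_mem.
  suff -> : a *: (emb u *: x + emb t *: y) =
    emb u *: (a *: x) + (1 - emb u) *: (a *: y) by [].
  rewrite scalerDr !scalerA ![a * _]mulrC; congr (_ + (_ * _) *: _).
  by rewrite -(rmorph1 emb) -rmorphB; congr (emb _); lra.
Qed.

(** Minkowski functional of an absolutely convex [D] inside [U]: [T x] collects the [t] for which
    [x] is in [t D]. *)
Lemma gauge (U : set X) : nbhs 0 U -> exists q : X -> R,
  [/\ rseminorm S q, nbhs 0 [set x | q x < 1] & [set x | q x < 1] `<=` U].
Proof.
move=> /absolutely_convex_nbhs[D [D0 DU Dbal Dconv]].
pose T x := [set t : R | 0 < t /\ D ((emb t)^-1 *: x)].
have T0 x : T x !=set0.
  have [s s0 sD] := absorbing x D0; exists (2 / s); split; first by rewrite divr_gt0.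
  apply: sD; rewrite nrmV nrm_emb_ge0 ?divr_ge0 ?(ltW s0)//.
  by rewrite invf_div; lra.
have Tlb x : lbound (T x) 0 by move=> t [/ltW].
have Tinf x : has_inf (T x) by split => //; exists 0.
pose q x := inf (T x).
have qle x t : T x t -> q x <= t by move=> Txt; apply: ge_inf => //; exists 0.
have qge x c : (forall t, T x t -> c <= t) -> c <= q x.
  by move=> H; apply: lb_le_inf.
have q0 x : 0 <= q x by apply: qge => t [/ltW].
have qlt x (c : R) : q x < c -> exists2 t, T x t & t < c.
  by move=> /(inf_lt (T0 x))[t Tt tc]; exists t.
have nemb t : 0 < t -> nrm (emb t) = t by move=> /ltW; exact: nrm_emb_ge0.
have eneq0 t : 0 < t -> emb t != 0 by move=> t0; rewrite fmorph_eq0 gt_eqF.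
have TD x t c : T x t -> t <= c -> D ((emb c)^-1 *: x).
  move=> [t0 Dx] tc; have c0 := lt_le_trans t0 tc.
  have -> : (emb c)^-1 *: x = (emb t / emb c) *: ((emb t)^-1 *: x).
    by rewrite scalerA mulrAC divff ?eneq0// mul1r.
  by apply: Dbal => //; rewrite nrmM nrmV !nemb// ler_pdivrMr// mul1r.
have TZ a x t : a != 0 -> T x t -> T (a *: x) (nrm a * t).
  move=> a0 [t0 Dx]; split; first by rewrite mulr_gt0// nrm_gt0.
  have -> : (emb (nrm a * t))^-1 *: (a *: x) = (a / emb (nrm a)) *: ((emb t)^-1 *: x).
    by rewrite !scalerA rmorphM invfM [_ * a]mulrC mulrA.
  apply: Dbal => //; rewrite nrmM nrmV nemb ?nrm_gt0// divff//.
  by rewrite gt_eqF// nrm_gt0.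
have qZ1 a x : a != 0 -> q (a *: x) <= nrm a * q x.
  move=> a0; rewrite -ler_pdivrMl ?nrm_gt0//; apply: qge => t Tt.
  by rewrite ler_pdivrMl ?nrm_gt0//; apply: qle; exact: TZ.
exists q; split.
- split=> [x y|a x].
    apply/ler_addgt0Pl => e e0.
    have e2 : 0 < e / 2 by rewrite divr_gt0.
    have [t Tt te] : exists2 t, T x t & t < q x + e / 2 by apply: qlt; rewrite ltrDl.
    have [u Tu ue] : exists2 t, T y t & t < q y + e / 2 by apply: qlt; rewrite ltrDl.
    have t0 : 0 < t by case: Tt.
    have u0 : 0 < u by case: Tu.
    have tu0 : 0 < t + u by rewrite addr_gt0.
    suff : q (x + y) <= t + u by lra.
    apply: qle; split => //.
    have -> : (emb (t + u))^-1 *: (x + y) =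
      emb (t / (t + u)) *: ((emb t)^-1 *: x) + emb (u / (t + u)) *: ((emb u)^-1 *: y).
      have H v : 0 < v -> emb (v / (t + u)) * (emb v)^-1 = (emb (t + u))^-1.
        by move=> v0; rewrite fmorph_div mulrAC divff ?eneq0// mul1r.
      by rewrite !scalerA (H t)// (H u)// -scalerDr.
    case: Tt => _ Dx; case: Tu => _ Dy; apply: Dconv => //.
    - by rewrite divr_ge0 ?ltW.
    - by rewrite divr_ge0 ?ltW.
    - by rewrite -mulrDl divff ?gt_eqF.
  have [->|a0] := eqVneq a 0.
    rewrite scale0r nrm0 mul0r; apply/eqP; rewrite eq_le q0 andbT.
    apply/ler_addgt0Pl => e e0; rewrite addr0; apply: qle; split => //.
    by rewrite scaler0; exact: nbhs_singleton D0.
  apply/eqP; rewrite eq_le qZ1//=.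
  have := qZ1 a^-1 (a *: x); rewrite invr_eq0 => /(_ a0).
  rewrite scalerA mulVf// scale1r nrmV ler_pdivlMl//.
  exact: nrm_gt0.
- have h2 : emb (2^-1) != 0 by rewrite eneq0// invr_gt0.
  apply: filterS (nbhs0Z h2 D0) => _ [x Dx <-] /=.
  have h0 : 0 < (2^-1 : R) by rewrite invr_gt0.
  apply: (@le_lt_trans _ _ 2^-1); last by rewrite invf_lt1// ltr1n.
  apply: qle; split => //; rewrite scalerA mulVf// scale1r.
  by [].
- move=> x /= /qlt[t Tt t1]; apply: DU; have := TD x t 1 Tt (ltW t1).
  by rewrite rmorph1 invr1 scale1r.
Qed.

(** A single seminorm takes the place of the finitely many in [defines_topology], the sequences in
    question being increasing. *)
Definition seminorms_define (p : nat -> X -> R) := forall x (U : set X),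
  nbhs x U <-> exists n (e : R), 0 < e /\ [set y | p n (y - x) < e] `<=` U.

Lemma seminorm_ball_nbhs (q : X -> R) (e : R) : rseminorm S q ->
  nbhs 0 [set x | q x < 1] -> 0 < e -> nbhs 0 [set x | q x < e].
Proof.
move=> qS q1 e0; have ee : emb e != 0 by rewrite fmorph_eq0 gt_eqF.
apply: filterS (nbhs0Z ee q1) => _ [x /= qx <-].
by rewrite (snZ qS) nrm_emb_ge0 ?ltW// gtr_pMr.
Qed.

(** [p n] sums gauges whose unit balls lie in metric balls around 0. The metric need not be
    translation invariant, so other points are reached by translating neighbourhoods. *)
Lemma metrizable_seminorms : metrizable X -> exists2 p : nat -> X -> R,
  calibrated S p & seminorms_define p.
Proof.
move=> [d [d0 deq0 _ _ dnbhs]].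
pose U n : set X := [set y | d 0 y < emb n.+1%:R^-1].
have U0 n : nbhs 0 (U n).
  by apply/dnbhs; exists (emb n.+1%:R^-1) => //; rewrite emb_gt0 invr_gt0.
have /choice[q qP] : forall n, exists q : X -> R,
    [/\ rseminorm S q, nbhs 0 [set x | q x < 1] & [set x | q x < 1] `<=` U n].
  by move=> n; exact: gauge.
have qS n : rseminorm S (q n) by case: (qP n).
pose p n x := \sum_(i < n.+1) q i x.
have pE n x : p n.+1 x = p n x + q n.+1 x by rewrite /p big_ord_recr.
have qp n x : q n x <= p n x.
  by rewrite /p big_ord_recr /= lerDr sumr_ge0// => i _; exact: (sn_ge0 (qS i)).
have pS n : rseminorm S (p n).
  split=> [x y|a x].
    by rewrite /p -big_split ler_sum// => i _; exact: (snD (qS i)).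
  by rewrite /p mulr_sumr; apply: eq_bigr => i _; rewrite (snZ (qS i)).
have small_d (e : K) : 0 < e -> exists n, [set x | p n x < 1] `<=` [set x | d 0 x < e].
  move=> /emb_gt0P[s s0 ->]; have [n _ ns] := inv_small 0%N s0.
  exists n => x /= px; have [_ _ /(_ x)] := qP n.
  rewrite /U /= (le_lt_trans (qp n x) px) => /(_ isT) /lt_trans; apply.
  by rewrite emb_lt.
have pnbhs n (e : R) : 0 < e -> nbhs 0 [set x | p n x < e].
  elim: n e => [|n IH] e e0.
    rewrite (_ : [set x | _] = [set x | q 0%N x < e]); last first.
      by apply/seteqP; split => x; rewrite /p /= big_ord_recr big_ord0 /= add0r.
    by apply: seminorm_ball_nbhs => //; case: (qP 0%N).
  have e2 : 0 < e / 2 by rewrite divr_gt0.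
  have q2 : nbhs 0 [set x | q n.+1 x < e / 2].
    by apply: seminorm_ball_nbhs => //; case: (qP n.+1).
  apply: filterS (filterI (IH _ e2) q2) => x [/= px qx]; rewrite pE.
  by move: px qx; lra.
exists p.
  split => //.
    by move=> n x; rewrite pE lerDl; exact: (sn_ge0 (qS _)).
  move=> x px; apply/esym/deq0; apply/eqP; rewrite eq_le d0 andbT.
  have [t t0 tE] := emb_ge0P S (d0 0 x).
  rewrite tE -(rmorph0 emb) emb_le leNgt; apply/negP => t1.
  have [|n /(_ x)] := @small_d (emb t); first by rewrite emb_gt0.
  by rewrite /= px ltr01 tE ltxx => /(_ isT).
move=> x V; split => [|[n [e [e0 eV]]]].
  move=> /(nbhsB (- x)); rewrite addNr => /dnbhs[e e0 eV].
  have [n ne] := small_d e e0; exists n, 1; split; first exact: ltr01.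
  move=> y /= /ne /eV[z Vz] /eqP; rewrite addrC subr_eq subrK => /eqP <-.
  by [].
apply: filterS eV _; apply: filterS (nbhsT x (pnbhs n e e0)) => _ [y /= ye <-].
by rewrite addrC addKr.
Qed.

End Gauge.
End MetrizableSeminorms.

(** * The classes in terms of the kernels of one defining sequence *)

Section Translation.
Context (K : numFieldType) (R : realType) (S : scalars K R).
Local Notation nrm := (nrm S).
Local Notation emb := (emb S).

Lemma fin_dim_quotientE (E : tvsType K) (U V : set E) :
  fin_dim_quotient U V <-> fdq U V.
Proof.
split=> [[n [s [sU sg]]]|[L LU Lg]].
  exists [seq s i | i <- enum 'I_n]; first by move=> _ /mapP[i _ ->].
  move=> x /sg[c xc]; exists (\sum_(i < n) c i *: s i) => //.
  apply: (subsp_sum (subsp_lspan _)) => i _; apply: (subspZ (subsp_lspan _)).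
  by apply: mem_lspan; apply: map_f; rewrite mem_enum.
exists (size L), (fun i => L`_i); split; first by move=> i; apply: LU; rewrite mem_nth.
move=> x /Lg[y + xy]; rewrite -{1}(mkseq_nth 0 L) => /lspan_comb[c yc].
by exists (fun i => c i); rewrite -[X in x - X]yc.
Qed.

Lemma seminorm_bound (X : lmodType K) (q r : X -> R) (e : R) :
  rseminorm S q -> rseminorm S r -> 0 < e ->
  (forall x, r x < e -> q x < 1) -> forall x, q x <= 2 / e * r x.
Proof.
move=> qS rS e0 rq x; rewrite leNgt; apply/negP => H.
have r0 := sn_ge0 rS x.
have q0 : 0 < q x by apply: le_lt_trans H; rewrite mulr_ge0// divr_ge0 ?ltW.
have ne : nrm (emb (q x)^-1) = (q x)^-1 by rewrite nrm_emb_ge0// invr_ge0 ltW.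
have := rq (emb (q x)^-1 *: x).
rewrite (snZ qS) (snZ rS) ne mulVf ?gt_eqF// ltxx => H1.
suff : (q x)^-1 * r x < e by move=> /H1.
rewrite mulrC ltr_pdivrMr//.
by move: H; rewrite mulrAC ltr_pdivrMr// [q x * e]mulrC; lra.
Qed.

Section OneSpace.
Variables (E : tvsType K).
Implicit Types (q r : nat -> E -> R).

Lemma seminorms_define_ball q n (e : R) : calibrated S q -> seminorms_define q ->
  0 < e -> nbhs 0 [set x | q n x < e].
Proof.
move=> qC qD e0; apply/qD; exists n, e; split => // x /=.
by rewrite subr0.
Qed.

Lemma seminorms_compare q r n : calibrated S q -> seminorms_define q ->
  calibrated S r -> seminorms_define r ->
  exists m (C : R), forall x, q n x <= C * r m x.
Proof.
move=> qC qD rC rD.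
have /rD[m [e [e0 rq]]] := seminorms_define_ball n qC qD ltr01.
exists m, (2 / e); apply: (seminorm_bound (calibrated_seminorm qC n) (calibrated_seminorm rC m) e0) => x rx.
by apply: rq => /=; rewrite subr0.
Qed.

Lemma seminorms_kernel q r n : calibrated S q -> seminorms_define q ->
  calibrated S r -> seminorms_define r ->
  exists m, kerp r m `<=` kerp q n.
Proof.
move=> qC qD rC rD; have [m [C qr]] := seminorms_compare n qC qD rC rD.
exists m => x xm; apply/eqP; rewrite eq_le (calibrated_ge0 qC) andbT.
by rewrite (le_trans (qr x))// xm mulr0.
Qed.

Lemma calibrated_hausdorff q : calibrated S q -> seminorms_define q ->
  hausdorff_space E.
Proof.
move=> qC qD x y xy; apply/esym/(eq_p0 qC) => k; apply: (p_lt_eq0 qC) => e e0.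
have e2 : 0 < e / 2 by rewrite divr_gt0.
have [||z [/= zx zy]] := xy [set z | q k (z - x) < e / 2] [set z | q k (z - y) < e / 2].
- by apply/qD; exists k, (e / 2); split.
- by apply/qD; exists k, (e / 2); split.
have := sn_tri (calibrated_seminorm qC k) z y x; rewrite (snC (calibrated_seminorm qC k) y z).
by move: zx zy; lra.
Qed.

Lemma real_of_defining P : hausdorff_space E -> defining_seminorms (E := E) P ->
  exists r, [/\ calibrated S r, seminorms_define r & forall n, ker (P n) = kerp r n].
Proof.
move=> hE [Ps Pm Pd]; exists (fun n x => nrm (P n x)).
have P0 n x : 0 <= P n x by case: (Ps n).
have rE n x : emb (nrm (P n x)) = P n x by rewrite embK ger0_norm.
have rS n : rseminorm S (fun x => nrm (P n x)).
  split=> [x y|a x].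
    by rewrite -(emb_le S) rmorphD !rE; case: (Ps n).
  by apply: (@emb_inj _ _ S); rewrite rmorphM !rE embK; case: (Ps n) => _ _ ->.
have rmono n x : nrm (P n x) <= nrm (P n.+1 x).
  by rewrite -(emb_le S) !rE.
have rle i n x : (i <= n)%N -> nrm (P i x) <= nrm (P n x).
  by move=> /subnK <-; elim: (n - i)%N => // j IH; rewrite (le_trans IH).
have rD : seminorms_define (fun n x => nrm (P n x)).
  move=> x U; rewrite Pd; split=> [[n [e [/(emb_gt0P S)[s s0 ->] sU]]]|[n [e [e0 eU]]]].
    exists n, s; split => // y /= ys; apply: sU => i ile.
    by rewrite -rE emb_lt (le_lt_trans (rle _ _ _ ile)).
  exists n, (emb e); split; first by rewrite emb_gt0.
  by move=> y /= /(_ n (leqnn n)); rewrite -rE emb_lt; exact: eU.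
have kE n x : P n x = 0 <-> nrm (P n x) = 0.
  split=> [->|x0]; first exact: nrm0.
  by rewrite -rE x0 rmorph0.
split => //.
  split => // x x0; apply/esym/hE => A B A0 Bx; exists x; split.
    have /rD[n [e [e0]]] := A0; apply => /=.
    by rewrite subr0 x0.
  exact: nbhs_singleton.
by move=> n; apply/seteqP; split => x /=; rewrite /ker /kerp /= kE.
Qed.

Lemma defining_of_real q : calibrated S q -> seminorms_define q ->
  defining_seminorms (fun n x => emb (q n x)).
Proof.
move=> qC qD; split.
- move=> n; split.
  + by move=> x; rewrite -(rmorph0 emb) emb_le (calibrated_ge0 qC).
  + by move=> x y; rewrite -rmorphD emb_le (snD (calibrated_seminorm qC n)).
  + by move=> a x; rewrite (snZ (calibrated_seminorm qC n)) rmorphM embK.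
- by move=> n x; rewrite emb_le; case: qC.
move=> x U; rewrite qD; split=> [[n [e [e0 eU]]]|[n [e [/(emb_gt0P S)[s s0 ->] sU]]]].
  exists n, (emb e); split; first by rewrite emb_gt0.
  by move=> y /= /(_ n (leqnn n)); rewrite emb_lt; exact: eU.
exists n, s; split => // y /= ys; apply: sU => i ile.
by rewrite emb_lt (le_lt_trans (calibrated_le qC _ ile)).
Qed.

Lemma ker_emb q n : ker (fun x => emb (q n x)) = kerp q n.
Proof.
apply/seteqP; split => x; rewrite /ker /kerp /=.
  by rewrite -(rmorph0 emb) => /(@emb_inj _ _ S).
by move=> ->; rewrite rmorph0.
Qed.

Variables (q : nat -> E -> R) (qC : calibrated S q) (qD : seminorms_define q).

Let shift_calibrated n : calibrated S (fun k => q (n + k)%N).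
Proof.
split=> [k|k x|x x0]; first exact: calibrated_seminorm qC _.
  by rewrite addnS; case: qC.
apply: (calibrated_sep qC) => k; apply: (calibrated_ker qC (leq_addl n k)); exact: x0.
Qed.

Let shift_define n : seminorms_define (fun k => q (n + k)%N).
Proof.
move=> x U; rewrite qD; split=> [[k [e [e0 eU]]]|[k [e [e0 eU]]]]; last by exists (n + k)%N, e.
exists k, e; split => // y /= ye; apply: eU => /=.
exact: le_lt_trans (calibrated_le qC _ (leq_addl n k)) ye.
Qed.

Lemma classM0P : classM E -> classM0 E <-> type0 q setT.
Proof.
move=> ME; split=> [[_ [P Pd [P0 PS]]]|q0].
  have [hE _ _] := ME; have [r [rC rD kr]] := real_of_defining hE Pd.
  have r0 : type0 r setT.
    elim=> [|m IH]; first by rewrite -kr; exact/fin_dim_quotientE.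
    apply: fdq_trans IH _ => //; rewrite setTI -!kr.
    exact/fin_dim_quotientE.
  move=> n; have [m rq] := seminorms_kernel n qC qD rC rD.
  exact: fdq_subr rq (r0 m).
split => //; exists (fun n x => emb (q n x)); first exact: defining_of_real.
split; first by apply/fin_dim_quotientE; rewrite ker_emb.
move=> n; apply/fin_dim_quotientE; rewrite !ker_emb.
exact: (fdq_subl (subsp_kerp qC _) _ (q0 n.+1)).
Qed.

Lemma classM1P : classM E -> classM1 E <-> type1 q setT.
Proof.
move=> ME; split=> [[_ [P Pd [n Pn]]]|[n qn]].
  have [hE _ _] := ME; have [r [rC rD kr]] := real_of_defining hE Pd.
  have [m qr] := seminorms_kernel n rC rD qC qD.
  by exists m => x [_ /qr]; rewrite -kr Pn.
split => //; exists (fun n x => emb (q n x)); first exact: defining_of_real.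
exists n; rewrite ker_emb; apply/seteqP; split => x; first by move=> xn; apply: qn.
by move=> ->; exact: (subsp0 (subsp_kerp qC n)).
Qed.

Lemma weak_of_steps r : calibrated S r -> (forall n, fdq (kerp r n) (kerp r n.+1)) ->
  forall n m, fdq (kerp r n) (kerp r m).
Proof.
move=> rC rS n m; have [mn|/ltnW nm] := leqP m n.
  by exists [::] => // x xn; exists 0 => //; rewrite subr0; exact: (kerp_le rC mn).
rewrite -(subnK nm) addnC; elim: (m - n)%N => [|k IH].
  by rewrite addn0; exists [::] => // x xn; exists 0 => //; rewrite subr0.
apply: (fdq_trans (subsp_kerp rC n) IH).
rewrite addnS; apply: fdq_subl (rS (n + k)%N) => //; exact: (subsp_kerp rC _).
Qed.

Lemma classM2P : classM E -> classM2 E <-> type2 q setT.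
Proof.
move=> ME; split=> [[_ [P Pd [P0 PS Pn]]]|[n [nf weak nz]]].
  have [hE _ _] := ME; have [r [rC rD kr]] := real_of_defining hE Pd.
  have rS n : fdq (kerp r n) (kerp r n.+1).
    by rewrite -!kr; exact/fin_dim_quotientE.
  have [n qr] := seminorms_kernel 0 rC rD qC qD; exists n; split.
  - apply: contra_not P0 => qn; apply/fin_dim_quotientE; rewrite kr.
    exact: fdq_subr qr qn.
  - move=> m; have [m' rq] := seminorms_kernel m qC qD rC rD.
    apply: fdq_subr rq _; rewrite setTI.
    exact: (fdq_subl (subsp_kerp rC m') qr (weak_of_steps rC rS 0 m')).
  - move=> m; have [m' rq] := seminorms_kernel m qC qD rC rD.
    have [k m'k /existsNP[x /not_implyP[xk xk1]]] := Pn m'.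
    exists x; first by split => //; apply/rq/(kerp_le rC m'k); rewrite -kr.
    move=> x0; apply: xk1; rewrite kr x0; exact: (subsp0 (subsp_kerp rC _)).
(* The sequence is cut at [n], where the kernel has infinite codimension and is finite dimensional
   modulo the later ones. Its kernels never become constant: a nonzero vector in a constant tail
   would lie in all of them. *)
split => //; exists (fun k x => emb (q (n + k)%N x)).
  by apply: (@defining_of_real (fun k => q (n + k)%N)).
have kE k : ker (fun x => emb (q (n + k)%N x)) = kerp q (n + k).
  exact: (@ker_emb q (n + k)).
split.
- by rewrite kE addn0 => /fin_dim_quotientE.
- move=> k; rewrite !kE; apply/fin_dim_quotientE.
  apply: fdq_subl (weak (n + k.+1)%N) => //; first exact: (subsp_kerp qC _).
  by rewrite setTI; exact: (kerp_le qC (leq_addr k n)).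
- move=> m; apply: contrapT => H; have [x [_ xm] x0] := nz (n + m)%N.
  apply: x0; apply: (calibrated_sep qC) => k.
  have sub k' : (m <= k')%N -> kerp q (n + k')%N `<=` kerp q (n + k'.+1)%N.
    by move=> mk'; apply: contrapT => H'; apply: H; exists k' => //; rewrite !kE.
  suff : kerp q (n + (k + m))%N x by apply: (calibrated_ker qC); lia.
  by elim: k => // k IH; rewrite addSn; apply: (sub _ _ x IH); exact: leq_addl.
Qed.

Lemma classM3P : classM E -> classM3 E <-> type3 q setT.
Proof.
move=> ME; split=> [[_ [P Pd P3]]|q3].
  have [hE _ _] := ME; have [r [rC rD kr]] := real_of_defining hE Pd.
  move=> n; have [n' rq] := seminorms_kernel n qC qD rC rD.
  have [k n'k] := P3 n'; rewrite !kr => nf.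
  have [m qr] := seminorms_kernel k.+1 rC rD qC qD; exists m.
  rewrite setTI => qf; apply: nf; apply/fin_dim_quotientE.
  apply: (fdq_subl (subsp_kerp rC _) _ (fdq_subr qr qf)).
  by apply: subset_trans rq; exact: (kerp_le rC n'k).
split => //; exists (fun n x => emb (q n x)); first exact: defining_of_real.
move=> m; apply: contrapT => H; have [k] := q3 m; apply; rewrite setTI.
have steps n : (m <= n)%N -> fdq (kerp q n) (kerp q n.+1).
  move=> mn; apply: contrapT => nf; apply: H; exists n => //.
  by rewrite !ker_emb => /fin_dim_quotientE.
have st n : fdq (kerp (fun k => q (m + k)%N) n) (kerp (fun k => q (m + k)%N) n.+1).
  by have := steps (m + n)%N (leq_addr _ _); rewrite -addnS.
apply: (fdq_subr (kerp_le qC (leq_addl m k))).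
by have := weak_of_steps (shift_calibrated m) st 0%N k; rewrite /kerp addn0.
Qed.

End OneSpace.

Lemma linear_continuous_bounded (E F : tvsType K) (q : nat -> E -> R) (r : nat -> F -> R)
    (h : E -> F) :
  calibrated S q -> seminorms_define q -> calibrated S r -> seminorms_define r ->
  linear h -> (continuous h <->
    forall k, exists m (C : R), forall x, r k (h x) <= C * q m x).
Proof.
move=> qC qD rC rD hl; split=> [hc k|hb x U].
  have := hc 0 [set y | r k y < 1]; rewrite (lin0 hl) => /(_ _)/qD[].
    exact: seminorms_define_ball.
  move=> m [e [e0 me]]; exists m, (2 / e).
  apply: (@seminorm_bound _ (fun x => r k (h x)) (q m) e) => //; last first.
  - by move=> x xe; apply: me => /=; rewrite subr0.
  - exact: calibrated_seminorm qC m.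
  split=> [x y|a x]; first by rewrite (linD hl) (snD (calibrated_seminorm rC k)).
  by rewrite (linZ hl) (snZ (calibrated_seminorm rC k)).
move=> /rD[k [e [e0 eU]]]; have [m [C hm]] := hb k.
apply/qD; exists m, (e / (`|C| + 1)).
have C1 : 0 < `|C| + 1 by rewrite ltr_wpDl.
split; first by rewrite divr_gt0.
move=> y /=; rewrite ltr_pdivlMr// => ye; apply: eU => /=.
rewrite -(linB hl) (le_lt_trans (hm _))// (le_lt_trans _ ye)// mulrC.
rewrite ler_wpM2l ?(calibrated_ge0 qC)// (le_trans (ler_norm C))// lerDl.
exact: ler01.
Qed.

End Translation.

(** * Subspaces as topological vector spaces *)

Section Subspaces.
Context (K : numFieldType) (R : realType) (S : scalars K R).
Local Notation nrm := (nrm S).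
Local Notation emb := (emb S).
Context (X : tvsType K) (p : nat -> X -> R) (pC : calibrated S p)
  (pD : seminorms_define p).
Implicit Types (E F : linear_subspace X).

Local Notation incl := (sval : sub_tvs _ -> X).

Lemma subsp_carrier E : subsp (carrier E).
Proof.
have [E0 EZ] := carrier_submod_closed E.
split; first exact/set_mem.
by move=> a x y Ex Ey; apply/set_mem/EZ; exact/mem_set.
Qed.

Lemma incl_in E (u : sub_tvs E) : carrier E (incl u).
Proof. exact/set_mem/(svalP u). Qed.

(* Junk value: into E x = 0 when x is not in E. *)
Definition into E (x : X) : sub_tvs E :=
  if pselect (carrier E x) is left Ex then exist _ x (mem_set Ex) else 0.

Lemma intoK E x : carrier E x -> incl (into E x) = x.
Proof. by move=> Ex; rewrite /into; case: pselect. Qed.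

Lemma incl_inj E : injective (incl : sub_tvs E -> X).
Proof. exact: val_inj. Qed.

Lemma incl_linear E : linear (incl : sub_tvs E -> X).
Proof. by []. Qed.

Lemma inclZD E a (u v : sub_tvs E) : incl (a *: u + v) = a *: incl u + incl v.
Proof. by []. Qed.

Lemma inclB E (u v : sub_tvs E) : incl (u - v) = incl u - incl v.
Proof. by []. Qed.

Lemma inclZ E a (u : sub_tvs E) : incl (a *: u) = a *: incl u.
Proof. by []. Qed.

Lemma incl_sum E I (r : seq I) (F : I -> sub_tvs E) :
  incl (\sum_(i <- r) F i) = \sum_(i <- r) incl (F i).
Proof. by apply: (big_morph incl). Qed.

Lemma inclK E (u : sub_tvs E) : into E (incl u) = u.
Proof. by apply: incl_inj; rewrite intoK//; exact: incl_in. Qed.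

Lemma nbhs_incl E (u : sub_tvs E) (U : set (sub_tvs E)) :
  nbhs u U <-> exists2 V, nbhs (incl u) V & incl @^-1` V `<=` U.
Proof.
split=> [|[V Vu VU]].
  rewrite nbhsE => -[_ [[W oW <-] Wu] WU].
  by exists W => //; apply: open_nbhs_nbhs.
by apply: filterS VU _; exact: (@initial_continuous _ _ incl u V Vu).
Qed.

Definition pE E (n : nat) (u : sub_tvs E) : R := p n (incl u).

Lemma calibrated_sub E : calibrated S (pE (E := E)).
Proof.
split=> [n|n u|u u0].
- split=> [u v|a u]; first exact: (snD (calibrated_seminorm pC n)).
  exact: (snZ (calibrated_seminorm pC n)).
- exact: (calibrated_le pC _ (leqnSn n)).
- apply: incl_inj; exact: (calibrated_sep pC).
Qed.

Lemma seminorms_define_sub E : seminorms_define (pE (E := E)).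
Proof.
move=> u U; rewrite nbhs_incl; split=> [[V /pD[n [e [e0 eV]]] VU]|[n [e [e0 eU]]]].
  by exists n, e; split => // v /= ve; apply: VU; exact: eV.
exists [set y | p n (y - incl u) < e] => //.
by apply/pD; exists n, e; split.
Qed.

Lemma fdq_sub E (U V : set X) :
  fdq ((incl : sub_tvs E -> X) @^-1` U) (incl @^-1` V) <-> fdq (carrier E `&` U) V.
Proof.
split=> [[L LU Lg]|[L LU Lg]].
  exists (map incl L).
    by move=> _ /mapP[u uL ->]; split; [exact: incl_in|exact: LU].
  move=> x [Ex Ux]; have [|y Ly xy] := Lg (into E x); first by rewrite /= intoK.
  exists (incl y); first exact: (lin_lspan (@incl_linear E)).
  by move: xy => /=; rewrite /= intoK.
exists (map (into E) L).
  by move=> _ /mapP[x /LU[Ex Ux] ->]; rewrite /= intoK.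
move=> u /= Uu; have [y Ly uy] := Lg _ (conj (incl_in u) Uu).
exists (into E y).
  elim: L y Ly {Uu uy Lg} LU => [|x L IH] y /=.
    by move=> -> _; apply: incl_inj; rewrite intoK//; exact: (subsp0 (subsp_carrier E)).
  move=> [a ya] LU; exists a.
  have EL z : z \in x :: L -> carrier E z by move=> /LU[].
  have Ex : carrier E x by apply: EL; rewrite inE eqxx.
  have Ey : carrier E (y - a *: x).
    by apply: (lspan_sub (subsp_carrier E) _ ya) => z zL; apply: EL; rewrite inE zL orbT.
  suff -> : into E y - a *: into E x = into E (y - a *: x).
    by apply: IH => // z zL; apply: LU; rewrite inE zL orbT.
  apply: incl_inj; rewrite [RHS]intoK//.
  have Ey' : carrier E y.
    rewrite -(subrK (a *: x) y); apply: (subspD (subsp_carrier E)) => //.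
    exact: (subspZ (subsp_carrier E)).
  by rewrite inclB inclZ !intoK.
move: uy => /=; rewrite intoK//.
apply: (lspan_sub (subsp_carrier E) _ Ly) => z zL; by case: (LU z zL).
Qed.

Lemma fdq_subT E n : fdq setT (kerp (pE (E := E)) n) <-> fdq (carrier E) (kerp p n).
Proof. by have := fdq_sub E setT (kerp p n); rewrite setIT preimage_setT. Qed.

Lemma fdq_subI E n m : fdq (setT `&` kerp (pE (E := E)) n) (kerp (pE (E := E)) m) <->
  fdq (carrier E `&` kerp p n) (kerp p m).
Proof. by rewrite setTI; exact: (fdq_sub E (kerp p n) (kerp p m)). Qed.

Lemma type0_subE E : type0 (pE (E := E)) setT <-> type0 p (carrier E).
Proof. by split => H m; apply/fdq_subT; exact: H. Qed.

Lemma type1_subE E : type1 (pE (E := E)) setT <-> type1 p (carrier E).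
Proof.
split=> -[n H]; exists n.
  move=> x [Ex xn]; have := H (into E x); rewrite -{3}(intoK Ex) => -> //.
  by split => //; rewrite /kerp /pE /= intoK.
by move=> u [_ un]; apply: incl_inj; apply: H; split => //; exact: incl_in.
Qed.

Lemma type2_subE E : type2 (pE (E := E)) setT <-> type2 p (carrier E).
Proof.
split=> -[n [nf weak nz]]; exists n; split.
- by move=> /fdq_subT.
- by move=> m; apply/fdq_subI; exact: weak.
- move=> m; have [u [_ um] u0] := nz m; exists (incl u).
    by split => //; exact: incl_in.
  by move=> iu; apply: u0; exact: incl_inj.
- by move=> /fdq_subT.
- by move=> m; apply/fdq_subI; exact: weak.
- move=> m; have [x [Ex xm] x0] := nz m; exists (into E x).
    by split => //; rewrite /kerp /pE /= intoK.
  by move=> ix; apply: x0; rewrite -(intoK Ex) ix.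
Qed.

Lemma type3_subE E : type3 (pE (E := E)) setT <-> type3 p (carrier E).
Proof.
by split => H n; have [m nf] := H n; exists m => /fdq_subI.
Qed.

Lemma classM_sub E : metrizable X -> ~ fdq (carrier E) [set 0] -> classM (sub_tvs E).
Proof.
move=> [d [d0 deq dC dtri dn]] infE; split.
- exact: calibrated_hausdorff (@calibrated_sub E) (@seminorms_define_sub E).
- exists (fun u v => d (incl u) (incl v)); split => //.
  + by move=> u v; rewrite deq; split=> [/incl_inj|->].
  + move=> u U; rewrite nbhs_incl; split=> [[V /dn[e e0 eV] VU]|[e e0 eU]].
      by exists e => // v /= ve; apply: VU; exact: eV.
    exists [set y | d (incl u) y < e] => //.
    by apply/dn; exists e.
- move=> /fin_dim_quotientE H; apply: infE.
  have := fdq_sub E setT [set 0]; rewrite setIT preimage_setT => -[+ _]; apply.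
  suff -> : (incl : sub_tvs E -> X) @^-1` [set 0] = [set 0] by [].
  apply/seteqP; split=> u /= u0; last by rewrite u0.
  exact: incl_inj.
Qed.

Lemma isomorphicE E F : tvs_isomorphic (sub_tvs E) (sub_tvs F) <->
  isomorphic_sets p (carrier E) (carrier F).
Proof.
have qC := calibrated_sub; have qD := seminorms_define_sub.
split=> [[f [g [fg gf fc gc]]]|[f [g [fl fP gP fb gb]]]].
  have fl : linear f by exact: linearP.
  have gl : linear g.
    by move=> a x y; rewrite -{1}(gf x) -{1}(gf y) -fl fg.
  exists (fun x => incl (f (into E x))), (fun y => incl (g (into F y))); split.
  - move=> a x y Ex Ey; rewrite -[RHS]inclZD -fl; congr (incl (f _)).
    apply: incl_inj; rewrite [RHS]inclZD !intoK//.
    exact: (subsp_carrier E).2.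
  - by move=> x Ex; split; [exact: incl_in|rewrite inclK fg intoK].
  - by move=> x Ex; split; [exact: incl_in|rewrite inclK gf intoK].
  - move=> k; have [m [C CP]] := (linear_continuous_bounded (qC E) (qD E) (qC F) (qD F) fl).1 fc k.
    by exists m, C => x Ex; have := CP (into E x); rewrite /pE intoK.
  - move=> k; have [m [C CP]] := (linear_continuous_bounded (qC F) (qD F) (qC E) (qD E) gl).1 gc k.
    by exists m, C => x Ex; have := CP (into F x); rewrite /pE intoK.
pose h (u : sub_tvs E) := into F (f (incl u)).
have ih u : incl (h u) = f (incl u) by rewrite intoK//; case: (fP _ (incl_in u)).
pose h' (u : sub_tvs F) := into E (g (incl u)).
have ih' u : incl (h' u) = g (incl u) by rewrite intoK//; case: (gP _ (incl_in u)).
have hl : linear h.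
  move=> a u v; apply: incl_inj; rewrite inclZD !ih inclZD fl//; exact: incl_in.
have gl := lin_on_inverse (subsp_carrier E) fl fP gP.
have hl' : linear h'.
  move=> a u v; apply: incl_inj; rewrite inclZD !ih' inclZD gl//; exact: incl_in.
pose H : {linear sub_tvs E -> sub_tvs F} :=
  HB.pack h (GRing.isLinear.Build K (sub_tvs E) (sub_tvs F) _ h hl).
exists H, h'; split.
- by move=> u; apply: incl_inj; rewrite ih' /= ih; case: (fP _ (incl_in u)).
- by move=> u; apply: incl_inj; rewrite /= ih ih'; case: (gP _ (incl_in u)).
- apply/(linear_continuous_bounded (qC E) (qD E) (qC F) (qD F) hl) => k.
  have [m [C CP]] := fb k; exists m, C => u.
  by rewrite /pE ih; apply: CP; exact: incl_in.
- apply/(linear_continuous_bounded (qC F) (qD F) (qC E) (qD E) hl') => k.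
  have [m [C CP]] := gb k; exists m, C => u.
  by rewrite /pE ih'; apply: CP; exact: incl_in.
Qed.

Lemma pdenseE (A : set X) : dense A <-> pdense p A.
Proof.
split=> [dA x k e e0|dA O [x Ox] oO].
  have : nbhs x [set y | p k (y - x) < e] by apply/pD; exists k, e; split.
  rewrite nbhsE => -[U [oU Ux] Ue]; have [|y [Uy Ay]] := dA U _ oU; first by exists x.
  by exists y => //; rewrite (snC (calibrated_seminorm pC k)); exact: Ue.
have /pD[k [e [e0 eO]]] : nbhs x O by apply: open_nbhs_nbhs.
have [y Ay xy] := dA x k e e0; exists y; split => //.
by apply: eO; rewrite /= (snC (calibrated_seminorm pC k)).
Qed.

(** Step [n] takes [v n] if it is new and otherwise any vector of the span outside the current one,
    which infinite dimension provides; so the construction never stalls, and [v n] is reached by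
    step [n]. *)
Lemma basis_of_spanning (v : nat -> X) : ~ fdq (cspan v) [set 0] -> exists b : nat -> X,
  (forall n, indep [set 0] n b) /\ cspan b = cspan v.
Proof.
move=> inf.
have outside s : (forall i, i \in s -> cspan v i) -> exists2 x, cspan v x & ~ lspan s x.
  move=> sv; apply: contrapT => H; apply: inf; exists s => // x vx; exists x.
    by apply: contrapT => sx; apply: H; exists x.
  by rewrite subrr.
pose P (s : seq X) x := [/\ cspan v x, ~ lspan s x & lspan (rcons s x) (v (size s))].
have [b n bP||b bP] := @history_choice_cond X P.
- have bv i : i \in mkseq b n -> cspan v i.
    by move=> /mapP[j + ->]; rewrite mem_iota => /andP[_ /bP[]].
  rewrite /P size_mkseq; have [vin|vout] := pselect (lspan (mkseq b n) (v n)).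
    have [x vx xout] := outside _ bv; exists x; split => //.
    by apply/lspan_rcons; exists 0; rewrite scale0r subr0.
  exists (v n); split => //; first exact: mem_cspan.
  by apply: mem_lspan; rewrite mem_rcons inE eqxx.
- have [x vx xout] := outside [::] (fun i => ltac:(by [])).
  have [v0|v0] := eqVneq (v 0%N) 0.
    by exists x; split => //; rewrite /= v0; exists 0; rewrite scale0r subr0.
  exists (v 0%N); split; [exact: mem_cspan|exact/eqP|].
  by exists 1; rewrite scale1r subrr.
exists b; split.
  elim=> [|n IH] c //; rewrite combS => cb.
  have cn : c n = 0.
    apply: contrapT => /eqP cn; have [_ + _] := bP n; apply.
    suff -> : b n = - (c n)^-1 *: comb c b n.
      by apply: (subspZ (subsp_lspan _)); apply/lspan_comb; exists c.
    have -> : comb c b n = - (c n *: b n) by apply/eqP; rewrite -addr_eq0; exact/eqP.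
    by rewrite scaleNr scalerN opprK scalerA mulVf// scale1r.
  move=> i; rewrite ltnS leq_eqVlt => /predU1P[->//|]; apply: IH.
  by move: cb; rewrite cn scale0r addr0.
apply/seteqP; split; apply: cspan_sub; try exact: subsp_cspan.
  by move=> i; case: (bP i).
move=> i; exists i.+1; have [_ _] := bP i.
by rewrite size_mkseq mkseqS.
Qed.

(** Density in an infinite dimensional space makes the span of [v] infinite dimensional, so a Hamel
    basis indexed by [nat] can be extracted; the constructions themselves handle only spanning
    sequences. *)
Lemma calE_cspan E : ~ fdq setT [set (0 : X)] ->
  calE X E <-> pdense p (carrier E) /\ exists v, carrier E = cspan v.
Proof.
move=> infX; rewrite /calE /=; split=> [[/pdenseE dE [b [_ bgen]]]|[dE [v Ev]]].
  split => //; exists (incl \o b); apply/seteqP; split; last first.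
    by apply: cspan_sub (subsp_carrier E) _ => i; exact: incl_in.
  move=> x Ex; have [n [c xc]] := bgen (into E x).
  exists n; rewrite -(intoK Ex) xc incl_sum.
  apply: (subsp_sum (subsp_lspan _)) => i _; rewrite inclZ.
  apply: (subspZ (subsp_lspan _)).
  exact: (lspan_mkseq_mem (incl \o b) (ltn_ord i)).
split; first exact/pdenseE.
have [|b [bi bv]] := @basis_of_spanning v.
  by rewrite -Ev; exact: (dense_infinite pC dE infX).
have Eb i : carrier E (b i) by rewrite Ev -bv; exact: mem_cspan.
have inclb n (c : 'I_n -> K) : incl (\sum_(i < n) c i *: into E (b i)) = \sum_(i < n) c i *: b i.
  rewrite incl_sum; apply: eq_bigr => i _.
  by rewrite inclZ intoK.
exists (fun i => into E (b i)); split=> [n c|u].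
  move=> /(congr1 incl); rewrite inclb => c0 i.
  pose c' j := if insub j is Some k then c k else 0.
  have cE (k : 'I_n) : c' k = c k by rewrite /c' valK.
  rewrite -cE; apply: (bi n c') => //.
  by rewrite /set1 /= -[RHS]c0; apply: eq_bigr => k _; rewrite cE.
have : cspan b (incl u) by rewrite bv -Ev; exact: incl_in.
move=> [n /lspan_comb[c uc]]; exists n, (fun i => c i).
by apply: incl_inj; rewrite inclb uc.
Qed.

Definition subspace_of_span (v : nat -> X) : linear_subspace X.
Proof.
apply: (@LinearSubspace K X (cspan v)); split.
  by apply/mem_set; exact: (subsp0 (subsp_cspan v)).
move=> a x y /set_mem vx /set_mem vy; apply/mem_set.
exact: (subsp_cspan v).2.
Defined.

Lemma pcomplete_of_linear : linear_complete X -> pcomplete p.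
Proof.
move=> cX u uC; have [|x ux] := cX (u @ \oo) _.
  move=> U /pD[k [e [e0 eU]]]; have [N NP] := uC k e e0.
  exists (u @` [set i | (N <= i)%N]).
    by exists N => // i /= Ni; exists i.
  move=> _ _ [i Ni <-] [j Nj <-]; apply: eU => /=.
  by rewrite subr0; exact: NP.
exists x => k e e0.
have : nbhs x [set y | p k (y - x) < e] by apply/pD; exists k, e; split.
by move=> /ux[N _ NP]; exists N.
Qed.

Lemma pseparable_of_separable : separable X -> pseparable p.
Proof.
move=> [D /countable_injP[f finj] dD].
have [|x0 [_ Dx0]] := dD setT _ openT; first by exists 0.
have /choice[d dP] : forall n, exists x, D x /\ ((exists2 y, D y & f y = n) -> f x = n).
  move=> n; have [[y Dy fy]|ny] := pselect (exists2 y, D y & f y = n).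
    by exists y.
  by exists x0.
exists d => x k e e0; have [y Dy xy] := (pdenseE D).1 dD x k e e0.
exists (f y); have [Dd fd] := dP (f y).
suff -> : d (f y) = y by [].
by apply: finj; rewrite ?inE//; apply: fd; exists y.
Qed.

End Subspaces.

(** * From the types of traces to the four statements *)

Theorem theorem1p11 (K : numFieldType) (hK : real_or_complex K)
    (X : tvsType K) (hX : classF X) :
  (* (1) *)
  ([/\ classF0 X <-> calE X `&` subspaces_in X (@classM0 K) !=set0,
       calE X `&` subspaces_in X (@classM0 K) !=set0 <->
         calE X `<=` subspaces_in X (@classM0 K) &
       classF0 X -> pairwise_isomorphic (calE X)])
  /\
  (* (2) *)
  ([/\ ~ classF0 X <-> calE X `&` subspaces_in X (@classM1 K) !=set0,
       pairwise_isomorphic (calE X `&` subspaces_in X (@classM1 K)) &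
       classF1 X <-> calE X `<=` subspaces_in X (@classM1 K)])
  /\
  (* (3) *)
  ([/\ classF2 X \/ classF3 X <->
         calE X `&` subspaces_in X (@classM2 K) !=set0,
       classF3 X -> pairwise_isomorphic (calE X `&` subspaces_in X (@classM2 K)) &
       classF2 X ->
         (isomorphism_classes (calE X `&` subspaces_in X (@classM2 K)) #= `I_2)%card])
  /\
  (* (4) *)
  ((classF3 X <-> calE X `&` subspaces_in X (@classM3 K) !=set0) /\
   (classF3 X ->
      ~ countable
          (isomorphism_classes (calE X `&` subspaces_in X (@classM3 K))))).
Proof.
have [R [S]] := scalars_exist hK.
have [[hausX metX complX] sepX nfX] := hX.
have [p pC pD] := metrizable_seminorms S metX.
have infX : ~ fdq setT [set (0 : X)] by move=> /fin_dim_quotientE.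
have MX : classM X by [].
have cplt := pcomplete_of_linear pD complX.
have psep := pseparable_of_separable pC pD sepX.
have F0 : classF0 X <-> type0 p setT.
  by rewrite /classF0 -(classM0P pC pD MX); split=> [[]|].
have F1 : classF1 X <-> type1 p setT.
  by rewrite /classF1 -(classM1P pC pD MX); split=> [[]|].
have F2 : classF2 X <-> type2 p setT.
  by rewrite /classF2 -(classM2P pC pD MX); split=> [[]|].
have F3 : classF3 X <-> type3 p setT.
  by rewrite /classF3 -(classM3P pC pD MX); split=> [[]|].
pose good (v : nat -> X) := pdense p (cspan v).
have calP (E : linear_subspace X) : calE X E -> exists2 v, carrier E = cspan v & good v.
  by move=> /(calE_cspan pC pD E infX)[dE [v Ev]]; exists v => //; rewrite /good -Ev.
have MS (E : linear_subspace X) : calE X E -> classM (sub_tvs E).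
  move=> /(calE_cspan pC pD E infX)[dE _]; apply: (classM_sub pC pD metX).
  exact: (dense_infinite pC dE infX).
have qC := @calibrated_sub K R S X p pC; have qD := @seminorms_define_sub K R X p pD.
have M0E E : calE X E -> subspaces_in X (@classM0 K) E <-> type0 p (carrier E).
  by move=> /MS ME; rewrite /subspaces_in /= (classM0P (qC E) (qD E) ME) type0_subE.
have M1E E : calE X E -> subspaces_in X (@classM1 K) E <-> type1 p (carrier E).
  by move=> /MS ME; rewrite /subspaces_in /= (classM1P (qC E) (qD E) ME) type1_subE.
have M2E E : calE X E -> subspaces_in X (@classM2 K) E <-> type2 p (carrier E).
  by move=> /MS ME; rewrite /subspaces_in /= (classM2P (qC E) (qD E) ME) type2_subE.
have M3E E : calE X E -> subspaces_in X (@classM3 K) E <-> type3 p (carrier E).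
  by move=> /MS ME; rewrite /subspaces_in /= (classM3P (qC E) (qD E) ME) type3_subE.
have mk v : good v -> calE X (subspace_of_span v).
  by move=> gv; apply/(calE_cspan pC pD _ infX); split => //; exists v.
have isoE := isomorphicE pC pD.
have denseC E v : calE X E -> carrier E = cspan v -> pdense p (cspan v).
  by move=> /(calE_cspan pC pD E infX)[dE _] <-.
have member v : good v -> carrier (subspace_of_span v) = cspan v by [].
have [v0 dv0] := dense_exists psep.
have X01 : type0 p setT -> type1 p setT -> False.
  by move=> x0 x1; apply: infX; exact: (type01 (@subspT _ _) x0 x1).
have Xcases : [\/ type0 p setT, type1 p setT, type2 p setT | type3 p setT].
  exact: type_cases.
have dense0 E : calE X E -> type0 p (carrier E) <-> type0 p setT.
  by move=> /calP[v -> dv]; exact: (dense_type0 pC dv).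
have ex2 : ~ type0 p setT -> ~ type1 p setT ->
    calE X `&` subspaces_in X (@classM2 K) !=set0.
  move=> x0 x1; have [v dv v2] := type2_exists pC psep x0 x1.
  by exists (subspace_of_span v); split; [exact: mk|apply/M2E => //; exact: mk].
have ex2P : calE X `&` subspaces_in X (@classM2 K) !=set0 ->
    type2 p setT \/ type3 p setT.
  move=> [E [cE /(M2E E cE) E2]]; case: Xcases => [x0|x1|x2|x3].
  - by exfalso; apply: type02 E2; apply/dense0.
  - by exfalso; apply: type12 E2; exact: type1_sub x1.
  - by left.
  - by right.
split; [split|split; [split|split; [split|split]]].
- rewrite F0; split=> [x0|[E [cE /(M0E E cE)/dense0]]]; last exact.
  exists (subspace_of_span v0); split; first exact: mk.
  by apply/M0E; [exact: mk|apply/dense0 => //; exact: mk].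
- split=> [[E [cE /(M0E E cE)/dense0 x0]] F cF|H].
    by apply/M0E => //; apply/dense0 => //; exact: x0.
  by exists (subspace_of_span v0); split; [exact: mk|apply: H; exact: mk].
- move=> /F0 x0 E F /calP[v Ev dv] /calP[w Fw dw]; apply/isoE; rewrite Ev Fw.
  exact: (type0_isomorphic pC cplt infX x0).
- rewrite F0; split=> [x0|[E [cE /(M1E E cE) E1]] x0].
    have [v dv v1] := type1_exists pC psep x0.
    by exists (subspace_of_span v); split; [exact: mk|apply/M1E => //; exact: mk].
  have E0 : type0 p (carrier E) by apply/dense0.
  have [v Ev dv] := calP E cE; rewrite Ev in E0 E1.
  exact: (dense_not_type01 pC infX dv).
- move=> E F [cE /(M1E E cE) E1] [cF /(M1E F cF) F1']; apply/isoE.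
  have [v Ev dv] := calP E cE; have [w Fw dw] := calP F cF; rewrite Ev Fw in E1 F1' *.
  exact: (type1_isomorphic pC).
- rewrite F1; split=> [x1 E cE|H]; first by apply/M1E => //; exact: type1_sub x1.
  (* Outside F_0 and F_1 the space has a dense subspace of type 2, and in F_0 every dense subspace
     has type 0; either way some member of [calE X] is not of type 1. *)
  have no2 : calE X `&` subspaces_in X (@classM2 K) !=set0 -> False.
    move=> [E [cE /(M2E E cE) E2]]; apply: type12 E2.
    by apply/(M1E E cE)/H.
  apply: contrapT => x1; have [x0|x0] := pselect (type0 p setT); last exact/no2/ex2.
  apply: (dense_not_type01 pC infX dv0).
    exact/(dense_type0 pC dv0).
  by have /(M1E _ (mk _ dv0)) := H _ (mk _ dv0).
- rewrite F2 F3; split=> [x23|]; last exact: ex2P.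
  apply: ex2.
    by case: x23 => [x2|x3] x0; [exact: type02 x0 x2|exact: (type03 pC x0 x3)].
  by case: x23 => [x2|x3] x1; [exact: type12 x1 x2|exact: (type13 pC x1 x3)].
- move=> /F3 x3 E F [cE /(M2E E cE) E2] [cF /(M2E F cF) F2']; apply/isoE.
  have [v Ev dv] := calP E cE; have [w Fw dw] := calP F cF; rewrite Ev Fw in E2 F2' *.
  exact: (type3_isomorphic pC cplt x3).
- move=> /F2 x2; set A := calE X `&` _.
  pose fl (E : linear_subspace X) := full p (carrier E).
  have iso_full E F : A E -> A F -> (tvs_isomorphic (sub_tvs E) (sub_tvs F) <-> (fl E <-> fl F)).
    move=> [cE /(M2E E cE) E2] [cF /(M2E F cF) F2'].
    have [v Ev dv] := calP E cE; have [w Fw dw] := calP F cF.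
    split=> [/isoE iso|EF]; [split|].
    + apply: (full_invariant pC cplt (subsp_carrier E) (subsp_carrier F) _ x2 iso).
      by rewrite Fw.
    + have osi := isomorphic_sets_sym (subsp_carrier E) iso.
      apply: (full_invariant pC cplt (subsp_carrier F) (subsp_carrier E) _ x2 osi).
      by rewrite Ev.
    + apply/isoE; rewrite /fl Ev Fw in EF E2 F2' *.
      have [fv|nfv] := pselect (full p (cspan v)).
        by apply: (full_isomorphic pC) => //; apply/EF.
      apply: (not_full_isomorphic pC) => //.
      by move=> /EF.
  have [[v [dv v2 vf]] [w [dw w2 wf]]] := full_and_not_full pC psep x2.
  have Av : A (subspace_of_span v) by split; [exact: mk|apply/M2E => //; exact: mk].
  have Aw : A (subspace_of_span w) by split; [exact: mk|apply/M2E => //; exact: mk].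
  pose c (n : nat) : set (linear_subspace X) :=
    if n == 0%N then A `&` [set E | fl E] else A `&` [set E | ~ fl E].
  have classE E : A E -> A `&` [set T | tvs_isomorphic (sub_tvs E) (sub_tvs T)] =
      if `[< fl E >] then c 0%N else c 1%N.
    move=> AE; case: asboolP => fE; apply/seteqP; split=> F /= [AF].
    + by move=> /(iso_full _ _ AE AF) EF; split => //; apply/EF.
    + by move=> fF; split => //; apply/(iso_full _ _ AE AF).
    + by move=> /(iso_full _ _ AE AF) EF; split => // /EF.
    + by move=> fF; split => //; apply/(iso_full _ _ AE AF).
  apply/card_esym/card_set_bijP; exists c; split.
  + case=> [|[|//]] _.
      by exists (subspace_of_span v) => //; rewrite classE//; case: asboolP.
    by exists (subspace_of_span w) => //; rewrite classE//; case: asboolP.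
  + have c01 : c 0%N <> c 1%N.
      move=> c01; have : c 0%N (subspace_of_span v) by [].
      by rewrite c01 => -[].
    move=> i j; rewrite !inE /= => i2 j2.
    case: i i2 => [|[|//]] _; case: j j2 => [|[|//]] _ // /esym.
    by move=> ij; case: (c01 ij).
  + move=> _ [E AE <-]; rewrite classE//.
    by case: asboolP => _; [exists 0%N|exists 1%N].
- rewrite F3; split=> [x3|[E [cE /(M3E E cE) E3]]]; last exact: (type3_super pC (@subsetT _ _) E3).
  have [v [dv v3 _]] := narrow_dense_exists pC (d := fun=> 1) x3 psep
    (fun=> ltr01) (fun _ _ _ => lexx _).
  by exists (subspace_of_span v); split; [exact: mk|apply/M3E => //; exact: mk].
- move=> /F3 x3; set A := calE X `&` _ => /countable_injP[h hinj].
  have [v1 [dv1 v13 _]] := narrow_dense_exists pC (d := fun=> 1) x3 psep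
    (fun=> ltr01) (fun _ _ _ => lexx _).
  pose cl (E : linear_subspace X) := A `&` [set T | tvs_isomorphic (sub_tvs E) (sub_tvs T)].
  (* [e n] spans a representative of the class numbered [n], with [v1] for numbers that no class
     has. A subspace isomorphic to none of these contradicts countability. *)
  have /choice[e eP] : forall n, exists v, [/\ good v, type3 p (cspan v) &
      forall E, A E -> h (cl E) = n -> tvs_isomorphic (sub_tvs E) (sub_tvs (subspace_of_span v))].
    move=> n; have [[E AE hE]|nE] := pselect (exists2 E, A E & h (cl E) = n); last first.
      by exists v1; split => // E AE hE; exfalso; apply: nE; exists E.
    have [cE /(M3E E cE) E3] := AE; have [v Ev dv] := calP E cE.
    exists v; split => //; first by rewrite -Ev.
    move=> F AF hF; have : cl F = cl E.
      by apply: hinj; rewrite ?inE ?hF ?hE//; [exists F|exists E].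
    have EE : cl E E.
      by split => //; apply/isoE; exact: isomorphic_sets_refl.
    move=> FE; have [_ /isoE FE'] : cl F E by rewrite FE.
    by apply/isoE; rewrite /= -Ev.
  have [w [dw w3 wnew]] := type3_new_class pC (e := e) x3 psep (fun n => let: And3 _ a _ := eP n in a).
  have Aw : A (subspace_of_span w) by split; [exact: mk|apply/M3E => //; exact: mk].
  have [_ _ /(_ _ Aw erefl)/isoE] := eP (h (cl (subspace_of_span w))).
  exact: wnew.
Qed.
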